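(* The terminal $\mathtt{ggGrc}$-operad $\mathsf 1_{\mathtt{ggGrc}}$, with $\mathsf 1_{\mathtt{ggGrc}}(\Gamma)=\Bbbk$ for each $\Gamma\in\mathtt{ggGrc}$ and constant composition laws, is binary quadratic.
   Context: $\Bbbk$ is a field of characteristic $0$; operads have values in graded $\Bbbk$-vector spaces. **The operadic category $\mathtt O=\mathtt{ggGrc}$.** An ordered graph $\Gamma$ has vertices $V=\{1,\dots,n\}$, $n\ge1$, a finite set $\mathrm{Fl}$ of half-edges, a map $g:\mathrm{Fl}\to V$, an involution $\sigma$ of $\mathrm{Fl}$, a linear order on each $g^{-1}(v)$ (local orders) and a linear order on the set of fixed points of $\sigma$, called legs (global order); half-edges are taken to be $\{1,\dots,m\}$, ordered first by vertex and then locally. Two-element orbits of $\sigma$ are internal edges and $e(\Gamma)$ is their number. Objects of $\mathtt{ggGrc}$ are connected ordered graphs with a genus $g(v)\in\mathbb N$ for each vertex; the genus of $\Gamma$ is $\sum_vg(v)+b_1(\Gamma)$. A morphism $\Gamma'\to\Gamma''$ is a pair $(\psi,\varphi)$: an injection $\psi:\mathrm{Fl}''\to\mathrm{Fl}'$ commuting with involutions and restricting to a bijection of legs preserving the global orders, and a surjection $\varphi:V'\to V''$ with $\varphi g'\psi=g''$, such that if $h\notin\mathrm{Im}\,\psi$ then $\varphi g'(h)=\varphi g'(\sigma'h)$, all fibers are connected, and the genus of each $v\in V''$ equals the genus of the fiber over $v$. The fiber over $v$ has vertices $\varphi^{-1}(v)$ (renumbered order-preservingly), half-edges $h\in\mathrm{Fl}'$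 with $\varphi g'(h)=v$, involution $h\mapsto\sigma'(h)$ if $h\notin\mathrm{Im}\,\psi$ and $h\mapsto h$ if $h\in\mathrm{Im}\,\psi$, inherited local orders and vertex genera, and global order transported along $\psi$ from the local order at $v$. Put $|\Gamma|=V$, $|(\psi,\varphi)|=\varphi$; for $f:\Gamma\to\Gamma'$, $g:\Gamma'\to\Gamma''$ the induced map $f_v:(gf)^{-1}(v)\to g^{-1}(v)$ is the restriction of $f$. Local terminal objects (terminal in their connected component) are the one-vertex graphs without internal edges; the trivial (chosen local terminal) ones are those whose local and global orders agree. **Markl operads over $\mathtt O$.** $\mathtt O_{\rm iso}$ is the groupoid of isomorphisms. $\phi:T\to S$ with $|\phi|$ order-preserving is elementary (at $i\in|S|$) if all its fibers are trivial except $F=\phi^{-1}(i)$, and $e(F)\ge1$; notation $F\triangleright_iT\xrightarrow{\phi}S$. A (strictly unital) operad $M$ over $\mathtt O$ is a presheaf of graded vector spaces on $\mathtt O_{\rm iso}$ with degree $0$ maps $\circ_\phi:M(S)\otimes M(F)\to M(T)$ for all elementary $F\triangleright T\xrightarrow{\phi}S$ and $\eta_U:\Bbbk\to M(U)$ for trivial $U$, such that: (a) if $F\triangleright_jT\xrightarrow{\phi}S$, $G\triangleright_iS\xrightarrow{\psi}P$, $|\psi|(j)=i$, $\xi=\psi\phi$, then $\circ_\xi(\mathrm{id}\otimes\circ_{\phi_i})=\circ_\phi(\circ_\psi\otimes\mathrm{id})$ on $M(P)\otimes M(G)\otimes M(F)$; (b) if $\psi'\phi'=\psi''\phi'':T\to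 S$ with $\phi',\psi',\phi'',\psi''$ elementary at $j,i,l,k$ and $|\psi''|(l)=i\ne k=|\psi'|(j)$ (then $\phi',\psi''$ have the same nontrivial fiber $F$, and $\phi'',\psi'$ the same nontrivial fiber $G$), then $\circ_{\phi'}(\circ_{\psi'}\otimes\mathrm{id})(\mathrm{id}\otimes\tau)=\circ_{\phi''}(\circ_{\psi''}\otimes\mathrm{id})$ on $M(S)\otimes M(F)\otimes M(G)$, $\tau$ the symmetry; (u) with $\eta_u:=!^*\eta_U$ for $u$ local terminal, $!:u\to U$, $U$ trivial: whenever $F\triangleright T\xrightarrow{!}u$, $M(T)=M(F)$ and $\circ_!(\eta_u\otimes\mathrm{id})=\mathrm{id}$; (c) if $\phi''\omega=\sigma\phi'$ with $\omega,\sigma$ isomorphisms, $F'\triangleright_iT'\xrightarrow{\phi'}S'$, $F''\triangleright_jT''\xrightarrow{\phi''}S''$, then $\omega^*\circ_{\phi''}=\circ_{\phi'}(\sigma^*\otimes\omega_j^* )$, where $\omega_j:F\to F''$, $F=(\phi''\omega)^{-1}(j)$, and $M(F)=M(F')$ by (u). It is $1$-connected if all $\eta_U$ are isomorphisms. **Quadratic operads.** A $1$-connected collection is a presheaf $E$ of graded vector spaces on $\mathtt O_{\rm iso}$ with $E(T)=0$ if $e(T)=0$; $E(T)=E(F)$ whenever $F$ is the fiber of $T\to u$, $u$ local terminal; and $E(\phi')=E(\phi'')$ if $\phi'':F'\to F''$ is the map induced between the fibers over a local terminal $t$ by an isomorphism $\phi':T'\to S'$ over $t$. $\mathbb F(E)$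 is the free $1$-connected operad on $E$ (left adjoint to $M\mapsto\{M(T)\text{ if }e(T)\ge1;\,0\text{ otherwise}\}$). It has a weight grading $\mathbb F(E)=\bigoplus_{k\ge0}\mathbb F^k(E)$, additive under $\circ_\phi$, with $\mathbb F^0(E)(T)=\Bbbk$ if $e(T)=0$ and $0$ otherwise, and $\mathbb F^1(E)=E$. An ideal $I$ in $M$ is a sub-presheaf with $\circ_\phi(a\otimes b)\in I$ if $a\in I$ or $b\in I$; $(R)$ is the smallest ideal containing $R$. A $1$-connected operad is quadratic if it is isomorphic to $\mathbb F(E)/(R)$ with $R\subset\mathbb F^2(E)$ a sub-presheaf on $\mathtt O_{\rm iso}$; it is binary if moreover $E(T)\ne0$ implies $e(T)=1$. *)

(* Defs.v *)
From HB Require Import structures.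
From mathcomp Require Import all_boot all_order all_algebra.
From Stdlib Require Import Eqdep.
Set Implicit Arguments. Unset Strict Implicit. Unset Printing Implicit Defensive.
Import Order.TTheory GRing.Theory Num.Theory.

(* Half-edges are numbered first by vertex, then by local order, so the local
   order at a vertex is the restriction of the order of 'I_nh; legs lists the
   fixed points of flip in their global order. *)
Record pregraph := Pregraph {
  nv : nat;
  nh : nat;
  vtx : {ffun 'I_nh -> 'I_nv};
  flip : {ffun 'I_nh -> 'I_nh};
  legs : seq 'I_nh;
  vgen : {ffun 'I_nv -> nat} }.

Definition adj (G : pregraph) : rel 'I_(nv G) :=
  fun x y => [exists h, (vtx G h == x) && (vtx G (flip G h) == y)].

Definition connected (G : pregraph) : bool :=
  (0 < nv G) && [forall x, forall y, connect (@adj G) x y].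

Definition edges (G : pregraph) : {set {set 'I_(nh G)}} :=
  [set [set h; flip G h] | h in [pred h | flip G h != h]].

Definition ne (G : pregraph) : nat := #|edges G|.

(* First Betti number: edges - vertices + connected components. *)
Definition betti1 (G : pregraph) : int :=
  ((ne G)%:Z - (nv G)%:Z + (n_comp (@adj G) predT)%:Z)%R.

Definition genus (G : pregraph) : int :=
  (\sum_x (vgen G x)%:Z + betti1 G)%R.

Definition ordered_graph (G : pregraph) : bool :=
  [&& [forall h : 'I_(nh G), forall h' : 'I_(nh G),
         (h <= h') ==> (vtx G h <= vtx G h')],
      [forall h, flip G (flip G h) == h],
      uniq (legs G)
    & [forall h, (h \in legs G) == (flip G h == h)]].

Record ggGrc := GgGrc {
  graph_of :> pregraph;
  ggGrcP : ordered_graph graph_of && connected graph_of }.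

Record premor (G H : pregraph) := Premor {
  hmap : {ffun 'I_(nh H) -> 'I_(nh G)};
  vmap : {ffun 'I_(nv G) -> 'I_(nv H)} }.

(* enum_val and enum_rank_in number a subset of an ordinal type increasingly.
   The if keeps the half-edges in the image of hmap as legs of the fiber. *)
Section Prefiber.
Variables (G H : pregraph) (f : premor G H) (v : 'I_(nv H)).

Definition fvert : {set 'I_(nv G)} := [set x | vmap f x == v].
Definition fhalf : {set 'I_(nh G)} := [set h | vmap f (vtx G h) == v].

Lemma fhalf_vtx (h : 'I_#|fhalf|) : vtx G (enum_val h) \in fvert.
Proof. by move: (enum_valP h); rewrite !inE. Qed.

Definition prefiber : pregraph := Pregraph
  [ffun h => enum_rank_in (fhalf_vtx h) (vtx G (enum_val h))]
  [ffun h => enum_rank_in (enum_valP h)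
     (if enum_val h \in codom (hmap f) then enum_val h else flip G (enum_val h))]
  (pmap (fun h => [pick k : 'I_#|fhalf| | enum_val k == hmap f h])
        (enum [pred h | vtx H h == v]))
  [ffun x : 'I_#|fvert| => vgen G (enum_val x)].

End Prefiber.

(* hmap is the injection psi on half-edges, vmap the surjection phi on vertices. *)
Definition is_mor (G H : pregraph) (f : premor G H) : bool :=
  [&& injectiveb (hmap f),
      [forall h, hmap f (flip H h) == flip G (hmap f h)],
      map (hmap f) (legs H) == legs G,
      [forall v, v \in codom (vmap f)],
      [forall h, vmap f (vtx G (hmap f h)) == vtx H h],
      [forall h, (h \notin codom (hmap f)) ==>
                 (vmap f (vtx G h) == vmap f (vtx G (flip G h)))],
      [forall v, connected (prefiber f v)]
    & [forall v, ((vgen H v)%:Z == genus (prefiber f v))%R]].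

Record mor (G H : ggGrc) := Mor {
  mor_val :> premor G H;
  morP : is_mor mor_val }.

Definition precomp (G H K : pregraph) (f : premor G H) (g : premor H K) : premor G K :=
  Premor [ffun h => hmap f (hmap g h)] [ffun x => vmap g (vmap f x)].

Lemma sorted_enum_ord n (A : {pred 'I_n}) : sorted ltn (map val (enum A)).
Proof.
rewrite (_ : map val (enum A) = filter (fun k => [exists x in A, val x == k]) (iota 0 n)).
  by apply: sorted_filter; [exact: ltn_trans | exact: iota_ltn_sorted].
rewrite -val_enum_ord filter_map enumT; congr map.
rewrite {1}/enum_mem; apply: eq_filter => x /=.
apply/idP/existsP => [xA|[y /andP[yA /eqP/val_inj <-]] //].
by exists x; rewrite eqxx andbT.
Qed.

Lemma enum_val_lt n (A : {set 'I_n}) (i j : 'I_#|A|) :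
  (enum_val i < enum_val j) = (i < j).
Proof.
have sA := sorted_enum_ord (mem A).
case: (leqP n 0) => [n0|n0].
  by have := ltn_ord (enum_val i); rewrite ltnNge (leq_trans n0).
pose x0 : 'I_n := Ordinal n0.
have szA : size (map val (enum A)) = #|A| by rewrite size_map -cardE.
have E (k : 'I_#|A|) : val (enum_val k) = nth (val x0) (map val (enum A)) k.
  by rewrite (enum_val_nth x0) (nth_map x0) // -cardE.
have L a b : a < b < #|A| ->
   nth (val x0) (map val (enum A)) a < nth (val x0) (map val (enum A)) b.
  case/andP=> ab bA; apply: (sorted_ltn_nth ltn_trans) => //;
  by rewrite inE szA // (ltn_trans ab).
rewrite !E; case: (ltngtP i j) => [ij|ji|ij].
- by rewrite L // ij ltn_ord.
- by apply/negbTE; rewrite -leqNgt ltnW // L // ji ltn_ord.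
- by rewrite ij ltnn.
Qed.

Lemma enum_val_le n (A : {set 'I_n}) (i j : 'I_#|A|) :
  (enum_val i <= enum_val j) = (i <= j).
Proof. by rewrite leqNgt enum_val_lt -leqNgt. Qed.

Lemma ord_mono_id n (a : 'I_n -> 'I_n) : (forall i j : 'I_n, i < j -> a i < a j) -> a =1 id.
Proof.
move=> am.
have lo m : forall i : 'I_n, val i = m -> m <= a i.
  elim: m => // m IH i im.
  have mn : m < n by have := ltn_ord i; rewrite im; apply: ltnW.
  have := IH (Ordinal mn) erefl => /leq_ltn_trans; apply; apply: am.
  by rewrite im /=.
have hi m : forall i : 'I_n, (val i).+1 + m = n -> (a i).+1 + m <= n.
  elim: m => [|m IH] i im.
    by rewrite addn0 ltn_ord.
  have mn : (val i).+1 < n by apply: (@leq_trans ((val i).+1 + m.+1)); [rewrite addnS ltnS leq_addr | rewrite im].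
  have /IH: (val (Ordinal mn)).+1 + m = n by rewrite /= addSnnS.
  apply: leq_trans; rewrite addnS -addSn leq_add2r ltnS.
  by apply: am => /=.
move=> i; apply: val_inj; apply/eqP; rewrite /= eqn_leq [X in _ && X](lo _ i erefl) andbT.
have e : (val i).+1 + (n - (val i).+1) = n by rewrite subnKC // ltn_ord.
by have := hi _ _ e; rewrite -[leqRHS]e leq_add2r ltnS.
Qed.

Lemma pregraph_eq (G H : pregraph)
    (a : 'I_(nv G) -> 'I_(nv H)) (b : 'I_(nh G) -> 'I_(nh H)) :
  bijective a -> bijective b ->
  (forall i j : 'I_(nv G), i < j -> a i < a j) ->
  (forall i j : 'I_(nh G), i < j -> b i < b j) ->
  (forall h, vtx H (b h) = a (vtx G h)) ->
  (forall h, flip H (b h) = b (flip G h)) ->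
  legs H = map b (legs G) ->
  (forall x, vgen H (a x) = vgen G x) ->
  G = H.
Proof.
case: G a b => n m vt fl lg vg; case: H => n' m' vt' fl' lg' vg' /= a b ba bb.
have nn : n = n' by have := bij_eq_card ba; rewrite !card_ord.
have mm : m = m' by have := bij_eq_card bb; rewrite !card_ord.
subst n' m' => /ord_mono_id ia /ord_mono_id ib Hv Hf Hl Hg.
have -> : vt = vt' by apply/ffunP=> h; have := Hv h; rewrite ia ib.
have -> : fl = fl' by apply/ffunP=> h; have := Hf h; rewrite !ib.
have -> : vg = vg' by apply/ffunP=> h; have := Hg h; rewrite ia.
by rewrite Hl (eq_map ib) map_id.
Qed.

Lemma ggGrc_eq (G H : ggGrc) : graph_of G = graph_of H -> G = H.
Proof. by case: G H => G p [H q] /= e; subst H; rewrite (bool_irrelevance p q). Qed.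

Lemma mor_eq (G H : ggGrc) (f g : mor G H) : mor_val f = mor_val g -> f = g.
Proof. by case: f g => f p [g q] /= e; subst g; rewrite (bool_irrelevance p q). Qed.

Record mor_spec (G H : pregraph) (f : premor G H) : Prop := MorSpec {
  mor_inj : injective (hmap f);
  mor_flip : forall h, hmap f (flip H h) = flip G (hmap f h);
  mor_legs : map (hmap f) (legs H) = legs G;
  mor_surj : forall v, exists x, vmap f x = v;
  mor_vtx : forall h, vmap f (vtx G (hmap f h)) = vtx H h;
  mor_contr : forall h, h \notin codom (hmap f) ->
     vmap f (vtx G h) = vmap f (vtx G (flip G h));
  mor_conn : forall v, connected (prefiber f v);
  mor_genus : forall v, ((vgen H v)%:Z = genus (prefiber f v))%R }.

Lemma is_morP (G H : pregraph) (f : premor G H) : reflect (mor_spec f) (is_mor f).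
Proof.
apply: (iffP idP) => [|[i1 i2 i3 i4 i5 i6 i7 i8]].
  case/and5P=> /injectiveP i1 /forallP i2 /eqP i3 /forallP i4 /and4P[/forallP i5 /forallP i6
    /forallP i7 /forallP i8].
  split=> //.
  - by move=> h; apply/eqP.
  - by move=> v; have /codomP[x ->] := i4 v; exists x.
  - by move=> h; apply/eqP.
  - by move=> h hc; apply/eqP; have /implyP := i6 h; apply.
  - by move=> v; apply/eqP.
apply/and5P; split; last (apply/and4P; split).
- exact/injectiveP.
- by apply/forallP=> h; apply/eqP.
- exact/eqP.
- by apply/forallP=> v; have [x <-] := i4 v; apply: codom_f.
- by apply/forallP=> h; apply/eqP.
- by apply/forallP=> h; apply/implyP=> hc; apply/eqP/i6.
- exact/forallP.
- by apply/forallP=> v; apply/eqP.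
Qed.

Record graph_spec (G : pregraph) : Prop := GraphSpec {
  g_mono : forall h h' : 'I_(nh G), h <= h' -> vtx G h <= vtx G h';
  g_flip : involutive (flip G);
  g_uniq : uniq (legs G);
  g_legs : forall h, (h \in legs G) = (flip G h == h) }.

Lemma ordered_graphP G : reflect (graph_spec G) (ordered_graph G).
Proof.
apply: (iffP idP) => [|[i1 i2 i3 i4]].
  case/and4P=> /forallP i1 /forallP i2 i3 /forallP i4; split=> //.
  - by move=> h h'; have /forallP/(_ h')/implyP := i1 h.
  - by move=> h; apply/eqP.
  - by move=> h; apply/eqP.
apply/and4P; split=> //.
- by apply/forallP=> h; apply/forallP=> h'; apply/implyP/i1.
- by apply/forallP=> h; apply/eqP.
- by apply/forallP=> h; apply/eqP.
Qed.

Section Fib.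
Variables (G H : pregraph) (f : premor G H).

Lemma fib_vtx v (h : 'I_(nh (prefiber f v))) :
  enum_val (vtx (prefiber f v) h) = vtx G (enum_val h).
Proof. by rewrite ffunE enum_rankK_in // fhalf_vtx. Qed.

Lemma fib_vgen v (x : 'I_(nv (prefiber f v))) :
  vgen (prefiber f v) x = vgen G (enum_val x).
Proof. by rewrite ffunE. Qed.

Hypothesis contr : forall h, h \notin codom (hmap f) ->
     vmap f (vtx G h) = vmap f (vtx G (flip G h)).

Lemma fib_flip v (h : 'I_(nh (prefiber f v))) :
  enum_val (flip (prefiber f v) h) =
  if enum_val h \in codom (hmap f) then enum_val h else flip G (enum_val h).
Proof.
rewrite ffunE enum_rankK_in //.
case: ifP => hc; first exact: enum_valP.
by have := enum_valP h; rewrite !inE (contr (negbT hc)).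
Qed.

Hypothesis vtxf : forall h, vmap f (vtx G (hmap f h)) = vtx H h.

Lemma fib_legs v : map (fun k : 'I_(nh (prefiber f v)) => enum_val k) (legs (prefiber f v)) =
  map (hmap f) (enum [pred h | vtx H h == v]).
Proof.
rewrite /=.
have: all [pred h | vtx H h == v] (enum [pred h | vtx H h == v]).
  by apply/allP=> h; rewrite mem_enum.
elim: (enum _) => //= h s IH /andP[/eqP hv /IH <-].
have hin : hmap f h \in fhalf f v by rewrite inE vtxf hv.
case: pickP => [k /eqP /= <- //|/(_ (enum_rank_in hin (hmap f h)))].
by rewrite enum_rankK_in // eqxx.
Qed.

End Fib.

Lemma prefiber_ordered_gen (G H : pregraph) (f : premor G H) v :
  ordered_graph G -> injective (hmap f) ->
  (forall h, hmap f (flip H h) = flip G (hmap f h)) ->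
  map (hmap f) (legs H) = legs G ->
  (forall h, vmap f (vtx G (hmap f h)) = vtx H h) ->
  (forall h, h \notin codom (hmap f) -> vmap f (vtx G h) = vmap f (vtx G (flip G h))) ->
  ordered_graph (prefiber f v).
Proof.
move=> /ordered_graphP[gm gf gu gl] i1 i2 i3 i5 i6.
apply/ordered_graphP; split.
- move=> h h' hh; rewrite -enum_val_le !fib_vtx; apply: gm.
  by rewrite enum_val_le.
- move=> h; apply: enum_val_inj; rewrite !fib_flip //.
  case: (boolP (enum_val h \in codom (hmap f))) => hc; first by rewrite hc.
  rewrite ifF; first by rewrite gf.
  apply/negP=> /codomP[k e]; case/negP: hc; rewrite -(gf (enum_val h)) e -i2 codom_f //.
- rewrite -(map_inj_uniq enum_val_inj) fib_legs // map_inj_uniq //.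
  exact: enum_uniq.
- move=> h; rewrite -(mem_map enum_val_inj) fib_legs // -(inj_eq enum_val_inj) fib_flip //.
  case: ifP => [/codomP[k e]|hc].
    rewrite e mem_map // mem_enum inE eqxx -i5 -e.
    by have := enum_valP h; rewrite inE.
  apply/mapP/eqP => [[k _ e]|e]; first by rewrite e codom_f in hc.
  have : enum_val h \in legs G by rewrite gl e.
  by rewrite -i3 => /mapP[k _ e']; rewrite e' codom_f in hc.
Qed.

Lemma prefiber_ordered (G H : pregraph) (f : premor G H) v :
  ordered_graph G -> is_mor f -> ordered_graph (prefiber f v).
Proof. by move=> oG /is_morP[*]; apply: prefiber_ordered_gen. Qed.

Lemma fiberP (G H : ggGrc) (f : mor G H) (v : 'I_(nv H)) :
  ordered_graph (prefiber f v) && connected (prefiber f v).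
Proof.
have /andP[oG cG] := ggGrcP G.
have fm := morP f; rewrite prefiber_ordered //.
by rewrite (mor_conn (elimT (is_morP _) fm)).
Qed.

Definition fiber (G H : ggGrc) (f : mor G H) (v : 'I_(nv H)) : ggGrc :=
  GgGrc (fiberP f v).

Lemma connect_adj_sym G : ordered_graph G -> connect_sym (@adj G).
Proof.
case/ordered_graphP=> _ gf _ _; apply: sym_connect_sym => x y.
by apply/existsP/existsP=> -[h /andP[/eqP <- /eqP <-]]; exists (flip G h);
  rewrite gf !eqxx.
Qed.

Lemma connected_n_comp G : ordered_graph G -> connected G -> n_comp (@adj G) predT = 1.
Proof.
move=> oG /andP[n0 /forallP cG]; pose x0 : 'I_(nv G) := Ordinal n0.
have cs := connect_adj_sym oG.
rewrite -(n_comp_connect cs x0); apply: eq_n_comp_r => y.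
by rewrite !inE; have /forallP := cG x0 => ->.
Qed.

Lemma edges_double G : ordered_graph G -> #|[set h | flip G h != h]| = ne G * 2.
Proof.
move=> /ordered_graphP[_ gf _ _]; rewrite /ne -[RHS]/(_ * 2).
have -> : [set h | flip G h != h] = cover (edges G).
  apply/setP=> h; rewrite inE; apply/idP/bigcupP => [hh|[B /imsetP[k kk ->]]].
    by exists [set h; flip G h]; [apply/imsetP; exists h | rewrite set21].
  rewrite inE in kk; rewrite !inE => /orP[] /eqP -> //.
  by rewrite gf eq_sym.
apply: card_uniform_partition => [B /imsetP[k kk ->]|].
  by rewrite cards2 eq_sym; rewrite inE in kk; rewrite kk.
rewrite /partition eqxx /=; apply/andP; split; last first.
  by apply/imsetP=> -[k _ /setP/(_ k)]; rewrite !inE eqxx.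
apply/trivIsetP=> _ _ /imsetP[h _ ->] /imsetP[k _ ->] hk.
rewrite -setI_eq0; apply: contraR hk => /set0Pn[x].
rewrite !inE => /andP[/orP[]/eqP-> /orP[]/eqP e]; apply/eqP.
- by rewrite e.
- by rewrite e gf setUC.
- by rewrite -e gf setUC.
- by rewrite (inv_inj gf e).
Qed.

Definition inner (G H : pregraph) (f : premor G H) v : {set 'I_(nh G)} :=
  [set h | (vmap f (vtx G h) == v) && (h \notin codom (hmap f))].

Lemma ne_prefiber (G H : pregraph) (f : premor G H) v :
  ordered_graph G -> ordered_graph (prefiber f v) -> 
  (forall h, h \notin codom (hmap f) -> vmap f (vtx G h) = vmap f (vtx G (flip G h))) ->
  map (hmap f) (legs H) = legs G ->
  ne (prefiber f v) * 2 = #|inner f v|.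
Proof.
move=> /ordered_graphP oG op contr lg; rewrite -edges_double //.
rewrite -(card_imset _ (@enum_val_inj _ (mem (fhalf f v)))); apply: eq_card => h.
apply/imsetP/idP => [[k]|].
  rewrite !inE -(inj_eq enum_val_inj) fib_flip //.
  case: ifP => [_|hc _]; first by rewrite eqxx.
  by move=> ->; rewrite hc andbT; have := enum_valP k; rewrite inE.
rewrite inE => /andP[hv hc].
have hin : h \in fhalf f v by rewrite inE.
exists (enum_rank_in hin h); last by rewrite enum_rankK_in.
rewrite inE -(inj_eq enum_val_inj) fib_flip // !enum_rankK_in // (negbTE hc).
apply/negP=> hh; case/negP: hc.
have : h \in legs G by rewrite g_legs.
by rewrite -lg => /mapP[k _ ->]; apply: codom_f.
Qed.

Lemma genus_prefiber (G H : pregraph) (f : premor G H) v :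
  ordered_graph G -> ordered_graph (prefiber f v) -> connected (prefiber f v) ->
  (forall h, h \notin codom (hmap f) -> vmap f (vtx G h) = vmap f (vtx G (flip G h))) ->
  map (hmap f) (legs H) = legs G ->
  (genus (prefiber f v) * 2 =
   \sum_(x | vmap f x == v) ((vgen G x)%:Z * 2 - 2) + (#|inner f v|)%:Z + 2)%R.
Proof.
move=> oG op cp contr lg; rewrite /genus /betti1 connected_n_comp //.
rewrite -(ne_prefiber oG op) // PoszM sumrB !mulrDl mulr_suml /=.
rewrite -!addrA; congr (_ + _)%R.
  rewrite -(eq_bigl _ _ (fun x => in_set (fun x => vmap f x == v) x)).
  rewrite [RHS]big_enum_val; apply: eq_bigr => x _.
  by rewrite fib_vgen.
have -> : (\sum_(x | vmap f x == v) (2 : int) = (#|fvert f v|)%:Z * 2)%R.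
  rewrite -(eq_bigl _ _ (fun x => in_set (fun x => vmap f x == v) x)).
  by rewrite sumr_const -[LHS]mulr_natl [X in (X * _)%R]natz.
rewrite addrCA mulNr; congr (_ + _)%R.
Qed.

Definition radj (G H : pregraph) (f : premor G H) : rel 'I_(nv G) :=
  fun x y => [exists h, [&& h \notin codom (hmap f), vtx G h == x & vtx G (flip G h) == y]].

Lemma connected_prefiber (G H : pregraph) (f : premor G H) v :
  (forall h, h \notin codom (hmap f) -> vmap f (vtx G h) = vmap f (vtx G (flip G h))) ->
  reflect ((exists x, vmap f x = v) /\
           forall x y, vmap f x = v -> vmap f y = v -> connect (radj f) x y)
          (connected (prefiber f v)).
Proof.
move=> contr; apply: (iffP andP) => [[n0 /forallP cG]|[[x0 xv] cG]].
  split.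
    exists (enum_val (Ordinal n0 : 'I_#|fvert f v|)).
    by have := enum_valP (Ordinal n0 : 'I_#|fvert f v|); rewrite inE => /eqP.
  move=> x y xv yv.
  have xin : x \in fvert f v by rewrite inE xv.
  have yin : y \in fvert f v by rewrite inE yv.
  have /forallP/(_ (enum_rank_in xin y)) := cG (enum_rank_in xin x).
  case/connectP=> p pp ly.
  have {}ly : y = enum_val (last (enum_rank_in xin x) p).
    by rewrite -ly enum_rankK_in.
  rewrite {}ly -{1}(enum_rankK_in xin xin).
  elim: p (enum_rank_in xin x) pp => [|z p IH] w /=; first by rewrite connect0.
  case/andP=> /existsP[h /andP[/eqP hw /eqP hz]] /IH; apply: connect_trans.
  have := fib_flip contr h; case: ifP => [hc hh|hc hh].
    by rewrite -hz -hw (enum_val_inj hh) connect0.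
  apply: connect1; apply/existsP; exists (enum_val h); rewrite hc /=.
  by rewrite -hh -!fib_vtx hw hz !eqxx.
have xin : x0 \in fvert f v by rewrite inE xv.
split; first by apply: leq_ltn_trans (ltn_ord (enum_rank_in xin x0)).
apply/forallP=> x; apply/forallP=> y.
have val2 (z : 'I_#|fvert f v|) : vmap f (enum_val z) = v.
  by have := enum_valP z; rewrite inE => /eqP.
have /connectP[p pp ly] := cG _ _ (val2 x) (val2 y).
elim: p x pp ly => [|z p IH] x /=.
  by move=> _ /enum_val_inj ->; rewrite connect0.
case/andP=> /existsP[h /and3P[hc /eqP hx /eqP hz]] pp ly.
have hv : h \in fhalf f v by rewrite inE hx val2.
have zv : z \in fvert f v by rewrite inE -hz -contr // hx val2.
have zE : z = enum_val (enum_rank_in zv z) by rewrite enum_rankK_in.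
apply: connect_trans (IH (enum_rank_in zv z) _ _); rewrite -?zE //.
apply: connect1; apply/existsP; exists (enum_rank_in hv h).
apply/andP; split; rewrite -(inj_eq enum_val_inj) fib_vtx ?fib_flip //.
  by rewrite enum_rankK_in // hx.
by rewrite !enum_rankK_in // (negbTE hc) hz.
Qed.

Lemma codom_comp (A B C : finType) (f : B -> C) (g : A -> B) h :
  h \in codom (f \o g) -> h \in codom f.
Proof. by case/codomP=> x ->; apply: codom_f. Qed.

Section Comp.
Variables (T S P : ggGrc) (f : mor T S) (g : mor S P).
Let fm : mor_spec f := elimT (is_morP _) (morP f).
Let gm : mor_spec g := elimT (is_morP _) (morP g).
Let fg := precomp f g.

Lemma codom_precomp h : (h \in codom (hmap fg)) = [exists k, (k \in codom (hmap g)) && (hmap f k == h)].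
Proof.
apply/codomP/existsP => [[k ->]|[_ /andP[/codomP[k ->] /eqP <-]]].
  by exists (hmap g k); rewrite codom_f ffunE eqxx.
by exists k; rewrite ffunE.
Qed.

Lemma precomp_contr h : h \notin codom (hmap fg) ->
  vmap fg (vtx T h) = vmap fg (vtx T (flip T h)).
Proof.
rewrite !ffunE codom_precomp => hc.
case: (boolP (h \in codom (hmap f))) => [/codomP[k e]|/(mor_contr fm) -> //].
rewrite e -(mor_flip fm) !(mor_vtx fm); apply: (mor_contr gm).
apply: contraNN hc => kc; apply/existsP; exists k; by rewrite kc e eqxx.
Qed.

Lemma precomp_legs : map (hmap fg) (legs P) = legs T.
Proof.
rewrite -(mor_legs fm) -(mor_legs gm) -map_comp; apply: eq_map => h.
by rewrite ffunE.
Qed.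

Lemma precomp_surj v : exists x, vmap fg x = v.
Proof.
have [y <-] := mor_surj gm v; have [x <-] := mor_surj fm y.
by exists x; rewrite ffunE.
Qed.

Lemma precomp_vtx h : vmap fg (vtx T (hmap fg h)) = vtx P h.
Proof. by rewrite !ffunE (mor_vtx fm) (mor_vtx gm). Qed.

Lemma precomp_inj : injective (hmap fg).
Proof. by move=> x y; rewrite !ffunE => /(mor_inj fm)/(mor_inj gm). Qed.

Lemma precomp_flip h : hmap fg (flip P h) = flip T (hmap fg h).
Proof. by rewrite !ffunE (mor_flip gm) (mor_flip fm). Qed.

Lemma precomp_connected v : connected (prefiber fg v).
Proof.
apply/connected_prefiber; first exact: precomp_contr.
split; first exact: precomp_surj.
have sub : subrel (radj f) (connect (radj fg)).
  move=> x y /existsP[h /and3P[hc hx hy]]; apply: connect1; apply/existsP; exists h.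
  rewrite hx hy !andbT; apply: contraNN hc; rewrite codom_precomp.
  by case/existsP=> k /andP[_ /eqP <-]; apply: codom_f.
have cf x y : vmap f x = vmap f y -> connect (radj fg) x y.
  move=> e; apply: (connect_sub sub).
  have /(connected_prefiber _ (mor_contr fm))[_] := mor_conn fm (vmap f y).
  by apply.
move=> x y; rewrite !ffunE => xv yv.
have /(connected_prefiber _ (mor_contr gm))[_ cg] := mor_conn gm v.
have /connectP[p] := cg _ _ xv yv.
elim: p x {xv} => [|z p IH] x /=; first by move=> _ /esym; apply: cf.
case/andP=> /existsP[h /and3P[hc /eqP hx /eqP hz]] pp ly.
have e1 : vmap f x = vmap f (vtx T (hmap f h)) by rewrite (mor_vtx fm).
have e2 : vmap f (vtx T (hmap f (flip S h))) = z by rewrite (mor_vtx fm).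
apply: connect_trans (cf _ _ e1) _.
apply: (@connect_trans _ _ (vtx T (hmap f (flip S h)))); last first.
  by apply: IH; rewrite e2.
apply: connect1; apply/existsP; exists (hmap f h).
rewrite (mor_flip fm) !eqxx !andbT; apply: contraNN hc; rewrite codom_precomp.
by case/existsP=> k /andP[kc /eqP/(mor_inj fm) <-].
Qed.

Lemma card_inner_comp v :
  #|inner fg v| = #|inner g v| + \sum_(w | vmap g w == v) #|inner f w|.
Proof.
rewrite -(card_imset _ (mor_inj fm)).
have -> : \sum_(w | vmap g w == v) #|inner f w| =
          #|[set h | (vmap fg (vtx T h) == v) && (h \notin codom (hmap f))]|.
  rewrite -sum1_card (partition_big (fun h => vmap f (vtx T h)) (fun w => vmap g w == v)) /=.
    apply: eq_bigr => w wv; rewrite -sum1_card; apply: eq_bigl => h.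
    rewrite !inE !ffunE; case: eqP => [->|]; rewrite ?andbF //.
    by rewrite wv andbT.
  by move=> h; rewrite inE ffunE => /andP[].
rewrite -cardsUI [X in _ + X](_ : _ = 0) ?addn0.
  apply: eq_card => h; rewrite !inE codom_precomp !ffunE.
  apply/andP/orP => [[hv hc]|[/imsetP[k]|/andP[hv hc]]].
  - case: (boolP (h \in codom (hmap f))) => hf; last by right; rewrite hv.
    left; case/codomP: hf => k e; apply/imsetP; exists k => //.
    rewrite inE -(mor_vtx fm) -e hv /=; apply: contraNN hc => kc.
    by apply/existsP; exists k; rewrite kc e eqxx.
  - rewrite inE => /andP[kv kc] ->; rewrite (mor_vtx fm) kv; split=> //.
    by apply: contraNN kc => /existsP[k' /andP[kc /eqP/(mor_inj fm) <-]].
  - rewrite hv; split=> //; apply: contraNN hc => /existsP[k /andP[_ /eqP <-]].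
    exact: codom_f.
apply: eq_card0 => h; rewrite !inE; apply/negP=> /andP[/imsetP[k _ ->]].
by rewrite codom_f andbF.
Qed.

Lemma precomp_mor : is_mor fg.
Proof.
have /andP[oT _] := ggGrcP T; have /andP[oS _] := ggGrcP S.
have op v : ordered_graph (prefiber fg v).
  exact: prefiber_ordered_gen oT precomp_inj precomp_flip precomp_legs precomp_vtx precomp_contr.
apply/is_morP; split.
- exact: precomp_inj.
- exact: precomp_flip.
- exact: precomp_legs.
- exact: precomp_surj.
- exact: precomp_vtx.
- exact: precomp_contr.
- exact: precomp_connected.
move=> v; apply: (@mulIf _ 2%R) => //.
rewrite (genus_prefiber oT) //; [|exact: precomp_connected|exact: precomp_contr|exact: precomp_legs].
rewrite (mor_genus gm) (genus_prefiber oS); first last.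
- exact: mor_legs gm.
- exact: mor_contr gm.
- exact: mor_conn gm v.
- exact: prefiber_ordered (morP g).
congr (_ + _)%R; rewrite card_inner_comp PoszD addrC [RHS]addrCA; congr (_ + _)%R.
rewrite [X in _ = (X + _)%R](partition_big (fun x => vmap f x) (fun w => vmap g w == v)) /=; last first.
  by move=> x; rewrite ffunE.
rewrite -natz natr_sum -big_split /=; apply: eq_bigr => w wv.
rewrite (mor_genus fm) (genus_prefiber oT); first last.
- exact: mor_legs fm.
- exact: mor_contr fm.
- exact: mor_conn fm w.
- exact: prefiber_ordered (morP f).
rewrite addrK; congr (_ + _)%R; last by rewrite natz.
 apply: eq_bigl => x.
by rewrite ffunE; case: (vmap f x =P w) => [->|]; rewrite ?andbF // wv.
Qed.
End Comp.

Definition mcomp (T S P : ggGrc) (g : mor S P) (f : mor T S) : mor T P :=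
  Mor (precomp_mor f g).

Lemma mcompA (T S P Q : ggGrc) (h : mor P Q) (g : mor S P) (f : mor T S) :
  mcomp h (mcomp g f) = mcomp (mcomp h g) f.
Proof.
by apply: mor_eq; congr Premor; apply/ffunP=> x; by rewrite !ffunE /= ?ffunE.
Qed.

Section FiberMap.
Variables (T S P : ggGrc) (f : mor T S) (g : mor S P) (v : 'I_(nv P)).
Let fm : mor_spec f := elimT (is_morP _) (morP f).
Let gm : mor_spec g := elimT (is_morP _) (morP g).

Lemma fiber_hmap_in (h : 'I_#|fhalf g v|) :
  hmap f (enum_val h) \in fhalf (mcomp g f) v.
Proof.
have := enum_valP h; rewrite !inE !ffunE.
by rewrite (mor_vtx (elimT (is_morP _) (morP f))).
Qed.

Lemma fiber_vmap_in (x : 'I_#|fvert (mcomp g f) v|) :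
  vmap f (enum_val x) \in fvert g v.
Proof. by have := enum_valP x; rewrite !inE ffunE. Qed.

Definition prefiber_map : premor (prefiber (mcomp g f) v) (prefiber g v) :=
  Premor
    ([ffun h => enum_rank_in (fiber_hmap_in h) (hmap f (enum_val h))]
       : {ffun 'I_(nh (prefiber g v)) -> 'I_(nh (prefiber (mcomp g f) v))})
    ([ffun x => enum_rank_in (fiber_vmap_in x) (vmap f (enum_val x))]
       : {ffun 'I_(nv (prefiber (mcomp g f) v)) -> 'I_(nv (prefiber g v))}).

Lemma fiber_hmapE (h : 'I_(nh (prefiber g v))) :
  enum_val (hmap prefiber_map h) = hmap f (enum_val h).
Proof. by rewrite ffunE enum_rankK_in // fiber_hmap_in. Qed.

Lemma fiber_vmapE (x : 'I_(nv (prefiber (mcomp g f) v))) :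
  enum_val (vmap prefiber_map x) = vmap f (enum_val x).
Proof. by rewrite ffunE enum_rankK_in // fiber_vmap_in. Qed.

Lemma sub_enum n (A C : {set 'I_n}) (B : {set 'I_#|A|}) :
  (forall k, (k \in B) = (enum_val k \in C)) -> C \subset A ->
  exists a : 'I_#|B| -> 'I_#|C|,
    [/\ bijective a, forall i j : 'I_#|B|, i < j -> a i < a j &
        forall i, enum_val (a i) = enum_val (enum_val i)].
Proof.
move=> BC CA.
have inC (i : 'I_#|B|) : enum_val (enum_val i) \in C by rewrite -BC enum_valP.
pose a (i : 'I_#|B|) := enum_rank_in (inC i) (enum_val (enum_val i)).
have aE i : enum_val (a i) = enum_val (enum_val i) by rewrite enum_rankK_in.
exists a; split=> //; last by move=> i j ij; rewrite -enum_val_lt !aE !enum_val_lt.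
apply: inj_card_bij => [i j e|].
  by apply: enum_val_inj; apply: enum_val_inj; rewrite -!aE e.
rewrite !card_ord -(card_imset _ (@enum_val_inj _ (mem A))).
apply: subset_leq_card; apply/subsetP=> x xC.
have xA := subsetP CA _ xC.
apply/imsetP; exists (enum_rank_in xA x); last by rewrite enum_rankK_in.
by rewrite BC enum_rankK_in.
Qed.

Lemma codom_fiber_map (k : 'I_(nh (prefiber (mcomp g f) v))) :
  (k \in codom (hmap prefiber_map)) = (enum_val k \in codom (hmap f)).
Proof.
apply/codomP/codomP => [[h ->]|[h e]]; first by exists (enum_val h); rewrite fiber_hmapE.
have hv : h \in fhalf g v.
  by have := enum_valP k; rewrite !inE !ffunE e (mor_vtx fm).
exists (enum_rank_in hv h); apply: enum_val_inj.
by rewrite fiber_hmapE e enum_rankK_in.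
Qed.

Let comp_m : mor_spec (mcomp g f) := elimT (is_morP _) (morP (mcomp g f)).

Lemma fiber_map_contr h : h \notin codom (hmap prefiber_map) ->
  vmap prefiber_map (vtx (prefiber (mcomp g f) v) h) =
  vmap prefiber_map (vtx (prefiber (mcomp g f) v) (flip (prefiber (mcomp g f) v) h)).
Proof.
rewrite codom_fiber_map => hc; apply: enum_val_inj.
rewrite !fiber_vmapE !fib_vtx (fib_flip (mor_contr comp_m)).
by case: ifP => // _; apply: (mor_contr fm).
Qed.

Lemma fiber_map_vtx h :
  vmap prefiber_map (vtx (prefiber (mcomp g f) v) (hmap prefiber_map h)) =
  vtx (prefiber g v) h.
Proof.
apply: enum_val_inj.
by rewrite fiber_vmapE !fib_vtx fiber_hmapE (mor_vtx fm).
Qed.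

Lemma fiber_fiber w : prefiber prefiber_map w = prefiber f (enum_val w).
Proof.
have wv : vmap g (enum_val w) = v by have := enum_valP w; rewrite inE => /eqP.
have [|//|a [ba ma aE]] := @sub_enum _ (fvert (mcomp g f) v) (fvert f (enum_val w))
   (fvert prefiber_map w).
- by move=> k; rewrite !inE -fiber_vmapE (inj_eq enum_val_inj).
- by apply/subsetP=> x; rewrite !inE ffunE => /eqP ->; rewrite wv.
have [||b [bb mb bE]] := @sub_enum _ (fhalf (mcomp g f) v) (fhalf f (enum_val w))
   (fhalf prefiber_map w).
- by move=> k; rewrite !inE -fib_vtx -fiber_vmapE (inj_eq enum_val_inj).
- by apply/subsetP=> x; rewrite !inE ffunE => /eqP ->; rewrite wv.
apply: (@pregraph_eq (prefiber prefiber_map w) (prefiber f (enum_val w)) a b) => //.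
- move=> h; apply: enum_val_inj; rewrite fib_vtx bE; apply/esym/(etrans (aE _)).
  exact: (etrans (congr1 (fun z => enum_val z) (fib_vtx h)) (fib_vtx _)).
- move=> h; apply: enum_val_inj; rewrite (fib_flip (mor_contr fm)) !bE.
  rewrite (fib_flip fiber_map_contr) codom_fiber_map.
  case: ifP => // hc; rewrite (fib_flip (mor_contr comp_m)); case: ifP => // /codomP[k e].
  by rewrite e ffunE codom_f in hc.
- apply: (inj_map (@enum_val_inj _ (mem (fhalf f (enum_val w))))).
  rewrite (fib_legs (mor_vtx fm)) -map_comp.
  rewrite (eq_map (g := fun h : 'I_(nh (prefiber prefiber_map w)) => enum_val (enum_val h)));
    last by move=> h /=; rewrite bE.
  rewrite (map_comp (fun k => enum_val k)) (fib_legs fiber_map_vtx) -map_comp.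
  rewrite (eq_map (g := fun h : 'I_(nh (prefiber g v)) => hmap f (enum_val h)));
    last by move=> h /=; rewrite fiber_hmapE.
  rewrite [RHS](map_comp (hmap f) (fun h : 'I_#|fhalf g v| => enum_val h)).
  congr map; apply: (inj_map val_inj).
  apply: (@irr_sorted_eq _ ltn ltn_trans ltnn); first exact: sorted_enum_ord.
    have := sorted_enum_ord [pred h | vtx (prefiber g v) h == w].
    rewrite !sorted_map; apply: sub_sorted => i j /=.
    by rewrite /relpre /= enum_val_lt.
  move=> x; apply/mapP/mapP => -[h].
    rewrite mem_enum inE => /eqP hw ->.
    have hv : h \in fhalf g v by rewrite inE hw wv.
    exists h => //; apply/mapP; exists (enum_rank_in hv h); last by rewrite enum_rankK_in.
    by rewrite mem_enum inE -(inj_eq enum_val_inj) fib_vtx enum_rankK_in // hw.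
  case/mapP=> k; rewrite mem_enum inE => /eqP kw -> ->; exists (enum_val k) => //.
  by rewrite mem_enum inE -kw fib_vtx.
- by move=> x; rewrite !fib_vgen aE.
Qed.

Lemma fiber_map_mor : is_mor prefiber_map.
Proof.
apply/is_morP; split.
- move=> x y e; apply: enum_val_inj; apply: (mor_inj fm).
  by rewrite -!fiber_hmapE e.
- move=> h; apply: enum_val_inj.
  rewrite fiber_hmapE (fib_flip (mor_contr gm)) (fib_flip (mor_contr comp_m)).
  rewrite fiber_hmapE (codom_precomp f g) -(mor_flip fm).
  case: ifP => hc; first by rewrite ifT //; apply/existsP; exists (enum_val h); rewrite hc eqxx.
  rewrite ifF //; apply: negbTE; rewrite negb_exists; apply/forallP=> k.
  rewrite negb_and (inj_eq (mor_inj fm)).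
  by case: eqP => [->|]; rewrite ?hc ?orbT.
- apply: (inj_map (@enum_val_inj _ (mem (fhalf (mcomp g f) v)))).
  rewrite (fib_legs (mor_vtx comp_m)) -map_comp.
  rewrite (eq_map (g := fun h : 'I_(nh (prefiber g v)) => hmap f (enum_val h)));
    last by move=> h /=; rewrite fiber_hmapE.
  rewrite (map_comp (hmap f) (fun h : 'I_(nh (prefiber g v)) => enum_val h)).
  rewrite (fib_legs (mor_vtx gm)) -map_comp; apply: eq_map => h.
  by rewrite ffunE.
- move=> w; have [x xw] := mor_surj fm (enum_val w).
  have xv : x \in fvert (mcomp g f) v.
    by have := enum_valP w; rewrite !inE ffunE xw.
  exists (enum_rank_in xv x); apply: enum_val_inj.
  by rewrite fiber_vmapE enum_rankK_in.
- exact: fiber_map_vtx.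
- exact: fiber_map_contr.
- by move=> w; rewrite fiber_fiber; apply: (mor_conn fm).
- move=> w; rewrite fiber_fiber fib_vgen; exact: (mor_genus fm).
Qed.

Definition fiber_map : mor (fiber (mcomp g f) v) (fiber g v) :=
  @Mor (fiber (mcomp g f) v) (fiber g v) prefiber_map fiber_map_mor.

Lemma fiber_of_fiber_map w : fiber fiber_map w = fiber f (enum_val w).
Proof. by apply: ggGrc_eq; apply: fiber_fiber. Qed.
End FiberMap.

Definition preid (G : pregraph) : premor G G := Premor [ffun h => h] [ffun x => x].

Lemma preid_mor (G : ggGrc) : is_mor (preid G).
Proof.
have /andP[oG _] := ggGrcP G.
have cd h : h \in codom (hmap (preid G)) by apply/codomP; exists h; rewrite ffunE.
have inj : injective (hmap (preid G)) by move=> x y; rewrite !ffunE.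
have fl h : hmap (preid G) (flip G h) = flip G (hmap (preid G) h) by rewrite !ffunE.
have lg : map (hmap (preid G)) (legs G) = legs G.
  by rewrite (eq_map (g := id)) ?map_id // => x; rewrite ffunE.
have vt h : vmap (preid G) (vtx G (hmap (preid G) h)) = vtx G h by rewrite !ffunE.
have ct h : h \notin codom (hmap (preid G)) ->
  vmap (preid G) (vtx G h) = vmap (preid G) (vtx G (flip G h)) by rewrite cd.
have cn v : connected (prefiber (preid G) v).
  apply/connected_prefiber => //; split; first by exists v; rewrite ffunE.
  by move=> x y; rewrite !ffunE => -> ->; apply: connect0.
apply/is_morP; split=> //.
  by move=> v; exists v; rewrite ffunE.
move=> v; apply: (@mulIf _ 2%R) => //.
rewrite (genus_prefiber oG) //; last exact: prefiber_ordered_gen.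
rewrite (big_pred1 v) => [|x]; last by rewrite ffunE.
rewrite [inner _ _](_ : _ = set0) ?cards0 ?addr0 ?subrK //.
by apply/setP=> h; rewrite !inE cd andbF.
Qed.

Definition mid (G : ggGrc) : mor G G := Mor (preid_mor G).

Lemma mcomp1 (G H : ggGrc) (f : mor G H) : mcomp f (mid G) = f.
Proof.
apply: mor_eq; case: f => -[a b] p; congr Premor; apply/ffunP=> x; by rewrite !ffunE /= ?ffunE.
Qed.

Lemma mcomp1l (G H : ggGrc) (f : mor G H) : mcomp (mid H) f = f.
Proof.
apply: mor_eq; case: f => -[a b] p; congr Premor; apply/ffunP=> x; by rewrite !ffunE /= ?ffunE.
Qed.

Record iso (G H : ggGrc) := Iso {
  iso_mor :> mor G H;
  iso_inv : mor H G;
  isoK : mcomp iso_inv iso_mor = mid G;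
  isoVK : mcomp iso_mor iso_inv = mid H }.

Definition iso_id (G : ggGrc) : iso G G := Iso (mcomp1 (mid G)) (mcomp1 (mid G)).

Lemma iso_compK (G H K : ggGrc) (g : iso H K) (f : iso G H) :
  mcomp (mcomp (iso_inv f) (iso_inv g)) (mcomp g f) = mid G.
Proof. by rewrite -mcompA (mcompA (iso_inv g)) isoK mcomp1l isoK. Qed.

Lemma iso_compVK (G H K : ggGrc) (g : iso H K) (f : iso G H) :
  mcomp (mcomp g f) (mcomp (iso_inv f) (iso_inv g)) = mid K.
Proof. by rewrite -mcompA (mcompA f) isoVK mcomp1l isoVK. Qed.

Definition iso_comp (G H K : ggGrc) (g : iso H K) (f : iso G H) : iso G K :=
  Iso (iso_compK g f) (iso_compVK g f).

Definition local_terminal (G : ggGrc) : bool := (nv G == 1) && (ne G == 0).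

Definition trivial (G : ggGrc) : bool :=
  local_terminal G && (legs G == enum 'I_(nh G)).

Definition elementary (T S : ggGrc) (f : mor T S) (i : 'I_(nv S)) : bool :=
  [&& [forall x : 'I_(nv T), forall y : 'I_(nv T),
         (x <= y) ==> (vmap f x <= vmap f y)],
      [forall j, (j != i) ==> trivial (fiber f j)]
    & 0 < ne (fiber f i)].

(* F |>_i T --f--> S *)
Definition elem (F T S : ggGrc) (f : mor T S) (i : 'I_(nv S)) : Prop :=
  elementary f i /\ fiber f i = F.

Lemma elementary_fiber_map (T S P : ggGrc) (f : mor T S) (g : mor S P) i
    (j' : 'I_(nv (fiber g i))) :
  elementary f (enum_val j') -> elementary (fiber_map f g i) j'.
Proof.
case/and3P=> /forallP mono /forallP tr ne0; apply/and3P; split.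
- apply/forallP=> x; apply/forallP=> y; apply/implyP=> xy.
  rewrite -enum_val_le !fiber_vmapE.
  have /forallP/(_ (enum_val y))/implyP := mono (enum_val x); apply.
  by rewrite enum_val_le.
- apply/forallP=> w; apply/implyP=> wj; rewrite fiber_of_fiber_map.
  have /implyP := tr (enum_val w); apply.
  by rewrite (inj_eq enum_val_inj).
- by rewrite fiber_of_fiber_map.
Qed.

Lemma trivial_fiber (T U : ggGrc) (f : mor T U) i : trivial U -> fiber f i = T.
Proof.
case/andP=> /andP[/eqP n1 _] /eqP lg.
have fm := elimT (is_morP _) (morP f).
have one (x y : 'I_(nv U)) : x = y.
  by apply: val_inj; case: x y => [x hx] [y hy] /=; move: hx hy; rewrite n1; case: x y => [|//] [].
apply/esym/ggGrc_eq.
have vin x : x \in fvert f i by rewrite inE (one (vmap f x) i).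
have hin h : h \in fhalf f i by rewrite inE (one (vmap f _) i).
pose a x := enum_rank_in (vin x) x; pose b h := enum_rank_in (hin h) h.
have aE x : enum_val (a x) = x by rewrite enum_rankK_in.
have bE h : enum_val (b h) = h by rewrite enum_rankK_in.
apply: (@pregraph_eq T (prefiber f i) a b).
- by exists enum_val => x //; apply: enum_val_inj; rewrite aE.
- by exists enum_val => x //; apply: enum_val_inj; rewrite bE.
- by move=> x y xy; rewrite -enum_val_lt !aE.
- by move=> x y xy; rewrite -enum_val_lt !bE.
- by move=> h; apply: enum_val_inj; rewrite fib_vtx aE bE.
- move=> h; apply: enum_val_inj; rewrite (fib_flip (mor_contr fm)) !bE.
  case: ifP => // /codomP[k e].
  have : h \in legs T by rewrite -(mor_legs fm) e map_f // lg mem_enum.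
  have /andP[/ordered_graphP oT _] := ggGrcP T.
  by rewrite (g_legs oT) => /eqP.
- apply: (inj_map (@enum_val_inj _ (mem (fhalf f i)))).
  rewrite (fib_legs (mor_vtx fm)) -map_comp (eq_map (g := id)); last by move=> h /=.
  rewrite map_id -(mor_legs fm) lg; congr map; apply: eq_enum => h.
  by rewrite !inE (one (vtx U h) i) eqxx.
- by move=> x; rewrite fib_vgen aE.
Qed.

Lemma elementary_comp (T S P : ggGrc) (f : mor T S) (g : mor S P) j i :
  elementary f j -> elementary g i -> vmap g j = i -> elementary (mcomp g f) i.
Proof.
case/and3P=> /forallP mono /forallP tr ne0.
case/and3P=> /forallP mono' /forallP tr' ne0' gj; apply/and3P; split.
- apply/forallP=> x; apply/forallP=> y; apply/implyP=> xy; rewrite !ffunE.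
  have /forallP/(_ (vmap f y))/implyP := mono' (vmap f x); apply.
  by have /forallP/(_ y)/implyP := mono x; apply.
- apply/forallP=> i'; apply/implyP=> ii'.
  have tg : trivial (fiber g i') by have /implyP := tr' i'; apply.
  have n1 : 0 < nv (fiber g i') by have /andP[/andP[/eqP -> ]] := tg.
  rewrite -(trivial_fiber (fiber_map f g i') (Ordinal n1) tg) fiber_of_fiber_map.
  have /implyP := tr (enum_val (Ordinal n1 : 'I_#|fvert g i'|)); apply.
  apply: contraNneq ii' => e; rewrite -gj -e.
  by have := enum_valP (Ordinal n1 : 'I_#|fvert g i'|); rewrite inE => /eqP ->.
- have /andP[oT _] := ggGrcP T; have /andP[oS _] := ggGrcP S.
  have gm := elimT (is_morP _) (morP g).
  have cm := elimT (is_morP _) (morP (mcomp g f)).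
  rewrite -(ltn_pmul2r (isT : 0 < 2)) mul0n.
  rewrite (ne_prefiber oT (prefiber_ordered _ oT (morP _)) (mor_contr cm) (mor_legs cm)).
  rewrite (card_inner_comp f g); apply: leq_trans (leq_addr _ _).
  rewrite -(ne_prefiber oS (prefiber_ordered _ oS (morP g)) (mor_contr gm) (mor_legs gm)).
  by rewrite muln_gt0 ne0'.
Qed.

Definition fiber_map_cast (T S P : ggGrc) (f : mor T S) (g : mor S P) (v : 'I_(nv P))
    (x : mor T P) (e : mcomp g f = x) : mor (fiber x v) (fiber g v) :=
  match e with erefl => fiber_map f g v end.

Lemma fiber_castE (T S P : ggGrc) (f : mor T S) (g : mor S P) (v : 'I_(nv P))
    (x : mor T P) (e : mcomp g f = x) :
  (forall h, enum_val (hmap (fiber_map_cast v e) h) = hmap f (enum_val h)) /\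
  (forall y, enum_val (vmap (fiber_map_cast v e) y) = vmap f (enum_val y)).
Proof. by case: _ / e => /=; split=> ?; [exact: fiber_hmapE | exact: fiber_vmapE]. Qed.

Lemma fiber_map_iso (T S P : ggGrc) (w : iso T S) (g : mor S P) v :
  exists wv : iso (fiber (mcomp g w) v) (fiber g v), iso_mor wv = fiber_map w g v.
Proof.
have e : mcomp (mcomp g w) (iso_inv w) = g by rewrite -mcompA isoVK mcomp1.
have [e1 e2] := fiber_castE v e.
have f1 h : enum_val (hmap (fiber_map w g v) h) = hmap w (enum_val h) by exact: fiber_hmapE.
have f2 y : enum_val (vmap (fiber_map w g v) y) = vmap w (enum_val y) by exact: fiber_vmapE.
have [h1 v1] : (hmap (mcomp (iso_inv w) w) =1 id) /\ (vmap (mcomp (iso_inv w) w) =1 id).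
  by rewrite isoK; split=> x; rewrite ffunE.
have [h2 v2] : (hmap (mcomp w (iso_inv w)) =1 id) /\ (vmap (mcomp w (iso_inv w)) =1 id).
  by rewrite isoVK; split=> x; rewrite ffunE.
have K : mcomp (fiber_map_cast v e) (fiber_map w g v) = mid _.
  apply: mor_eq; congr Premor; apply/ffunP=> x; rewrite ffunE [RHS]ffunE; apply: enum_val_inj.
    by rewrite f1 e1; have := h1 (enum_val x); rewrite ffunE.
  by rewrite e2 f2; have := v1 (enum_val x); rewrite ffunE.
have VK : mcomp (fiber_map w g v) (fiber_map_cast v e) = mid _.
  apply: mor_eq; congr Premor; apply/ffunP=> x; rewrite ffunE [RHS]ffunE; apply: enum_val_inj.
    by rewrite e1 f1; have := h2 (enum_val x); rewrite ffunE.
  by rewrite f2 e2; have := v2 (enum_val x); rewrite ffunE.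
by exists (Iso K VK).
Qed.

Lemma fiber_iso_terminal (S P : ggGrc) (s : iso S P) v : local_terminal (fiber s v).
Proof.
have [h2 v2] : (hmap (mcomp (iso_inv s) s) =1 id) /\ (vmap (mcomp (iso_inv s) s) =1 id).
  by rewrite isoK; split=> x; rewrite ffunE.
have [_ v3] : (hmap (mcomp s (iso_inv s)) =1 id) /\ (vmap (mcomp s (iso_inv s)) =1 id).
  by rewrite isoVK; split=> x; rewrite ffunE.
have sm := elimT (is_morP _) (morP s).
have /andP[oS _] := ggGrcP S.
apply/andP; split.
  rewrite /= (_ : fvert s v = [set vmap (iso_inv s) v]) ?cards1 //.
  apply/setP=> x; rewrite !inE; apply/eqP/eqP => [<-|->].
    by have := v2 x; rewrite ffunE.
  by have := v3 v; rewrite ffunE.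
rewrite -(eqn_pmul2r (isT : 0 < 2)) mul0n.
rewrite (ne_prefiber oS (prefiber_ordered _ oS (morP _)) (mor_contr sm) (mor_legs sm)).
rewrite cards_eq0; apply/eqP/setP=> h; rewrite !inE.
by rewrite -(h2 h) ffunE codom_f andbF.
Qed.

Local Open Scope ring_scope.

Section Operads.
Variable k : fieldType.

(* Graded vector spaces are Z-graded.  An identification M(F) = M(T) is a
   literal equality of gvs, and gcast is transport along it; axioms quantify
   over all such equality proofs, which are unique by UIP. *)
Definition gvs := int -> lmodType k.

Definition gcast (A B : gvs) (e : A = B) (d : int) : A d -> B d :=
  match e in _ = X return A d -> X d with erefl => id end.

(* The degree n of a composite comes with a proof of p + q = n, which avoids
   transports between degrees.  The premises hgf, hfi and wj below always hold:
   see elementary_comp, elementary_fiber_map, fiber_of_fiber_map and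
   fiber_map_iso.  In op_unitl, op_act t (op_unit hU 1) is the unit of the local
   terminal u.  In op_equiv, eq comes from op_eq, since F' is the fiber of
   fiber_map f' s j and fiber s j is local terminal (fiber_iso_terminal). *)
Record operad := Operad {
  op_sp :> ggGrc -> gvs;
  op_act : forall S T, iso S T -> forall d, {linear op_sp T d -> op_sp S d};
  op_comp : forall F T S (f : mor T S) i, elem F f i ->
    forall p q n : int, p + q = n -> op_sp S p -> op_sp F q -> op_sp T n;
  op_unit : forall U, trivial U -> {linear k^o -> op_sp U 0};
  op_act_id : forall T d (x : op_sp T d), op_act (iso_id T) d x = x;
  op_act_comp : forall S T U (g : iso T U) (f : iso S T) d (x : op_sp U d),
    op_act (iso_comp g f) d x = op_act f d (op_act g d x);
  op_comp_linl : forall F T S (f : mor T S) i (h : elem F f i) (p q n : int)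
    (e : p + q = n) (b : op_sp F q), linear (fun a => op_comp h e a b);
  op_comp_linr : forall F T S (f : mor T S) i (h : elem F f i) (p q n : int)
    (e : p + q = n) (a : op_sp S p), linear (op_comp h e a);
  op_assoc : forall F T S P (f : mor T S) (g : mor S P) j i
    (j' : 'I_(nv (fiber g i)))
    (hf : elem F f j) (hg : elem (fiber g i) g i)
    (hgf : elem (fiber (mcomp g f) i) (mcomp g f) i)
    (hfi : elem F (fiber_map f g i) j'),
    vmap g j = i -> enum_val j' = j ->
    forall (p q r m m' n : int) (e1 : p + m = n) (e2 : q + r = m)
      (e3 : m' + r = n) (e4 : p + q = m')
      (a : op_sp P p) (b : op_sp (fiber g i) q) (c : op_sp F r),
    op_comp hgf e1 a (op_comp hfi e2 b c) = op_comp hf e3 (op_comp hg e4 a b) c;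
  op_par : forall F G T P' P'' S (f' : mor T P') (g' : mor P' S)
    (f'' : mor T P'') (g'' : mor P'' S) j i l m
    (hf' : elem F f' j) (hg' : elem G g' i)
    (hf'' : elem G f'' l) (hg'' : elem F g'' m),
    mcomp g' f' = mcomp g'' f'' -> vmap g'' l = i -> vmap g' j = m -> i != m ->
    forall (p q r s t n : int) (e1 : p + r = s) (e2 : s + q = n)
      (e3 : p + q = t) (e4 : t + r = n)
      (a : op_sp S p) (b : op_sp F q) (c : op_sp G r),
    (-1) ^+ absz (q * r) *: op_comp hf' e2 (op_comp hg' e1 a c) b =
    op_comp hf'' e4 (op_comp hg'' e3 a b) c;
  op_eq : forall F T u (f : mor T u) i, local_terminal u -> elem F f i ->
    op_sp F = op_sp T;
  op_unitl : forall F T u U (f : mor T u) i (hf : elem F f i)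
    (hU : trivial U) (t : iso u U), local_terminal u ->
    forall (n : int) (e : 0 + n = n) (eq : op_sp F = op_sp T) (b : op_sp F n),
    op_comp hf e (op_act t 0 (op_unit hU 1)) b = gcast eq b;
  op_equiv : forall F' T' T'' S' S'' (f' : mor T' S') (f'' : mor T'' S'')
    (w : iso T' T'') (s : iso S' S'') i j
    (h' : elem F' f' i) (h'' : elem (fiber f'' j) f'' j)
    (wj : iso (fiber (mcomp f'' w) j) (fiber f'' j)),
    mcomp f'' w = mcomp s f' -> iso_mor wj = fiber_map w f'' j ->
    forall (eq : op_sp (fiber (mcomp f'' w) j) = op_sp F') (p q n : int)
      (e : p + q = n) (a : op_sp S'' p) (b : op_sp (fiber f'' j) q),
    op_act w n (op_comp h'' e a b) =
    op_comp h' e (op_act s p a) (gcast eq (op_act wj q b)) }.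

Definition one_connected (M : operad) : Prop :=
  forall U (hU : trivial U),
    bijective (op_unit M hU) /\ forall d, d != 0 -> forall x : M U d, x = 0.

Record operad_hom (M N : operad) := OperadHom {
  oh_map :> forall T d, {linear M T d -> N T d};
  oh_act : forall S T (w : iso S T) d (x : M T d),
    oh_map S d (op_act M w d x) = op_act N w d (oh_map T d x);
  oh_comp : forall F T S (f : mor T S) i (h : elem F f i) (p q n : int) (e : p + q = n)
    (a : M S p) (b : M F q),
    oh_map T n (op_comp h e a b) = op_comp h e (oh_map S p a) (oh_map F q b);
  oh_unit : forall U (hU : trivial U) c,
    oh_map U 0 (op_unit M hU c) = op_unit N hU c }.

Definition operad_isomorphic (M N : operad) : Prop :=
  exists f : operad_hom M N, forall T d, bijective (f T d).

Record collection := Collection {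
  co_sp :> ggGrc -> gvs;
  co_act : forall S T, iso S T -> forall d, {linear co_sp T d -> co_sp S d};
  co_act_id : forall T d (x : co_sp T d), co_act (iso_id T) d x = x;
  co_act_comp : forall S T U (g : iso T U) (f : iso S T) d (x : co_sp U d),
    co_act (iso_comp g f) d x = co_act f d (co_act g d x);
  co_zero : forall T : ggGrc, ne T = 0%N -> forall d (x : co_sp T d), x = 0;
  co_eq : forall T u (f : mor T u) i, local_terminal u ->
    co_sp (fiber f i) = co_sp T;
  co_eq_act : forall T S u (w : iso T S) (f : mor S u) i
    (wi : iso (fiber (mcomp f w) i) (fiber f i)),
    local_terminal u -> iso_mor wi = fiber_map w f i ->
    forall (eqT : co_sp (fiber (mcomp f w) i) = co_sp T)
      (eqS : co_sp (fiber f i) = co_sp S) d (x : co_sp (fiber f i) d),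
    gcast eqT (co_act wi d x) = co_act w d (gcast eqS x) }.

(* A morphism from E to the restriction of M to graphs with e(T) >= 1, extended
   by 0: where e(T) = 0 the component is 0, because E vanishes there. *)
Record coll_hom (E : collection) (M : operad) := CollHom {
  ch_map :> forall T d, {linear E T d -> M T d};
  ch_act : forall S T (w : iso S T) d (x : E T d),
    ch_map S d (co_act E w d x) = op_act M w d (ch_map T d x);
  ch_eq : forall F T u (f : mor T u) i, local_terminal u -> elem F f i ->
    forall (eqE : E F = E T) (eqM : M F = M T) d (x : E F d),
    ch_map T d (gcast eqE x) = gcast eqM (ch_map F d x) }.

Definition is_free (E : collection) (F : operad) (iota : coll_hom E F) : Prop :=
  forall M, one_connected M -> forall f : coll_hom E M,
    exists g : operad_hom F M,
      (forall T d (x : E T d), g T d (iota T d x) = f T d x) /\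
      forall g' : operad_hom F M,
        (forall T d (x : E T d), g' T d (iota T d x) = f T d x) ->
        forall T d (x : F T d), g' T d x = g T d x.

Definition family (M : operad) := forall T d, M T d -> Prop.

Definition subpresheaf (M : operad) (I : family M) : Prop :=
  [/\ forall T d, I T d 0,
      forall T d c (x y : M T d), I T d x -> I T d y -> I T d (c *: x + y)
    & forall S T (w : iso S T) d x, I T d x -> I S d (op_act M w d x)].

Definition ideal (M : operad) (I : family M) : Prop :=
  subpresheaf I /\
  forall F T S (f : mor T S) i (h : elem F f i) (p q n : int) (e : p + q = n)
    (a : M S p) (b : M F q),
    I S p a \/ I F q b -> I T n (op_comp h e a b).

Definition ideal_gen (M : operad) (R : family M) : family M :=
  fun T d x => forall I : family M, ideal I ->
    (forall T' d' (y : M T' d'), R T' d' y -> I T' d' y) -> I T d x.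

(* Q is M / I with projection pi. *)
Definition is_quotient (M : operad) (I : family M) (Q : operad)
    (pi : operad_hom M Q) : Prop :=
  forall T d, (forall y, exists x, pi T d x = y) /\
              (forall x, pi T d x = 0 <-> I T d x).

(* wg_0: if e(T) = 0 then F(T) is one-dimensional by 1-connectedness, and
   F^0(T) is all of it. *)
Record weight_grading (E : collection) (F : operad) (iota : coll_hom E F)
    (W : nat -> family F) : Prop := WeightGrading {
  wg_sub : forall n, subpresheaf (W n);
  wg_span : forall T d (x : F T d), exists n (w : 'I_n -> F T d),
    (forall i : 'I_n, W i T d (w i)) /\ x = \sum_i w i;
  wg_direct : forall T d n (w : 'I_n -> F T d),
    (forall i : 'I_n, W i T d (w i)) -> \sum_i w i = 0 -> forall i, w i = 0;
  wg_comp : forall G T S (f : mor T S) i (h : elem G f i) (p q n : int) (e : p + q = n)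
    s t (a : F S p) (b : F G q),
    W s S p a -> W t G q b -> W (s + t)%N T n (op_comp h e a b);
  wg_0 : forall T d x, W 0%N T d x <-> (ne T = 0%N \/ x = 0);
  wg_1 : forall T d x, W 1%N T d x <-> exists y, x = iota T d y;
  wg_1_inj : forall T d, injective (iota T d) }.

Definition quadratic_over (E : collection) (M : operad) : Prop :=
  exists (F : operad) (iota : coll_hom E F) (W : nat -> family F) (R : family F)
         (Q : operad) (pi : operad_hom F Q),
  [/\ one_connected F /\ is_free iota, weight_grading iota W,
      subpresheaf R /\ (forall T d x, R T d x -> W 2%N T d x),
      is_quotient (ideal_gen R) pi
    & operad_isomorphic M Q].

Definition quadratic (M : operad) : Prop :=
  one_connected M /\ exists E : collection, quadratic_over E M.

Definition binary_quadratic (M : operad) : Prop :=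
  one_connected M /\
  exists E : collection, quadratic_over E M /\
    forall T d (x : E T d), x != 0 -> ne T = 1%N.

(* The graded vector space k concentrated in degree 0. *)
Definition kgr : gvs := fun d =>
  match d with Posz 0 => (k^o : lmodType k) | _ => ('rV[k]_0 : lmodType k) end.

Definition kval (d : int) : kgr d -> k :=
  match d return kgr d -> k with Posz 0 => id | _ => fun _ => 0 end.

Definition kelt (d : int) : k -> kgr d :=
  match d return k -> kgr d with Posz 0 => id | _ => fun _ => 0 end.

Lemma kval_linear d : linear_for *%R (@kval d).
Proof. by case: d => [[|n]|n] c x y //=; rewrite mulr0 addr0. Qed.

Lemma kelt_linear d : linear (@kelt d : k^o -> kgr d).
Proof. by case: d => [[|n]|n] c x y //=; rewrite scaler0 addr0. Qed.

Lemma kelt0 d : kelt d 0 = 0. Proof. by case: d => [[|n]|n]. Qed.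
Lemma keltZ d c x : kelt d (c * x) = c *: kelt d x.
Proof. by have := kelt_linear d c x 0; rewrite addr0 kelt0 addr0. Qed.

Lemma kval_out d (x : kgr d) : d != 0 -> kval x = 0.
Proof. by case: d x => [[|n]|n] x. Qed.

Lemma keltK d (x : kgr d) : kelt d (kval x) = x.
Proof. by case: d x => [[|n]|n] x //=; rewrite [x]thinmx0. Qed.

Lemma kval0K c : kval (kelt 0 c) = c. Proof. by []. Qed.

Lemma kvalK d c : d = 0 -> kval (kelt d c) = c. Proof. by move=> ->. Qed.

Definition kmul (p q n : int) (a : kgr p) (b : kgr q) : kgr n := kelt n (kval a * kval b).

Lemma gcast_id (A : gvs) (e : A = A) d (x : A d) : gcast e x = x.
Proof. by rewrite (UIP_refl _ _ e). Qed.

Lemma kval_mul p q n (e : p + q = n) (a : kgr p) (b : kgr q) :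
  kval (kmul n a b) = kval a * kval b.
Proof.
have [p0|p0] := eqVneq p 0; last by rewrite /kmul (kval_out a p0) mul0r kelt0 -(kelt0 n) /kval; case: n {e} => [[]|].
have [q0|q0] := eqVneq q 0; last by rewrite /kmul (kval_out b q0) mulr0 kelt0 -(kelt0 n) /kval; case: n {e} => [[]|].
by rewrite /kmul kvalK // -e p0 q0 addr0.
Qed.

Lemma kval_inj d : injective (@kval d).
Proof. by move=> x y e; rewrite -(keltK x) e keltK. Qed.

Lemma kvalZ d c (x : kgr d) : kval (c *: x) = c * kval x.
Proof. by have := kval_linear c x 0; rewrite addr0 => ->; case: d x => [[|n]|n] x; rewrite /= ?addr0. Qed.

Lemma kmul_linl p q n (b : kgr q) : linear (fun a : kgr p => kmul n a b).
Proof. by move=> c x y; rewrite /kmul kval_linear mulrDl -mulrA -kelt_linear. Qed.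
Lemma kmul_linr p q n (a : kgr p) : linear (@kmul p q n a).
Proof. by move=> c x y; rewrite /kmul kval_linear mulrDr mulrCA -kelt_linear. Qed.

Definition terminal_operad : operad.
Proof.
refine (@Operad (fun _ => kgr)
  (fun _ _ _ d => idfun : {linear kgr d -> kgr d})
  (fun F T S f i h p q n e a b => kmul n a b)
  (fun U hU => idfun : {linear k^o -> kgr 0})
  _ _ _ _ _ _ _ _ _) => //.
- by move=> *; apply: kmul_linl.
- by move=> *; apply: kmul_linr.
- move=> *; apply: kval_inj; rewrite !(kval_mul, mulrA) //.
- move=> F G T P' P'' S f' g' f'' g'' j i l m _ _ _ _ _ _ _ _ p q r s t n e1 e2 e3 e4 a b c.
  apply: kval_inj; rewrite kvalZ !kval_mul //.
  have [q0|q0] := eqVneq q 0; last by rewrite (kval_out b q0) !(mulr0, mul0r).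
  have -> : absz (q * r) = 0%N by rewrite q0 mul0r.
  by rewrite expr0 mul1r mulrAC.
- move=> F T u U f i hf hU t _ n e eq b; rewrite gcast_id.
  by apply: kval_inj; rewrite kval_mul //= mul1r.
- by move=> *; rewrite /= gcast_id.
Defined.

End Operads.

(* Main.v *)
Require Import Defs.
From mathcomp Require Import all_boot all_order all_algebra.
From mathcomp Require Import boolp zify.
From HB Require Import structures.
From Stdlib Require Import Relation_Operators.
Set Implicit Arguments. Unset Strict Implicit. Unset Printing Implicit Defensive.
Import Order.TTheory GRing.Theory Num.Theory.

(** An ordering of the edges of a graph T says in which order to contract them,
    so it presents an iterated composite of one-edge generators.  Let F(T) be
    spanned by the orderings modulo exchanging two consecutive edges h, h' that
    are not connected through the edges contracted before them; composition is
    concatenation, first the edges of the fiber, then those of the target.  The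
    equivariance, associativity and parallel axioms of an arbitrary operad say
    exactly that iterated composites are independent of the choices made and of
    these exchanges, so F is the free operad on one generator for each one-edge
    graph, graded by the number of edges.  The map F -> 1 sends every ordering
    to 1.  Any two orderings are related by exchanges of consecutive edges: if
    the two contractions happen at different vertices the orderings are already
    equal in F, otherwise the two edges form a connected two-edge fiber and the
    difference is a composite with a relation of weight 2. *)

(** * Morphisms of graphs *)

(** The obstacle is rigidity. Composition exists only along elementary maps, which are monotone on
    vertices and keep the local orders outside one fiber, whereas the contraction of a given edge
    usually does neither. So each contraction is preceded by an isomorphism [w] renumbering its
    source, and a composite depends on choices that equivariance has to cancel. Two contractions of
    the same edge differ by an isomorphism of their targets, which lets this cancellation run by
    induction on the number of edges.

    The exchange condition is the shadow of [op_par], which needs two distinct vertices. Before any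
    contraction this reads: in the subgraph formed by the earlier edges and the two edges
    themselves, the two lie in different components.

    Since everything sits in degree 0, no sign survives and F(T) has a finite basis of classes of
    words, on which linear identities are checked. The identification of the values on T and on its
    fiber over a local terminal graph must be a literal equality; therefore F(T) is built from
    incidence and involution alone, the data that this fiber shares with T. *)

Lemma mor_specP (G H : ggGrc) (f : mor G H) : mor_spec f.
Proof. exact: elimT (is_morP _) (morP f). Qed.

Lemma ggGrc_ordered (G : ggGrc) : ordered_graph G.
Proof. by case/andP: (ggGrcP G). Qed.

Lemma ggGrc_connected (G : ggGrc) : connected G.
Proof. by case/andP: (ggGrcP G). Qed.

Lemma ggGrc_spec (G : ggGrc) : graph_spec G.
Proof. exact: elimT (ordered_graphP _) (ggGrc_ordered G). Qed.

Lemma mor_ext (G H : ggGrc) (f g : mor G H) :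
  hmap f =1 hmap g -> vmap f =1 vmap g -> f = g.
Proof.
move=> eh ev; apply: mor_eq.
case: f g eh ev => -[a b] p [[a' b'] q] /= eh ev.
by congr Premor; apply/ffunP.
Qed.

Lemma mcomp_hmap (T S P : ggGrc) (g : mor S P) (f : mor T S) h :
  hmap (mcomp g f) h = hmap f (hmap g h).
Proof. by rewrite ffunE. Qed.

Lemma mcomp_vmap (T S P : ggGrc) (g : mor S P) (f : mor T S) x :
  vmap (mcomp g f) x = vmap g (vmap f x).
Proof. by rewrite ffunE. Qed.

(** Every morphism is epi, because its half-edge map is injective and its vertex map surjective.
    This replaces most computations with inverses and factors. *)
Lemma mcomp_epi (T S P : ggGrc) (f : mor T S) (g g' : mor S P) :
  mcomp g f = mcomp g' f -> g = g'.
Proof.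
move=> e; apply: mor_ext => [h|y].
  by apply: (mor_inj (mor_specP f)); rewrite -!mcomp_hmap e.
by have [x <-] := mor_surj (mor_specP f) y; rewrite -!mcomp_vmap e.
Qed.

Lemma iso_ext (G H : ggGrc) (a b : iso G H) : iso_mor a = iso_mor b -> a = b.
Proof.
case: a b => [a a' ak ak'] [b b' bk bk'] /= e; subst b.
have e : a' = b' by apply: (@mcomp_epi _ _ _ a); rewrite ak bk.
by subst b'; congr Iso; apply: Prop_irrelevance.
Qed.

Definition iso_sym (G H : ggGrc) (w : iso G H) : iso H G := Iso (isoVK w) (isoK w).

Lemma iso_hmapK (G H : ggGrc) (w : iso G H) : cancel (hmap w) (hmap (iso_inv w)).
Proof. by move=> h; rewrite -mcomp_hmap isoVK ffunE. Qed.

Lemma iso_hmapVK (G H : ggGrc) (w : iso G H) : cancel (hmap (iso_inv w)) (hmap w).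
Proof. by move=> h; rewrite -mcomp_hmap isoK ffunE. Qed.

Lemma iso_vmapK (G H : ggGrc) (w : iso G H) : cancel (vmap w) (vmap (iso_inv w)).
Proof. by move=> h; rewrite -mcomp_vmap isoK ffunE. Qed.

Lemma iso_vmapVK (G H : ggGrc) (w : iso G H) : cancel (vmap (iso_inv w)) (vmap w).
Proof. by move=> h; rewrite -mcomp_vmap isoVK ffunE. Qed.

Lemma iso_codom (G H : ggGrc) (w : iso G H) h : h \in codom (hmap w).
Proof. by rewrite -(iso_hmapVK w h) codom_f. Qed.

Lemma mcomp_codom (T S P : ggGrc) (g : mor S P) (f : mor T S) h :
  (hmap f h \in codom (hmap (mcomp g f))) = (h \in codom (hmap g)).
Proof.
apply/codomP/codomP => -[a e]; exists a; last by rewrite mcomp_hmap e.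
by apply: (mor_inj (mor_specP f)); rewrite e mcomp_hmap.
Qed.

Lemma mcomp_codomS (T S P : ggGrc) (g : mor S P) (f : mor T S) h :
  h \in codom (hmap (mcomp g f)) -> h \in codom (hmap f).
Proof. by case/codomP=> a ->; rewrite mcomp_hmap codom_f. Qed.

Lemma mor_legs_codom (G H : ggGrc) (f : mor G H) h : flip G h = h -> h \in codom (hmap f).
Proof.
move=> /eqP; rewrite -(g_legs (ggGrc_spec G)) -(mor_legs (mor_specP f)) => /mapP[a _ ->].
exact: codom_f.
Qed.

Lemma mor_same_fiber (T S : ggGrc) (f : mor T S) x y :
  vmap f x = vmap f y -> connect (radj f) x y.
Proof.
move=> e.
have /(connected_prefiber _ (mor_contr (mor_specP f)))[_] := mor_conn (mor_specP f) (vmap f y).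
by apply.
Qed.

(** * Factorization through a contraction *)

(** The outer map is only a [premor]: the count serves to prove the genus condition of a factor that
    is not yet known to be a morphism. *)
Lemma card_inner_precomp (T S : ggGrc) (P : pregraph) (f : mor T S) (g : premor S P) v :
  #|inner (precomp f g) v| = #|inner g v| + \sum_(w | vmap g w == v) #|inner f w|.
Proof.
have fm := mor_specP f.
have cE h : (hmap f h \in codom (hmap (precomp f g))) = (h \in codom (hmap g)).
  apply/codomP/codomP => -[a e]; exists a; last by rewrite ffunE e.
  by apply: (mor_inj fm); rewrite e ffunE.
rewrite -(card_imset _ (mor_inj fm)).
have -> : \sum_(w | vmap g w == v) #|inner f w| =
          #|[set h | (vmap g (vmap f (vtx T h)) == v) && (h \notin codom (hmap f))]|.
  rewrite -sum1_card (partition_big (fun h => vmap f (vtx T h)) (fun w => vmap g w == v)) /=.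
    apply: eq_bigr => w wv; rewrite -sum1_card; apply: eq_bigl => h.
    by rewrite !inE; case: (vmap f (vtx T h) =P w) => [->|]; rewrite ?wv ?andbT ?andbF.
  by move=> h; rewrite inE => /andP[].
rewrite -cardsUI [X in _ + X](_ : _ = 0) ?addn0; last first.
  apply: eq_card0 => h; rewrite !inE; apply/negP=> /andP[/imsetP[a _ ->]].
  by rewrite codom_f andbF.
apply: eq_card => h; rewrite !inE ffunE.
case: (boolP (h \in codom (hmap f))) => [/codomP[a ->]|hf].
  by rewrite andbF orbF cE (mor_vtx fm) (mem_imset _ _ (mor_inj fm)) !inE.
rewrite andbT [X in X || _](_ : _ = false) /=; last first.
  by apply/negP=> /imsetP[a _ e]; rewrite e codom_f in hf.
rewrite andbC; case: codomP => // -[a e]; case/negP: hf.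
by rewrite e ffunE codom_f.
Qed.

Section Factor.
Variables (T R S : ggGrc) (f : mor T R) (p : mor T S).
Hypothesis sub : forall a, hmap p a \in codom (hmap f).
Let fm := mor_specP f.
Let pm := mor_specP p.

Let vsurj y : y \in codom (vmap f).
Proof. by have [x <-] := mor_surj fm y; apply: codom_f. Qed.

Let q : premor R S := Premor [ffun a => iinv (sub a)] [ffun y => vmap p (iinv (vsurj y))].

Let qh a : hmap f (hmap q a) = hmap p a.
Proof. by rewrite ffunE f_iinv. Qed.

Let sub' h : h \notin codom (hmap f) -> h \notin codom (hmap p).
Proof. by apply: contraNN => /codomP[a ->]. Qed.

(** Independence of the chosen preimage: a fiber of [f] is connected through edges contracted by
    [f], and [p] contracts these as well. *)
Let qv x : vmap q (vmap f x) = vmap p x.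
Proof.
rewrite ffunE; have: vmap f (iinv (vsurj (vmap f x))) = vmap f x by rewrite f_iinv.
move/mor_same_fiber/connectP => [s]; elim: s (iinv _) => [|z s IH] y /=; first by move=> _ ->.
case/andP=> /existsP[h /and3P[hc /eqP hx /eqP hz]] /IH{}IH /IH <-.
by rewrite -hx -hz (mor_contr pm) // sub'.
Qed.

Let qc a : (hmap f a \in codom (hmap p)) = (a \in codom (hmap q)).
Proof.
apply/codomP/codomP => -[b e]; exists b; last by rewrite e qh.
by apply: (mor_inj fm); rewrite qh.
Qed.

Let fq : precomp f q = p.
Proof.
case: (mor_val p) qh qv => a b /= qh' qv'.
by congr Premor; apply/ffunP=> x; rewrite ffunE /=; [exact: qh'|exact: qv'].
Qed.

Let q_contr a : a \notin codom (hmap q) -> vmap q (vtx R a) = vmap q (vtx R (flip R a)).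
Proof.
rewrite -qc => /(mor_contr pm).
by rewrite -(mor_flip fm) -!(mor_vtx fm) !qv.
Qed.

Let q_inj : injective (hmap q).
Proof. by move=> a b e; apply: (mor_inj pm); rewrite -!qh e. Qed.

Let q_flip a : hmap q (flip S a) = flip R (hmap q a).
Proof. by apply: (mor_inj fm); rewrite qh (mor_flip fm) qh (mor_flip pm). Qed.

Let q_legs : map (hmap q) (legs S) = legs R.
Proof.
apply: (inj_map (mor_inj fm)); rewrite (mor_legs fm) -(mor_legs pm) -map_comp.
exact/eq_map/qh.
Qed.

Let q_vtx a : vmap q (vtx R (hmap q a)) = vtx S a.
Proof. by rewrite -(mor_vtx fm) qv qh (mor_vtx pm). Qed.

Let q_conn v : connected (prefiber q v).
Proof.
apply/connected_prefiber=> //; split.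
  by have [x <-] := mor_surj pm v; exists (vmap f x); rewrite qv.
move=> y y'; have [x <-] := mor_surj fm y; have [x' <-] := mor_surj fm y'.
rewrite !qv => <- /esym/mor_same_fiber/connectP[s].
elim: s x => [|z s IH] x /=; first by move=> _ ->; apply: connect0.
case/andP=> /existsP[h /and3P[hc /eqP <- /eqP <-]] /IH{}IH /IH; apply: connect_trans.
case: (boolP (h \in codom (hmap f))) => [/codomP[a ea]|hf]; last first.
  by rewrite (mor_contr fm) // connect0.
apply: connect1; apply/existsP; exists a; rewrite -qc -ea hc.
by rewrite ea -(mor_flip fm) !(mor_vtx fm) !eqxx.
Qed.

Let q_mor : is_mor q.
Proof.
have oq v := prefiber_ordered_gen v (ggGrc_ordered R) q_inj q_flip q_legs q_vtx q_contr.
apply/is_morP; split=> // v; first by have /connected_prefiber[] := q_conn v.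
(* Doubling turns edges into half-edges. By [genus_prefiber], 2g-2 of a fiber is the sum of 2g-2
   over its vertices plus its number of inner half-edges; this is additive, so the condition for [q]
   follows from those for [f] and [p] by grouping vertices and half-edges along [f]. *)
apply: (@mulIf _ 2%R) => //.
rewrite (genus_prefiber (ggGrc_ordered R)) //.
rewrite (mor_genus pm) (genus_prefiber (ggGrc_ordered T)); first last.
- exact: mor_legs pm.
- exact: mor_contr pm.
- exact: mor_conn pm v.
- exact: prefiber_ordered (ggGrc_ordered T) (morP p).
congr (_ + _)%R; rewrite -fq card_inner_precomp PoszD addrC [RHS]addrC -addrA; congr (_ + _)%R.
rewrite (partition_big (fun x => vmap f x) (fun w => vmap q w == v)) /=; last first.
  by move=> x; rewrite ffunE.
rewrite -natz natr_sum -big_split /=; apply: eq_bigr => w wv.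
rewrite (mor_genus fm) (genus_prefiber (ggGrc_ordered T)); first last.
- exact: mor_legs fm.
- exact: mor_contr fm.
- exact: mor_conn fm w.
- exact: prefiber_ordered (ggGrc_ordered T) (morP f).
rewrite addrK addrC; congr (_ + _)%R; last by rewrite natz.
apply: eq_bigl => x.
by rewrite ffunE; case: (vmap f x =P w) => [->|]; rewrite ?andbF // wv.
Qed.

(** The universal property of a contraction: it suffices that [p] contracts whatever [f] contracts.
    The comparison maps below come from here instead of from formulas. *)
Lemma mor_factor : exists g : mor R S, mcomp g f = p.
Proof. by exists (Mor q_mor); apply: mor_eq; rewrite /= fq. Qed.

End Factor.

(** The identity of [T] factors through a map that contracts nothing; the left inverse so obtained
    is two-sided because [f] is epi. *)
Lemma mor_full_iso (T S : ggGrc) (f : mor T S) :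
  (forall h, h \in codom (hmap f)) -> exists w : iso T S, iso_mor w = f.
Proof.
move=> full; have [g gf] := @mor_factor _ _ _ f (mid T) (fun a => full _).
have fg : mcomp f g = mid S by apply: (@mcomp_epi _ _ _ f); rewrite -mcompA gf mcomp1 mcomp1l.
by exists (Iso gf fg).
Qed.

(** * Construction of contractions and relabellings *)

Section KeyRank.
Variables (n : nat) (H : {set 'I_n}) (key : 'I_n -> nat).
Hypothesis key_inj : injective key.

Definition key_rank h := #|[set x in H | key x < key h]|.

Lemma key_rank_lt h : h \in H -> key_rank h < #|H|.
Proof.
move=> hH; apply/proper_card/properP; split; first by apply/subsetP=> x; rewrite inE => /andP[].
by exists h => //; rewrite inE ltnn andbF.
Qed.

Lemma ltn_key_rank h h' : h \in H -> h' \in H -> (key_rank h < key_rank h') = (key h < key h').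
Proof.
have mono x y : x \in H -> key x < key y -> key_rank x < key_rank y.
  move=> xH xy; apply/proper_card/properP; split.
    by apply/subsetP=> z; rewrite !inE => /andP[-> /ltn_trans]; apply.
  by exists x; rewrite !inE ?xH ?xy ?ltnn.
move=> hH hH'; case: (ltngtP (key h) (key h')) => [hh|hh|/key_inj ->]; last by rewrite ltnn.
  by rewrite mono.
by apply/negbTE; rewrite -leqNgt ltnW // mono.
Qed.

(** Half-edges of a new graph have to be ordinals in their new order, so the surviving ones are
    renumbered by sorting along an injective key. *)
Lemma enum_by_key : exists a : 'I_#|H| -> 'I_n,
  [/\ injective a, forall h, (h \in codom a) = (h \in H)
    & forall i j : 'I_#|H|, (i < j) = (key (a i) < key (a j))].
Proof.
pose b (i : 'I_#|H|) := Ordinal (key_rank_lt (enum_valP i)).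
have b_inj : injective b.
  move=> i j /(congr1 val)/= e; apply: enum_val_inj; apply: key_inj.
  have Lij := ltn_key_rank (enum_valP i) (enum_valP j).
  have Lji := ltn_key_rank (enum_valP j) (enum_valP i).
  rewrite e ltnn in Lij; rewrite e ltnn in Lji.
  by case: ltngtP Lij Lji.
have [b' bK b'K] := injF_bij b_inj.
exists (fun i => enum_val (b' i)); split.
- by move=> i j /enum_val_inj/(can_inj b'K).
- move=> h; apply/codomP/idP => [[i ->]|hH]; first exact: enum_valP.
  by exists (b (enum_rank_in hH h)); rewrite bK enum_rankK_in.
- by move=> i j; rewrite -ltn_key_rank ?enum_valP // -{1}(b'K i) -{1}(b'K j).
Qed.

End KeyRank.

Lemma mor_target_connected (G H : pregraph) (f : premor G H) :
  (forall h, hmap f (flip H h) = flip G (hmap f h)) ->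
  (forall v, exists x, vmap f x = v) ->
  (forall h, vmap f (vtx G (hmap f h)) = vtx H h) ->
  (forall h, h \notin codom (hmap f) -> vmap f (vtx G h) = vmap f (vtx G (flip G h))) ->
  connected G -> connected H.
Proof.
move=> i1 i2 i3 i4 /andP[n0 /forallP cG].
apply/andP; split; first by apply: leq_ltn_trans (ltn_ord (vmap f (Ordinal n0))).
apply/forallP=> y; apply/forallP=> y'; have [x <-] := i2 y; have [x' <-] := i2 y'.
have /forallP/(_ x')/connectP[s] := cG x.
elim: s x => [|z s IH] x /=; first by move=> _ ->; apply: connect0.
case/andP=> /existsP[h /andP[/eqP <- /eqP <-]] /IH{}IH /IH; apply: connect_trans.
case: (boolP (h \in codom (hmap f))) => [/codomP[a ->]|/i4 ->]; last exact: connect0.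
by apply: connect1; apply/existsP; exists a; rewrite -i1 !i3 !eqxx.
Qed.

Section Build.
Variables (T : ggGrc) (m : nat) (q : 'I_(nv T) -> 'I_m) (H : {set 'I_(nh T)}).
Variables (key : 'I_(nh T) -> nat) (vg : 'I_m -> nat).
Hypotheses (q_surj : forall v, exists x, q x = v).
Hypothesis H_flip : forall h, h \in H -> flip T h \in H.
Hypothesis H_legs : forall h, flip T h = h -> h \in H.
Hypothesis q_contr : forall h, h \notin H -> q (vtx T h) = q (vtx T (flip T h)).
Hypothesis q_conn : forall x y, q x = q y ->
  connect (fun x y => [exists h, [&& h \notin H, vtx T h == x & vtx T (flip T h) == y]]) x y.
Hypothesis key_inj : injective key.
Hypothesis key_mono : forall h h', q (vtx T h) < q (vtx T h') -> key h < key h'.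
Hypothesis vg_genus : forall v, ((vg v)%:Z * 2 =
  \sum_(x | q x == v) ((vgen T x)%:Z * 2 - 2)
  + (#|[set h | (q (vtx T h) == v) && (h \notin H)]|)%:Z + 2)%R.

(** The target keeps the half-edges of [H], numbered by [key]; the key must refine the order of
    vertices since half-edges are numbered by vertex first. [vg_genus] is the doubled genus formula
    for the fibers. As the number of vertices of [S] is hidden by the existential, [q] survives only
    through the order it induces. *)
Lemma mor_build : exists (S : ggGrc) (f : mor T S),
  [/\ forall x y : 'I_(nv T), (vmap f x < vmap f y) = (q x < q y),
      forall h, (h \in codom (hmap f)) = (h \in H)
    & forall a b : 'I_(nh S), (a < b) = (key (hmap f a) < key (hmap f b))].
Proof.
have Ts := ggGrc_spec T.
have [a [a_inj a_cod a_lt]] := enum_by_key H key_inj.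
have aH i : a i \in H by rewrite -a_cod codom_f.
have inH h : h \in H -> exists i, a i == h by rewrite -a_cod => /codomP[i ->]; exists i.
pose b i := xchoose (inH _ (H_flip (aH i))).
have bK i : a (b i) = flip T (a i) by apply/eqP; rewrite (xchooseP (inH _ _)).
pose S0 := @Pregraph m #|H| [ffun i => q (vtx T (a i))] [ffun i => b i]
  (pmap (fun h => [pick i | a i == h]) (legs T)) [ffun v => vg v].
pose f0 : premor T S0 := Premor
  ([ffun i => a i] : {ffun 'I_(nh S0) -> 'I_(nh T)}) ([ffun x => q x] : {ffun 'I_(nv T) -> 'I_(nv S0)}).
have cod h : (h \in codom (hmap f0)) = (h \in H).
  have e : hmap f0 =1 a by move=> i; rewrite ffunE.
  by rewrite (eq_codom e) a_cod.
have i1 : injective (hmap f0) by move=> i j; rewrite !ffunE => /a_inj.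
have i2 i : hmap f0 (flip S0 i) = flip T (hmap f0 i) by rewrite !ffunE bK.
have i3 : map (hmap f0) (legs S0) = legs T.
  have: all [pred h | h \in H] (legs T).
    by apply/allP=> h; rewrite (g_legs Ts) inE => /eqP/H_legs.
  rewrite /=; elim: (legs T) => //= h s IH /andP[hH /IH sE].
  case: pickP => [i /eqP e|/(_ (xchoose (inH _ hH)))]; first by rewrite /= sE ffunE e.
  by rewrite (xchooseP (inH _ hH)).
have i4 v : exists x, vmap f0 x = v by have [x <-] := q_surj v; exists x; rewrite ffunE.
have i5 i : vmap f0 (vtx T (hmap f0 i)) = vtx S0 i by rewrite !ffunE.
have i6 h : h \notin codom (hmap f0) -> vmap f0 (vtx T h) = vmap f0 (vtx T (flip T h)).
  by rewrite cod !ffunE => /q_contr.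
have i7 v : connected (prefiber f0 v).
  apply/connected_prefiber=> //; split=> // x y <-; rewrite !ffunE => /esym/q_conn.
  apply: connect_sub => {}x {}y /existsP[h /and3P[h1 h2 h3]]; apply: connect1.
  by apply/existsP; exists h; rewrite cod h1 h2.
have oS : ordered_graph S0.
  apply/ordered_graphP; split.
  - move=> i j ij; rewrite !ffunE leqNgt; apply/negP=> /key_mono.
    by rewrite -a_lt ltnNge ij.
  - by move=> i; apply: a_inj; rewrite !ffunE !bK (g_flip Ts).
  - by rewrite -(map_inj_uniq i1) i3 (g_uniq Ts).
  - by move=> i; rewrite -(mem_map i1) i3 (g_legs Ts) -i2 (inj_eq i1).
have cS := mor_target_connected i2 i4 i5 i6 (ggGrc_connected T).
have S0P : ordered_graph S0 && connected S0 by rewrite oS cS.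
have fm : is_mor f0.
  apply/is_morP; split=> // v; apply: (@mulIf _ 2%R) => //.
  rewrite (genus_prefiber (ggGrc_ordered T)) //; last first.
    exact: prefiber_ordered_gen (ggGrc_ordered T) i1 i2 i3 i5 i6.
  rewrite ffunE vg_genus; congr (_ + _ + _)%R; first by apply: eq_bigl => x; rewrite ffunE.
  by congr Posz; apply: eq_card => h; rewrite !inE cod ffunE.
exists (GgGrc S0P), (@Mor _ (GgGrc S0P) f0 fm); split=> //.
- by move=> x y; rewrite !ffunE.
- by move=> i j; rewrite a_lt !ffunE.
Qed.

End Build.

Lemma ltn_lex (N a b a' b' : nat) : b < N -> b' < N ->
  (a * N + b < a' * N + b') = (a < a') || (a == a') && (b < b').
Proof.
move=> bN bN'; case: (ltngtP a a') => [aa|aa|->] /=.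
- nia.
- by apply/negbTE; rewrite -leqNgt; nia.
- by rewrite ltn_add2l.
Qed.

Lemma lex_inj (N a b a' b' : nat) : b < N -> b' < N ->
  a * N + b = a' * N + b' -> a = a' /\ b = b'.
Proof.
move=> bN bN' e; have N0 : 0 < N by apply: leq_ltn_trans bN.
have := congr1 (divn^~ N) e; rewrite /= !divnMDl // !divn_small // !addn0 => ea.
by move/eqP: e; rewrite ea eqn_add2l => /eqP.
Qed.

(** Isomorphisms fix the global order but neither the numbering of vertices nor the local orders, so
    any choice of the latter two is realized. *)
Lemma relabel (T : ggGrc) (vkey : 'I_(nv T) -> nat) (hkey : 'I_(nh T) -> nat) :
  injective vkey ->
  (forall h h', vtx T h = vtx T h' -> hkey h = hkey h' -> h = h') ->
  exists (T' : ggGrc) (w : iso T T'),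
    (forall x y : 'I_(nv T), (vmap w x < vmap w y) = (vkey x < vkey y)) /\
    (forall a b : 'I_(nh T'), vtx T' a = vtx T' b ->
       (a < b) = (hkey (hmap w a) < hkey (hmap w b))).
Proof.
move=> vinj hinj.
pose N := (\max_h hkey h).+1.
have hN h : hkey h < N by rewrite ltnS leq_bigmax.
pose r x : 'I_(nv T) := Ordinal (leq_trans (key_rank_lt vkey (in_setT x)) (eq_leq (etrans (cardsT _) (card_ord _)))).
have rlt x y : (r x < r y) = (vkey x < vkey y) by apply: (ltn_key_rank vinj).
have rinj : injective r.
  move=> x y e; apply: vinj; have := rlt x y; have := rlt y x; rewrite e ltnn.
  by case: ltngtP.
(* The lexicographic order, vertex first, coded as a number; [N] exceeds every value of [hkey]. *)
pose key h := r (vtx T h) * N + hkey h.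
have kinj : injective key.
  move=> h h' /lex_inj[]// /val_inj/rinj; exact: hinj.
have kmono h h' : r (vtx T h) < r (vtx T h') -> key h < key h'.
  by move=> l; rewrite /key ltn_lex // l.
have [r' rK r'K] := injF_bij rinj.
have [v|h|h|h|x y|v|T' [f [fv fh fk]]] :=
  @mor_build T _ r setT key (fun v => vgen T (r' v)) _ _ _ _ _ kinj kmono.
- by exists (r' v).
- by rewrite !inE.
- by rewrite inE.
- by rewrite inE.
- by move/rinj=> ->; apply: connect0.
- rewrite (big_pred1 (r' v)) => [|x]; last by rewrite -{1}(r'K v) (inj_eq rinj).
  have -> : [set h | (r (vtx T h) == v) && (h \notin setT)] = set0.
    by apply/setP=> h; rewrite !inE andbF.
  by rewrite cards0 addr0 subrK.
have [|w wf] := @mor_full_iso _ _ f; first by move=> h; rewrite fh inE.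
exists T', w; rewrite wf; split=> [x y|a b ab]; first by rewrite fv rlt.
have rab : r (vtx T (hmap f a)) = r (vtx T (hmap f b)).
  have fm := mor_specP f.
  have := fv (vtx T (hmap f a)) (vtx T (hmap f b)); have := fv (vtx T (hmap f b)) (vtx T (hmap f a)).
  by rewrite !(mor_vtx fm) ab ltnn => ba ab'; apply: val_inj; case: ltngtP ba ab'.
by rewrite fk /key rab ltn_add2l.
Qed.

(** Speaking of half-edges only treats loops and links alike, although a loop raises a vertex genus
    and a link merges two vertices. *)
Definition one_edge (T S : ggGrc) (f : mor T S) (h : 'I_(nh T)) : Prop :=
  forall g, (g \notin codom (hmap f)) = (g == h) || (g == flip T h).

Lemma contract_edge (T : ggGrc) (h : 'I_(nh T)) : flip T h != h ->
  exists (S : ggGrc) (f : mor T S), one_edge f h.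
Proof.
move=> hh; have Ts := ggGrc_spec T.
have eqh g : (flip T g == h) || (flip T g == flip T h) = (g == h) || (g == flip T h).
  by rewrite (inj_eq (inv_inj (g_flip Ts))) -{1}(g_flip Ts h) (inj_eq (inv_inj (g_flip Ts))) orbC.
pose x0 := vtx T h; pose y0 := vtx T (flip T h).
(* [r] merges the end [y0] into [x0], and is the identity for a loop. Its fixed points, numbered
   increasingly, become the vertices of the contraction. *)
pose r x := if x == y0 then x0 else x.
have rr x : r (r x) = r x.
  by rewrite /r; case: (x =P y0) => [_|/eqP/negbTE -> //]; case: ifP.
pose A := [set x | r x == x].
have rA x : r x \in A by rewrite inE rr.
pose q x := enum_rank_in (rA x) (r x).
have qE x : enum_val (q x) = r x by rewrite enum_rankK_in.
have qq x y : (q x == q y) = (r x == r y) by rewrite -(inj_eq enum_val_inj) !qE.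
pose H := [set g | (g != h) && (g != flip T h)].
have HE g : (g \notin H) = (g == h) || (g == flip T h) by rewrite inE -negb_or negbK.
pose key g := q (vtx T g) * nh T + g.
pose rx0 := q x0.
(* The genus of the fiber: a loop contributes its Betti number 1, a link adds the genera of its
   ends. *)
pose vg v := if v == rx0 then (if x0 == y0 then (vgen T x0).+1 else vgen T x0 + vgen T y0)
  else vgen T (enum_val v).
have rxy : r x0 = r y0 by rewrite /r eqxx; case: eqP.
have ry0 : r y0 = x0 by rewrite /r eqxx.
have [v|g|g|g|x y||g g' gg|v|S [f [_ fH _]]] := @mor_build T _ q H key vg.
- by exists (enum_val v); apply: enum_val_inj; rewrite qE; have := enum_valP v; rewrite inE => /eqP.
- by apply: contraLR; rewrite !HE eqh.
- move=> gl; apply: contraT; rewrite HE => /orP[]/eqP e; move: hh.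
    by rewrite -e gl eqxx.
  by rewrite -[X in _ != X](g_flip Ts) -e gl eqxx.
- by rewrite HE => /orP[]/eqP ->; apply/eqP; rewrite qq ?(g_flip Ts) -/x0 -/y0 rxy.
- move/eqP; rewrite qq /r => rxy0.
  set e := (fun _ _ => _).
  have cxy : connect e x0 y0 by apply: connect1; apply/existsP; exists h; rewrite HE !eqxx.
  have cyx : connect e y0 x0.
    by apply: connect1; apply/existsP; exists (flip T h); rewrite HE (g_flip Ts) !eqxx orbT.
  case: (x =P y0) rxy0 => [->|_]; case: (y =P y0) => [->|_] /eqP.
  - by move=> _; apply: connect0.
  - by move=> <-.
  - by move=> ->.
  - by move=> ->; apply: connect0.
- move=> g g' /lex_inj[]// _; exact: val_inj.
- by rewrite /key ltn_lex // gg.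
- have sE : [set g | (q (vtx T g) == v) && (g \notin H)] = if v == rx0 then [set h; flip T h] else set0.
    apply/setP=> g; rewrite inE HE.
    have [gh|gh] := boolP ((g == h) || (g == flip T h)); last first.
      by rewrite andbF; case: ifP; rewrite !inE // (negbTE gh).
    have -> : q (vtx T g) = rx0.
      by case/orP: gh => /eqP -> //; apply/eqP; rewrite qq -rxy.
    by rewrite andbT eq_sym; case: eqP; rewrite !inE.
  rewrite {}sE (eq_bigl (fun x => r x == enum_val v)); last first.
    by move=> x; rewrite -(inj_eq enum_val_inj) qE.
  rewrite /vg; case: (v =P rx0) => [->|/eqP vx]; last first.
    have vA := enum_valP v; rewrite inE in vA.
    have vx0 : enum_val v != x0.
      by apply: contraNneq vx => e; rewrite -(inj_eq enum_val_inj) qE -e (eqP vA).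
    rewrite (big_pred1 (enum_val v)) => [|x]; first by rewrite cards0 addr0 subrK.
    rewrite {1}/r /=; case: (x =P y0) => // ->.
    rewrite eq_sym (negbTE vx0); apply/esym/negbTE; apply: contraNneq vx0 => e.
    by rewrite -e -ry0 e (eqP vA).
  rewrite cards2 [h == _]eq_sym hh qE.
  have rE x : (r x == r x0) = (x == x0) || (x == y0).
    rewrite rxy ry0 /r; case: (x =P y0) => [->|_]; first by rewrite eqxx orbT.
    by rewrite orbF.
  rewrite (eq_bigl _ _ rE); case: (x0 =P y0) => [e|/eqP xy].
    rewrite -e (big_pred1 x0) => [|x]; last by rewrite /= orbb.
    by rewrite subrK -addn1 PoszD mulrDl.
  rewrite (bigD1 x0) /=; last by rewrite eqxx.
  rewrite (big_pred1 y0) => [|x]; last first.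
    by rewrite /=; case: (x =P x0) => [->|_]; rewrite ?andbF ?andbT // (negbTE xy).
  rewrite PoszD mulrDl; move: (_ * 2)%R (_ * 2)%R; clear=> a b /=; lia.
by exists S, f => g; rewrite fH HE.
Qed.

Lemma one_edge_flip (T S : ggGrc) (f : mor T S) h : one_edge f h -> one_edge f (flip T h).
Proof. by move=> fh g; rewrite fh (g_flip (ggGrc_spec T)) orbC. Qed.

Lemma one_edge_neq (T S : ggGrc) (f : mor T S) h : one_edge f h -> flip T h != h.
Proof.
move=> fh; apply: contraT; rewrite negbK => /eqP/(mor_legs_codom f).
by have := fh h; rewrite eqxx /=; case: (h \in _).
Qed.

(** Each map contracts what the other does, so one factors through the other and the factor
    contracts nothing. *)
Lemma one_edge_iso (T S S' : ggGrc) (f : mor T S) (f' : mor T S') h :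
  one_edge f h -> one_edge f' h -> exists s : iso S S', mcomp s f = f'.
Proof.
move=> fh fh'.
have cc g : (g \in codom (hmap f)) = (g \in codom (hmap f')).
  by apply: negb_inj; rewrite fh fh'.
have [a ea] : exists g, mcomp g f = f'.
  by apply: mor_factor => b; rewrite cc codom_f.
have [|s es] := @mor_full_iso _ _ a; last by exists s; rewrite es.
move=> b; have: hmap f b \in codom (hmap f') by rewrite -cc codom_f.
by rewrite -ea mcomp_codom.
Qed.

(** * Trivial fibers and elementary morphisms *)

Lemma sorted_ord_mono n (s : seq 'I_n) (a b : 'I_n) :
  sorted ltn (map val s) -> a \in s -> b \in s -> (a < b) = (index a s < index b s).
Proof.
have tr : transitive (relpre (@nat_of_ord n) ltn) by move=> x y z; apply: ltn_trans.
rewrite sorted_map => /(sorted_ltn_index tr) H aS bS.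
case: (ltngtP (index a s) (index b s)) => [l|l|/(index_inj a aS bS) ->]; last exact: ltnn.
  exact: H.
by apply/negbTE; rewrite -leqNgt ltnW //; apply: H.
Qed.

Lemma map_enum_val n (A : {set 'I_n}) : [seq enum_val i | i : 'I_#|A|] = enum A.
Proof.
apply: (inj_map val_inj); apply: (@irr_sorted_eq _ ltn ltn_trans ltnn).
- rewrite sorted_map /image_mem sorted_map; have := sorted_enum_ord (mem 'I_#|A|).
  by rewrite sorted_map; apply: sub_sorted => i j /=; rewrite /relpre /= enum_val_lt.
- exact: sorted_enum_ord.
move=> x; apply/mapP/mapP => -[y yA ->]; exists y => //.
  by case/imageP: yA => i _ ->; rewrite mem_enum enum_valP.
rewrite mem_enum in yA; apply/imageP; exists (enum_rank_in yA y) => //.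
by rewrite enum_rankK_in.
Qed.

(** Triviality read off [f] itself: one vertex, no contracted edge, and equal orders, since the
    global order of the fiber is the local order of [S] at [v] and its local order is that of
    [T]. *)
Lemma trivial_fiberP (T S : ggGrc) (f : mor T S) (v : 'I_(nv S)) :
  trivial (fiber f v) <->
  [/\ forall x y, vmap f x = v -> vmap f y = v -> x = y,
      forall h, vmap f (vtx T h) = v -> h \in codom (hmap f)
    & forall a b : 'I_(nh S), vtx S a = v -> vtx S b = v -> a < b -> hmap f a < hmap f b].
Proof.
have fm := mor_specP f; have oF := prefiber_ordered v (ggGrc_ordered T) (morP f).
have neE := ne_prefiber (ggGrc_ordered T) oF (mor_contr fm) (mor_legs fm).
set L := enum [pred h | vtx S h == v].
have LE h : (h \in L) = (vtx S h == v) by rewrite mem_enum.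
have lE : (legs (fiber f v) == enum 'I_(nh (fiber f v))) =
    (map (hmap f) L == enum (fhalf f v)).
  rewrite -(inj_eq (inj_map (@enum_val_inj _ (mem (fhalf f v))))).
  by rewrite (fib_legs (mor_vtx fm)) -[in RHS]map_enum_val.
rewrite /trivial /local_terminal {}lE; split.
  case/andP=> /andP[/eqP n1 /eqP e0] /eqP lE; split.
  - move=> x y xv yv; have /eqP/cards1P[z zE] : nv (fiber f v) = 1 by [].
    have: x \in fvert f v by rewrite inE xv.
    have: y \in fvert f v by rewrite inE yv.
    by rewrite zE !inE => /eqP -> /eqP ->.
  - move=> h hv; apply: contraT => hc.
    have /eqP := neE; rewrite [ne _]e0 eq_sym cards_eq0 => /eqP/setP/(_ h).
    by rewrite !inE hv eqxx hc.
  - move=> a b /eqP; rewrite -LE => aL /eqP; rewrite -LE => bL.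
    have e := sorted_enum_ord (mem (fhalf f v)); rewrite -lE in e.
    rewrite (sorted_ord_mono (sorted_enum_ord _) aL bL) (sorted_ord_mono e) ?map_f //.
    by rewrite !(index_map (mor_inj fm)).
case=> h1 h2 h3; apply/andP; split; first (apply/andP; split).
- have [x xv] := mor_surj fm v; apply/cards1P; exists x; apply/setP=> y.
  by rewrite !inE; apply/eqP/eqP => [yv|->//]; apply: h1.
- rewrite -(eqn_pmul2r (isT : 0 < 2)) mul0n [ne _ * 2]neE cards_eq0; apply/eqP/setP=> h.
  by rewrite !inE; case: eqP => // /h2 ->.
apply/eqP/(inj_map val_inj)/(@irr_sorted_eq _ ltn ltn_trans ltnn).
- rewrite !sorted_map; have := sorted_enum_ord [pred h | vtx S h == v]; rewrite -/L sorted_map.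
  apply: (@sub_in_sorted _ (mem L)); last exact/allP.
  by move=> a b; rewrite !LE => /eqP av /eqP bv ab; apply: h3.
- exact: sorted_enum_ord.
move=> z; apply/mapP/mapP => -[h]; last first.
  rewrite mem_enum inE => /eqP hv ->; exists h => //.
  by have /codomP[b e] := h2 _ hv; rewrite e map_f // LE -(mor_vtx fm) -e hv.
case/mapP=> b; rewrite LE => /eqP bv -> ->; exists (hmap f b) => //.
by rewrite mem_enum inE (mor_vtx fm) bv.
Qed.

Lemma elementaryP (T S : ggGrc) (f : mor T S) (i : 'I_(nv S)) :
  elementary f i <->
  [/\ forall x y : 'I_(nv T), x <= y -> vmap f x <= vmap f y,
      forall v, v != i -> trivial (fiber f v)
    & exists2 h, vmap f (vtx T h) = i & h \notin codom (hmap f)].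
Proof.
have fm := mor_specP f; have oF := prefiber_ordered i (ggGrc_ordered T) (morP f).
have neE := ne_prefiber (ggGrc_ordered T) oF (mor_contr fm) (mor_legs fm).
have ->: elementary f i = [&& [forall x : 'I_(nv T), forall y : 'I_(nv T),
         (x <= y) ==> (vmap f x <= vmap f y)],
      [forall j, (j != i) ==> trivial (fiber f j)]
    & 0 < #|inner f i|] by rewrite -neE muln_gt0 andbT.
split=> [/and3P[/forallP h1 /forallP h2 /card_gt0P[h]]|[h1 h2 [h hi hc]]].
  rewrite inE => /andP[/eqP hi hc]; split=> [x y xy|v vi|]; last by exists h.
    by have /forallP/(_ y)/implyP := h1 x; apply.
  by have /implyP := h2 v; apply.
apply/and3P; split.
- by apply/forallP=> x; apply/forallP=> y; apply/implyP/h1.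
- by apply/forallP=> v; apply/implyP/h2.
- by apply/card_gt0P; exists h; rewrite inE hi eqxx.
Qed.

(** A fiber is connected through contracted edges; without any it is a single vertex. *)
Lemma mor_no_inner_inj (T S : ggGrc) (f : mor T S) v :
  (forall h, vmap f (vtx T h) = v -> h \in codom (hmap f)) ->
  forall x y, vmap f x = v -> vmap f y = v -> x = y.
Proof.
move=> hv x y xv yv; have /connectP[[|z s] //=] := mor_same_fiber (etrans xv (esym yv)).
case/andP=> /existsP[h /and3P[hc /eqP hx _]]; case/negP: hc.
by apply: hv; rewrite hx.
Qed.

(* Sort the vertices of T by their image in S, and the half-edges that do not
   land in B in the order of S. *)
Lemma make_elementary (T S : ggGrc) (f : mor T S) (B : pred 'I_(nv S)) :
  (forall h, ~~ B (vmap f (vtx T h)) -> h \in codom (hmap f)) ->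
  exists (T' : ggGrc) (w : iso T T') (f' : mor T' S),
    [/\ mcomp f' w = f, forall x y : 'I_(nv T'), x <= y -> vmap f' x <= vmap f' y
      & forall v, ~~ B v -> trivial (fiber f' v)].
Proof.
move=> fB; have fm := mor_specP f.
pose vkey x := vmap f x * nv T + x.
pose hkey h := if B (vmap f (vtx T h)) then val h else index h (codom (hmap f)).
have [||T' [w [wv wh]]] := @relabel T vkey hkey.
- by move=> x y /lex_inj[]// _; apply: val_inj.
- move=> h h' hh; rewrite /hkey -hh.
  case: (boolP (B _)) => [_|hB]; first exact: val_inj.
  by apply: (index_inj h); apply: fB; rewrite -?hh.
have [f' f'w] : exists f', mcomp f' w = f.
  by apply: mor_factor => a; apply: iso_codom.
exists T', w, f'; split=> //.
  move=> x' y'; rewrite -(iso_vmapVK w x') -(iso_vmapVK w y').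
  move: (vmap _ x') (vmap _ y') => x y {x' y'}; rewrite -!mcomp_vmap f'w.
  by rewrite [vmap w x <= _]leqNgt wv /vkey ltn_lex // negb_or -leqNgt => /andP[].
move=> v vB.
have f'm := mor_specP f'.
have cod h : vmap f' (vtx T' h) = v -> h \in codom (hmap f').
  move=> hv; rewrite -(mcomp_codom f' w) f'w; apply: fB.
  by rewrite -f'w mcomp_vmap (mor_vtx (mor_specP w)) hv.
apply/trivial_fiberP; split=> //; first exact: mor_no_inner_inj.
move=> a b av bv ab.
have fE c : hmap w (hmap f' c) = hmap f c by rewrite -mcomp_hmap f'w.
rewrite wh; last by apply: (mor_no_inner_inj cod); rewrite (mor_vtx f'm).
rewrite /hkey !fE !(mor_vtx fm) av bv (negbTE vB).
have cE c : index (hmap f c) (codom (hmap f)) = c.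
  by rewrite codomE (index_map (mor_inj fm)) index_enum_ord.
by rewrite !cE.
Qed.

(** Both bijections underlying [f] are monotone maps of ordinals, hence identities. An equality of
    graphs is wanted because [elem] compares fibers by equality. *)
Lemma mono_trivial_eq (T S : ggGrc) (f : mor T S) :
  (forall x y : 'I_(nv T), x <= y -> vmap f x <= vmap f y) ->
  (forall v, trivial (fiber f v)) -> T = S.
Proof.
move=> mono tr; have fm := mor_specP f.
have full h : h \in codom (hmap f) by have /trivial_fiberP[_ H _] := tr (vmap f (vtx T h)); apply: H.
have inj x y : vmap f x = vmap f y -> x = y.
  by move=> xy; have /trivial_fiberP[H _ _] := tr (vmap f y); apply: H.
have [w wf] := mor_full_iso full.
have hlt (a b : 'I_(nh S)) : a < b -> hmap f a < hmap f b.
  move=> ab; have := g_mono (ggGrc_spec S) (ltnW ab); rewrite leq_eqVlt => /orP[/eqP/val_inj e|lt].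
    by have /trivial_fiberP[_ _ H] := tr (vtx S b); apply: H.
  rewrite ltnNge; apply: contraTN lt => /(g_mono (ggGrc_spec T))/mono.
  by rewrite !(mor_vtx fm) -leqNgt.
have bK h : hmap f (hmap (iso_inv w) h) = h by rewrite -wf iso_hmapVK.
apply: ggGrc_eq; apply: (@pregraph_eq T S (vmap f) (hmap (iso_inv w))).
- by rewrite -wf; exists (vmap (iso_inv w)); [exact: iso_vmapK | exact: iso_vmapVK].
- by exists (hmap w); [exact: iso_hmapVK | exact: iso_hmapK].
- move=> x y xy; rewrite ltn_neqAle mono ?(ltnW xy) // andbT.
  by apply: contraTneq xy => /val_inj/inj ->; rewrite ltnn.
- move=> a b ab; rewrite ltnNge leq_eqVlt; apply: contraTN ab => /orP[/eqP/val_inj e|/hlt].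
    by rewrite -(bK a) -e bK ltnn.
  by rewrite !bK -leqNgt => /ltnW.
- by move=> h; rewrite -(mor_vtx fm) bK.
- by move=> h; apply: (mor_inj fm); rewrite (mor_flip fm) !bK.
- apply: (inj_map (mor_inj fm)); rewrite (mor_legs fm) -map_comp -[LHS]map_id.
  by apply: eq_map => h /=; rewrite bK.
move=> x; apply/eqP; rewrite -eqz_nat (mor_genus fm); apply/eqP/(@mulIf _ 2%R) => //.
rewrite (genus_prefiber (ggGrc_ordered T)); first last.
- exact: mor_legs fm.
- exact: mor_contr fm.
- exact: mor_conn fm _.
- exact: prefiber_ordered (ggGrc_ordered T) (morP f).
rewrite (big_pred1 x) => [|y]; last by apply/eqP/eqP => [/inj|->].
have -> : inner f (vmap f x) = set0 by apply/setP=> h; rewrite !inE full andbF.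
by rewrite cards0 addr0 subrK.
Qed.

Lemma fiber_mcomp_outer (T S P : ggGrc) (f : mor T S) (g : mor S P) v j :
  trivial (fiber g v) -> vmap g j = v -> fiber (mcomp g f) v = fiber f j.
Proof.
move=> tr gj; have jv : j \in fvert g v by rewrite inE gj.
pose w : 'I_(nv (fiber g v)) := enum_rank_in jv j.
by rewrite -(trivial_fiber (fiber_map f g v) w tr) fiber_of_fiber_map enum_rankK_in.
Qed.

Lemma fiber_mcomp_inner (T S P : ggGrc) (f : mor T S) (g : mor S P) v :
  (forall x y : 'I_(nv T), x <= y -> vmap f x <= vmap f y) ->
  (forall j, vmap g j = v -> trivial (fiber f j)) ->
  fiber (mcomp g f) v = fiber g v.
Proof.
move=> mono tr; apply: (@mono_trivial_eq _ _ (fiber_map f g v)) => [x y xy|w].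
  by rewrite -enum_val_le !fiber_vmapE mono // enum_val_le.
rewrite fiber_of_fiber_map; apply: tr.
by have := enum_valP w; rewrite inE => /eqP.
Qed.

Section SplitParallel.
Variables (T R S : ggGrc) (p : mor T S) (f0 : mor T R) (i m : 'I_(nv S)).
Hypothesis im : i != m.
Hypothesis p_mono : forall x y : 'I_(nv T), x <= y -> vmap p x <= vmap p y.
Hypothesis p_triv : forall v, v != i -> v != m -> trivial (fiber p v).
Hypothesis f0_codom : forall h,
  (h \notin codom (hmap f0)) = (vmap p (vtx T h) == m) && (h \notin codom (hmap p)).
Hypothesis p_inner_i : exists2 h, vmap p (vtx T h) = i & h \notin codom (hmap p).
Hypothesis p_inner_m : exists2 h, vmap p (vtx T h) = m & h \notin codom (hmap p).

(** Splits a map with two nontrivial fibers as in [op_par], the fiber over [m] first. [f0] is any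
    map contracting that fiber's edges; neither it nor the remaining factor need be elementary, and
    one renumbering of [R] repairs both. *)
Lemma split_parallel : exists (P : ggGrc) (w : iso R P) (g : mor P S) (j : 'I_(nv P)),
  [/\ mcomp g (mcomp w f0) = p, elementary (mcomp w f0) j, elementary g i
    & [/\ vmap g j = m, fiber (mcomp w f0) j = fiber p m & fiber g i = fiber p i]].
Proof.
have fm := mor_specP f0; have pm := mor_specP p.
have [g0 g0f] : exists g0, mcomp g0 f0 = p.
  by apply: mor_factor => a; apply: contraT; rewrite f0_codom codom_f andbF.
have gm := mor_specP g0.
have g0v x : vmap g0 (vmap f0 x) = vmap p x by rewrite -mcomp_vmap g0f.
have g0h a : hmap f0 (hmap g0 a) = hmap p a by rewrite -mcomp_hmap g0f.
have g0c a : (a \in codom (hmap g0)) = (hmap f0 a \in codom (hmap p)) by rewrite -g0f mcomp_codom.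
have f0c h : vmap p (vtx T h) != m -> h \in codom (hmap f0).
  by move=> hm; apply: contraT; rewrite f0_codom (negbTE hm).
have f0u x y : vmap f0 x = vmap f0 y -> vmap p x != m -> x = y.
  move=> xy xm; apply: (@mor_no_inner_inj _ _ f0 (vmap f0 y)) => // h hv.
  by apply: f0c; rewrite -g0v hv -xy g0v.
have g0m a : vmap g0 (vtx R a) = m -> a \in codom (hmap g0).
  move=> am; rewrite g0c; have := f0_codom (hmap f0 a).
  by rewrite codom_f -g0v (mor_vtx fm) am eqxx /=; case: (_ \in _).
have [rep repK] := choice (mor_surj fm).
have prep x : vmap p (rep (vmap f0 x)) = vmap p x by rewrite -!g0v repK.
(* Vertices of [R] take the order of [T] through a preimage, which is unique except over [m].
   Half-edges over [m] take the order of [S], so that [g] is trivial there; the others take the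
   order of [T], so that the first factor is trivial there. *)
pose vkey y := val (rep y).
pose hkey a := if vmap g0 (vtx R a) == m then index a (codom (hmap g0)) else val (hmap f0 a).
have vkey_inj : injective vkey by move=> y y' /val_inj e; rewrite -(repK y) e repK.
have [//||P [w [wv wh]]] := @relabel R vkey hkey.
  move=> a b ab; rewrite /hkey -ab; case: eqP => [am|_ /val_inj/(mor_inj fm) //].
  by apply: (index_inj a); apply: g0m; rewrite -?ab.
have [g gw] : exists g, mcomp g w = g0 by apply: mor_factor => a; apply: iso_codom.
have gv y : vmap g (vmap w y) = vmap g0 y by rewrite -mcomp_vmap gw.
have gh a : hmap w (hmap g a) = hmap g0 a by rewrite -mcomp_hmap gw.
have ggm := mor_specP g; have wm := mor_specP w.
have gfp : mcomp g (mcomp w f0) = p by rewrite mcompA gw g0f.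
have Fm := mor_specP (mcomp w f0).
have [hm hm1 hm2] := p_inner_m; have [hi hi1 hi2] := p_inner_i.
pose j := vmap (mcomp w f0) (vtx T hm).
have gj : vmap g j = m by rewrite -mcomp_vmap gfp.
have fmono (x y : 'I_(nv T)) : x <= y -> vmap (mcomp w f0) x <= vmap (mcomp w f0) y.
  move=> xy; rewrite !mcomp_vmap leqNgt wv /vkey; apply/negP=> lt.
  have pxy : vmap p x = vmap p y.
    by apply/val_inj/anti_leq; rewrite p_mono //= -(prep x) -(prep y) p_mono // ltnW.
  have [xm|xm] := eqVneq (vmap p x) m.
    suff e : vmap f0 x = vmap f0 y by rewrite e ltnn in lt.
    apply: (mor_no_inner_inj (f := g0) (v := m)); rewrite ?g0v -?pxy //; exact: g0m.
  have rE z : vmap p z = vmap p x -> rep (vmap f0 z) = z.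
    by move=> zx; apply: f0u; rewrite ?repK // prep zx.
  by rewrite !rE // ltnNge xy in lt.
have wfc h : (h \in codom (hmap (mcomp w f0))) = (h \in codom (hmap f0)).
  apply/idP/idP => [/mcomp_codomS //|/codomP[a ->]].
  by rewrite mcomp_codom iso_codom.
have gm' a : vmap g (vtx P a) = m -> a \in codom (hmap g).
  move=> am; rewrite -(mcomp_codom g w) gw; apply: g0m.
  by rewrite -gv (mor_vtx wm).
have ftriv y : y != j -> trivial (fiber (mcomp w f0) y).
  move=> yj; have ym : vmap g y != m.
    apply: contraNneq yj => ym; apply/eqP; apply: (mor_no_inner_inj gm') => //.
  have cod h : vmap (mcomp w f0) (vtx T h) = y -> h \in codom (hmap (mcomp w f0)).
    by move=> hy; rewrite wfc f0c // -gfp mcomp_vmap hy.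
  apply/trivial_fiberP; split=> //; first exact: mor_no_inner_inj.
  move=> a b ay bY; rewrite wh ?ay ?bY // !mcomp_hmap /hkey.
  by rewrite -!gv !(mor_vtx wm) ay bY (negbTE ym).
have gtriv v : v != i -> trivial (fiber g v).
  move=> vi; have cod a : vmap g (vtx P a) = v -> a \in codom (hmap g).
    have [->|vm] := eqVneq v m; first exact: gm'.
    move=> av; rewrite -(mcomp_codom g (mcomp w f0)) gfp.
    have /trivial_fiberP[_ H _] := p_triv vi vm; apply: H.
    by rewrite -gfp mcomp_vmap (mor_vtx Fm).
  apply/trivial_fiberP; split=> //; first exact: mor_no_inner_inj.
  move=> a b av bv ab; rewrite wh; last first.
    by apply: (mor_no_inner_inj cod); rewrite (mor_vtx ggm).
  rewrite /hkey !gh !(mor_vtx gm) av bv; case: eqP => [_|/eqP vm].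
    by rewrite codomE !(index_map (mor_inj gm)) !index_enum_ord.
  by rewrite !g0h; have /trivial_fiberP[_ _ H] := p_triv vi vm; apply: H.
exists P, w, g, j; split=> //.
- apply/elementaryP; split=> //; exists hm => //.
  by rewrite wfc f0_codom hm1 eqxx.
- apply/elementaryP; split=> // [y y'|].
    rewrite -(iso_vmapVK w y) -(iso_vmapVK w y'); move: (vmap _ y) (vmap _ y') => {}y {}y'.
    rewrite leqNgt wv -leqNgt !gv -{2}(repK y) -{2}(repK y') !g0v; exact: p_mono.
  have : hi \in codom (hmap (mcomp w f0)) by rewrite wfc f0c // hi1.
  case/codomP=> a ea; exists a; last by rewrite -(mcomp_codom g (mcomp w f0)) gfp -ea.
  by rewrite -(mor_vtx Fm) -ea -mcomp_vmap gfp.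
split=> //; first by rewrite -gfp (fiber_mcomp_outer _ _ gj) //; apply: gtriv; rewrite eq_sym.
rewrite -gfp fiber_mcomp_inner // => y yi; apply: ftriv.
by apply: contraNneq im => e; rewrite -yi e gj.
Qed.

End SplitParallel.

(** * Graphs without edges *)

Lemma ne0P (T : ggGrc) : ne T = 0 <-> forall h, flip T h = h.
Proof.
have e := edges_double (ggGrc_ordered T); split=> [T0 h|H].
  rewrite T0 in e; apply/eqP; apply: contraT => hh.
  by have := cards0_eq e => /setP/(_ h); rewrite !inE hh.
apply/eqP; rewrite -(eqn_pmul2r (isT : 0 < 2)) -e mul0n cards_eq0; apply/eqP/setP=> h.
by rewrite !inE H eqxx.
Qed.

Lemma ne0_local_terminal (T : ggGrc) : ne T = 0 -> local_terminal T.
Proof.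
move=> T0; rewrite /local_terminal T0 andbT.
have /andP[n0 /forallP cT] := ggGrc_connected T.
have all0 y : y = Ordinal n0.
  have /forallP/(_ y)/connectP[s] := cT (Ordinal n0).
  elim: s (Ordinal n0) => [|z s IH] x //= /andP[/existsP[h /andP[/eqP <-]]].
  by have /ne0P -> := T0 => /eqP ->; apply: IH.
by rewrite -(card_ord (nv T)) (eq_card1 (x := Ordinal n0)) // => y; rewrite !inE [y]all0 eqxx.
Qed.

Lemma local_terminal_vertex (U : ggGrc) (x y : 'I_(nv U)) : local_terminal U -> x = y.
Proof.
case/andP=> /eqP n1 _; apply: val_inj; case: x y => [x xl] [y yl] /=.
by move: xl yl; rewrite n1 !ltnS !leqn0 => /eqP -> /eqP ->.
Qed.

(** All half-edges are legs; renumber them by their position in the global order. *)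
Lemma trivial_iso (T : ggGrc) : local_terminal T ->
  exists (U : ggGrc) (t : iso T U), trivial U.
Proof.
move=> tT; have T0 : forall h, flip T h = h by apply/ne0P; case/andP: tT => _ /eqP.
have Tl h : h \in legs T by rewrite (g_legs (ggGrc_spec T)) T0.
have [||U [t [_ th]]] := @relabel T val (fun h => index h (legs T)).
- exact: val_inj.
- by move=> h h' _; apply: (index_inj h).
exists U, t; have tm := mor_specP t.
have U0 : forall h, flip U h = h by move=> h; apply: (mor_inj tm); rewrite (mor_flip tm) T0.
have tU : local_terminal U by apply/ne0_local_terminal/ne0P.
rewrite /trivial tU /=.
have Ul h : h \in legs U by rewrite (g_legs (ggGrc_spec U)) U0.
apply/eqP/(inj_map val_inj)/(@irr_sorted_eq _ ltn ltn_trans ltnn).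
- case E : (legs U) => [//|a s]; rewrite -E; apply/(sortedP (val a)) => n.
  rewrite size_map => ns; have n's := ltnW ns.
  rewrite !(nth_map a) //= th; last exact: local_terminal_vertex.
  by rewrite -(mor_legs tm) !(index_map (mor_inj tm)) !index_uniq ?(g_uniq (ggGrc_spec U)).
- exact: sorted_enum_ord.
by move=> z; apply/mapP/mapP => -[h _ ->]; exists h; rewrite ?mem_enum.
Qed.

(** Every half-edge of [U] is a leg, and the effect on legs is dictated by the global orders. *)
Lemma trivial_terminal (T U : ggGrc) (f g : mor T U) : trivial U -> f = g.
Proof.
case/andP=> tU /eqP lU; apply: mor_ext => [h|x]; last exact: local_terminal_vertex.
have: h \in legs U by rewrite lU mem_enum.
by apply/eq_in_map: h; rewrite (mor_legs (mor_specP f)) (mor_legs (mor_specP g)).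
Qed.

Lemma trivial_iso_eq (U U' : ggGrc) (s : iso U U') : trivial U -> trivial U' -> U = U'.
Proof.
move=> tU tU'; apply: (@mono_trivial_eq _ _ s) => [x y _|v]; last by rewrite trivial_fiber.
by case/andP: tU' => lU' _; rewrite (local_terminal_vertex (vmap s x) (vmap s y) lU').
Qed.

(** * Orderings of edges *)

Section Orderings.
Variables (n m : nat) (vt : {ffun 'I_m -> 'I_n}) (fl : {ffun 'I_m -> 'I_m}).

(* An edge is represented by either one of its two half-edges. *)
Definition ordering (s : seq 'I_m) : bool :=
  perm_eq (s ++ map fl s) (enum [pred h | fl h != h]).

(* Means that the edges of s do not join h to h'; quantifying over a union D of
   components avoids paths and makes functoriality immediate. *)
Definition separated (s : seq 'I_m) (h h' : 'I_m) : Prop :=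
  exists D : {set 'I_n},
    [/\ {in s, forall g, (vt g \in D) = (vt (fl g) \in D)},
        vt h \in D /\ vt (fl h) \in D & vt h' \notin D /\ vt (fl h') \notin D].

Inductive step : seq 'I_m -> seq 'I_m -> Prop :=
| StepFlip x h y : step (x ++ h :: y) (x ++ fl h :: y)
| StepSwap x h h' y : separated x h h' -> step (x ++ h :: h' :: y) (x ++ h' :: h :: y).

Definition eqv := clos_refl_sym_trans _ step.

Hypothesis fl_inv : involutive fl.

Lemma step_sym s t : step s t -> step t s.
Proof.
case=> [x h y|x h h' y [D [Dx [h1 h2] [h3 h4]]]].
  by rewrite -{2}(fl_inv h); apply: StepFlip.
apply: StepSwap; exists (~: D); split; rewrite ?inE ?negbK //.
by move=> g /Dx; rewrite !inE => ->.
Qed.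

Lemma step_ordering s t : step s t -> ordering s = ordering t.
Proof.
suff H a b : step a b -> perm_eq (a ++ map fl a) (b ++ map fl b).
  by move=> /H/permPl e; rewrite /ordering e.
case=> [x h y|x h h' y _]; apply/seq.permP=> p; rewrite !map_cat /= !count_cat /= ?fl_inv; lia.
Qed.

Lemma eqv_ordering s t : eqv s t -> ordering s = ordering t.
Proof. by elim=> [a b /step_ordering|a|a b _ ->|a b c _ -> _ ->]. Qed.

Lemma ordering_uniq s : ordering s -> uniq s.
Proof.
by move=> /perm_uniq e; have := enum_uniq [pred h | fl h != h]; rewrite -e cat_uniq => /andP[].
Qed.

Lemma ordering_size s : ordering s -> size s <= m.
Proof. by move/ordering_uniq/card_uniqP => <-; rewrite -[leqRHS]card_ord max_card. Qed.

Lemma ordering_neq s h : ordering s -> h \in s -> fl h != h.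
Proof.
move=> /perm_mem e hs; have := e h; rewrite mem_cat hs mem_enum /=.
by rewrite inE => <-.
Qed.

(** The witness lists the smaller half of every edge. *)
Lemma ordering_ex : exists s, ordering s.
Proof.
exists (filter (fun h : 'I_m => h < fl h) (enum 'I_m)).
apply: uniq_perm; rewrite ?enum_uniq //.
  rewrite cat_uniq (map_inj_uniq (inv_inj fl_inv)) filter_uniq ?enum_uniq //= andbT.
  apply/hasPn=> g /mapP[h]; rewrite mem_filter => /andP[hh _] ->.
  by rewrite /= mem_filter fl_inv negb_and -leqNgt ltnW.
move=> h; rewrite mem_cat mem_filter !mem_enum /= andbT inE.
have -> : (h \in map fl [seq g : 'I_m <- enum 'I_m | g < fl g]) = (fl h < h).
  by rewrite -{1}(fl_inv h) (mem_map (inv_inj fl_inv)) mem_filter mem_enum andbT fl_inv.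
by rewrite neq_ltn orbC.
Qed.

(** A canonical representative: the value of [choose] depends only on the predicate, which
    equivalent words share. *)
Definition eqv_rep (s : seq 'I_m) : seq 'I_m := choose (fun t => `[< eqv s t >]) s.

Lemma eqv_repP s : eqv s (eqv_rep s).
Proof.
have e : `[< eqv s s >] by apply/asboolP/rst_refl.
by have /asboolP := chooseP (P := fun t => `[< eqv s t >]) e.
Qed.

Lemma eqv_rep_eq s t : eqv s t -> eqv_rep s = eqv_rep t.
Proof.
move=> st; have e : (fun r => `[< eqv s r >]) =1 (fun r => `[< eqv t r >]).
  move=> r; apply/asbool_equiv_eq; split; apply: rst_trans => //; exact: rst_sym.
rewrite /eqv_rep (eq_choose e); apply: choose_id; apply/asboolP; last exact: rst_refl.
exact: rst_sym.
Qed.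

Lemma eqv_rep_id s : eqv_rep (eqv_rep s) = eqv_rep s.
Proof. exact/esym/eqv_rep_eq/eqv_repP. Qed.

End Orderings.

(** * The space spanned by classes of orderings *)

Section OrderingModule.
Variables (k : fieldType).
Variables (n m : nat) (vt : {ffun 'I_m -> 'I_n}) (fl : {ffun 'I_m -> 'I_m}).
Local Open Scope ring_scope.

(** Bounded sequences make this a finite type, and [ordering_size] shows that the bound loses
    nothing. The test [d == 0] leaves no class in other degrees, so the functions on it form a space
    concentrated in degree 0. *)
Definition eqv_class (d : int) : finType :=
  {x : m.-bseq 'I_m | [&& d == 0, ordering fl x & eqv_rep vt fl x == x :> seq _]}.

Definition osp : gvs k := fun d => ({ffun eqv_class d -> k^o} : lmodType k).

Definition ocls (d : int) (s : seq 'I_m) : osp d :=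
  [ffun x : eqv_class d => (eqv_rep vt fl s == val x :> seq _)%:R : k^o].

Lemma ocls_span d (a : osp d) : a = \sum_(x : eqv_class d) a x *: ocls d (val x).
Proof.
apply/ffunP=> x; rewrite sum_ffunE (bigD1 x) //= big1 => [|y yx].
  rewrite addr0 !ffunE; have /and3P[_ _ /eqP ->] := valP x.
  by rewrite eqxx /=; rewrite -[LHS]mulr1.
rewrite !ffunE; have /and3P[_ _ /eqP ->] := valP y.
by rewrite (negbTE (_ : val y != val x :> seq _)) ?scaler0 //; apply: contraNneq yx => /val_inj/val_inj ->.
Qed.

Lemma osp_ind d (P : osp d -> Prop) :
  P 0 -> (forall c x y, P x -> P y -> P (c *: x + y)) ->
  (forall s, d = 0 -> ordering fl s -> P (ocls d s)) -> forall a, P a.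
Proof.
move=> P0 Pl Pc a; rewrite (ocls_span a); apply: big_ind => //.
  by move=> x y Px Py; rewrite -[x]scale1r; apply: Pl.
move=> x _; rewrite -[_ *: _]addr0; apply: Pl => //.
by have /and3P[/eqP d0 ox _] := valP x; apply: Pc.
Qed.

Lemma linear_at0 (U V : lmodType k) (f : U -> V) : linear f -> f 0 = 0.
Proof. by move=> lf; have := lf (-1) 0 0; rewrite scaler0 addr0 scaleN1r addNr. Qed.

(** The reduction behind the operad axioms of F: it suffices to compare on words, and only in degree
    0. *)
Lemma osp_lin_eq d (V : lmodType k) (f g : osp d -> V) : linear f -> linear g ->
  (forall s, d = 0 -> ordering fl s -> f (ocls d s) = g (ocls d s)) -> f =1 g.
Proof.
move=> lf lg fg; apply: osp_ind => //; first by rewrite !linear_at0.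
by move=> c x y fx fy; rewrite lf lg fx fy.
Qed.

(** Evaluates [h] on chosen representatives, so it is linear for every [h]; if [h] is constant along
    steps, [oext_cls] gives its value on any word. *)
Definition oext d (V : lmodType k) (h : seq 'I_m -> V) (a : osp d) : V :=
  \sum_(x : eqv_class d) a x *: h (val x).

Lemma oext_linear d (V : lmodType k) h : linear (@oext d V h).
Proof.
move=> c x y; rewrite /oext scaler_sumr -big_split; apply: eq_bigr => z _ /=.
by rewrite !ffunE scalerDl scalerA.
Qed.

Lemma oext_lin d (V : lmodType k) (c : k) (h1 h2 : seq 'I_m -> V) (a : osp d) :
  oext (fun s => c *: h1 s + h2 s) a = c *: oext h1 a + oext h2 a.
Proof.
rewrite /oext scaler_sumr -big_split; apply: eq_bigr => z _ /=.
by rewrite scalerDr !scalerA mulrC.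
Qed.

Hypothesis fl_inv : involutive fl.

Lemma ocls_eqv d s t : eqv vt fl s t -> ocls d s = ocls d t.
Proof. by move=> /eqv_rep_eq e; rewrite /ocls e. Qed.

Lemma ocls_step d s t : step vt fl s t -> ocls d s = ocls d t.
Proof. by move=> st; apply: ocls_eqv; apply: rst_step. Qed.

Lemma oext_cls d (V : lmodType k) (h : seq 'I_m -> V) s : d = 0 -> ordering fl s ->
  (forall t t', ordering fl t -> step vt fl t t' -> h t = h t') ->
  oext h (ocls d s) = h s.
Proof.
move=> d0 os hinv.
have hE t t' : eqv vt fl t t' -> ordering fl t -> h t = h t'.
  elim=> {t t'} [t t' st ot|//|t t' e IH ot'|t t' t'' e IH e' IH' ot].
  - exact: hinv.
  - by rewrite IH // (eqv_ordering fl_inv e).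
  - by rewrite IH // IH' // -(eqv_ordering fl_inv e).
have er := eqv_repP vt fl s; have orr : ordering fl (eqv_rep vt fl s).
  by rewrite -(eqv_ordering fl_inv er).
pose b : m.-bseq 'I_m := Bseq (ordering_size orr).
have bP : [&& d == 0, ordering fl b & eqv_rep vt fl b == b :> seq _].
  by rewrite d0 eqxx orr /= eqv_rep_id.
pose x : eqv_class d := Sub b bP.
rewrite (hE _ _ er os) /oext (bigD1 x) //= big1 => [|y yx].
  by rewrite ffunE eqxx scale1r addr0.
rewrite ffunE (negbTE (_ : _ != val y :> seq _)) ?scale0r //.
by apply: contraNneq yx => e; apply/eqP/val_inj/val_inj.
Qed.

End OrderingModule.

Notation gordering T := (ordering (flip T)).
Notation gseparated T := (separated (vtx T) (flip T)).
Notation gstep T := (step (vtx T) (flip T)).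

(** * Orderings under morphisms and fibers *)

Lemma flipK (T : ggGrc) : involutive (flip T).
Proof. exact: g_flip (ggGrc_spec T). Qed.

Lemma flip_codom (T S : ggGrc) (f : mor T S) h :
  (flip T h \in codom (hmap f)) = (h \in codom (hmap f)).
Proof.
suff H g : g \in codom (hmap f) -> flip T g \in codom (hmap f).
  by apply/idP/idP => /H //; rewrite flipK.
by case/codomP=> a ->; rewrite -(mor_flip (mor_specP f)) codom_f.
Qed.

Lemma nonfixed_split (T S : ggGrc) (f : mor T S) :
  perm_eq (enum [pred h | h \notin codom (hmap f)] ++
           map (hmap f) (enum [pred h | flip S h != h]))
          (enum [pred h | flip T h != h]).
Proof.
have fm := mor_specP f; apply: uniq_perm; rewrite ?enum_uniq //.
  rewrite cat_uniq enum_uniq (map_inj_uniq (mor_inj fm)) enum_uniq andbT /=.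
  by apply/hasPn=> h /mapP[a _ ->]; rewrite /= mem_enum inE codom_f.
move=> h; rewrite mem_cat !mem_enum !inE.
have [/codomP[a ->]|hc] /= := boolP (h \in codom (hmap f)).
  by rewrite (mem_map (mor_inj fm)) mem_enum inE -(mor_flip fm) (inj_eq (mor_inj fm)).
by apply/esym/eqP => /(mor_legs_codom f); rewrite (negbTE hc).
Qed.

Lemma fiber_nonfixed (T S : ggGrc) (f : mor T S) i (h : 'I_(nh (fiber f i))) :
  (flip (fiber f i) h != h) = (enum_val h \notin codom (hmap f)).
Proof.
have fm := mor_specP f; rewrite -(inj_eq enum_val_inj) (fib_flip (mor_contr fm)).
have [_|hc] /= := boolP (_ \in _); first by rewrite eqxx.
by apply/eqP=> /(mor_legs_codom f); rewrite (negbTE hc).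
Qed.

Lemma fiber_flip (T S : ggGrc) (f : mor T S) i (h : 'I_(nh (fiber f i))) :
  flip (fiber f i) h != h -> enum_val (flip (fiber f i) h) = flip T (enum_val h).
Proof.
by rewrite fiber_nonfixed (fib_flip (mor_contr (mor_specP f))) => /negbTE ->.
Qed.

Lemma fiber_nonfixed_perm (T S : ggGrc) (f : mor T S) i :
  (forall h, h \notin codom (hmap f) -> vmap f (vtx T h) = i) ->
  perm_eq (map (fun h : 'I_(nh (fiber f i)) => enum_val h)
             (enum [pred h | flip (fiber f i) h != h]))
          (enum [pred h | h \notin codom (hmap f)]).
Proof.
move=> fi; apply: uniq_perm; rewrite ?enum_uniq ?(map_inj_uniq enum_val_inj) ?enum_uniq //.
move=> h; rewrite mem_enum inE; apply/mapP/idP => [[g]|hc].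
  by rewrite mem_enum inE fiber_nonfixed => gc ->.
have hi : h \in fhalf f i by rewrite inE fi.
by exists (enum_rank_in hi h); rewrite ?mem_enum ?inE ?fiber_nonfixed enum_rankK_in.
Qed.

Lemma elementary_inner (T S : ggGrc) (f : mor T S) i h :
  elementary f i -> h \notin codom (hmap f) -> vmap f (vtx T h) = i.
Proof.
case/elementaryP=> _ tr _ hc; apply/eqP; apply: contraNT hc => /tr/trivial_fiberP[_ H _].
exact: H.
Qed.

Lemma ordering_comp (T S : ggGrc) (f : mor T S) i u v :
  (forall h, h \notin codom (hmap f) -> vmap f (vtx T h) = i) ->
  gordering (fiber f i) u -> gordering S v ->
  gordering T (map (fun h : 'I_(nh (fiber f i)) => enum_val h) u ++ map (hmap f) v).
Proof.
move=> fe ou ov; rewrite /ordering -(permPr (nonfixed_split f)) map_cat.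
rewrite perm_catACA; apply: perm_cat.
  rewrite -(permPr (fiber_nonfixed_perm fe)).
  have -> : map (flip T) (map (fun h : 'I_(nh (fiber f i)) => enum_val h) u) =
      map (fun h : 'I_(nh (fiber f i)) => enum_val h) (map (flip (fiber f i)) u).
    rewrite -!map_comp; apply/eq_in_map => h hu /=; rewrite fiber_flip //.
    exact: ordering_neq ou hu.
  by rewrite -map_cat perm_map.
have -> : map (flip T) (map (hmap f) v) = map (hmap f) (map (flip S) v).
  by rewrite -!map_comp; apply/eq_map => h /=; rewrite (mor_flip (mor_specP f)).
by rewrite -map_cat perm_map.
Qed.

Lemma perm_map_injE (A B : eqType) (f : A -> B) s t : injective f ->
  perm_eq (map f s) (map f t) = perm_eq s t.
Proof. by move=> fi; apply/idP/idP; [exact: perm_map_inj | exact: perm_map]. Qed.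

Lemma ordering_full (T S : ggGrc) (f : mor T S) s : (forall h, h \in codom (hmap f)) ->
  gordering T (map (hmap f) s) = gordering S s.
Proof.
move=> full; rewrite /ordering -(permPr (nonfixed_split f)).
rewrite (eq_enum (B := pred0)) ?enum0 => [|h]; last by rewrite !inE full.
rewrite -(perm_map_injE _ _ (mor_inj (mor_specP f))) map_cat; congr (perm_eq (_ ++ _) _).
by rewrite -!map_comp; apply/eq_map => h /=; rewrite (mor_flip (mor_specP f)).
Qed.

Lemma ordering_one_edge (T S : ggGrc) (f : mor T S) h s : one_edge f h ->
  gordering T (h :: map (hmap f) s) = gordering S s.
Proof.
move=> fh; have fm := mor_specP f; rewrite /ordering -(permPr (nonfixed_split f)).
have e : perm_eq (enum [pred g | g \notin codom (hmap f)]) [:: h; flip T h].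
  apply: uniq_perm; rewrite ?enum_uniq //= ?inE ?andbT.
    by rewrite eq_sym (one_edge_neq fh).
  by move=> g; rewrite mem_enum !inE fh.
rewrite (permPr (perm_cat e (perm_refl _))).
rewrite /=; have -> : map (flip T) (map (hmap f) s) = map (hmap f \o flip S) s.
  by rewrite -map_comp; apply: eq_map => a /=; rewrite (mor_flip fm).
rewrite -cat_cons.
have /permPl -> : perm_eq ((h :: map (hmap f) s) ++ flip T h :: map (hmap f \o flip S) s)
   ([:: h; flip T h] ++ map (hmap f) (s ++ map (flip S) s)).
  rewrite map_cat -map_comp -cat1s -[flip T h :: map _ _]cat1s -[[:: h; _]]/([:: h] ++ [:: _]).
  by rewrite perm_catACA.
by rewrite perm_cat2l perm_map_injE //; apply: mor_inj fm.
Qed.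

Lemma codom_seq (A B : finType) (f : A -> B) (s : seq B) :
  {in s, forall h, h \in codom f} -> exists s', s = map f s'.
Proof.
elim: s => [|h s IH] H; first by exists [::].
have [|s' ->] := IH; first by move=> g gs; apply: H; rewrite inE gs orbT.
by have /codomP[a ->] := H h (mem_head _ _); exists (a :: s').
Qed.

Lemma ordering_tail (T S : ggGrc) (f : mor T S) h s : one_edge f h ->
  gordering T (h :: s) -> exists2 s', s = map (hmap f) s' & gordering S s'.
Proof.
move=> fh os; have [|s' e] := @codom_seq _ _ (hmap f) s.
  move=> g gs; apply: contraT; rewrite fh => gh.
  have := perm_uniq os; rewrite enum_uniq /= mem_cat => /andP[].
  rewrite negb_or => /andP[hs _]; rewrite cat_uniq /= negb_or => /and3P[_ /andP[fs _] _].
  by case/orP: gh => /eqP gE; [move: hs | move: fs]; rewrite -gE gs.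
by exists s' => //; rewrite -(ordering_one_edge _ fh) -e.
Qed.

(** A separating set of [S] is pulled back along [vmap f]; it stays closed under the edges of [u],
    whose two ends have the same image. *)
Lemma step_map (T S : ggGrc) (f : mor T S) u v v' :
  {in u, forall g, vmap f (vtx T g) = vmap f (vtx T (flip T g))} ->
  gstep S v v' -> gstep T (u ++ map (hmap f) v) (u ++ map (hmap f) v').
Proof.
have fm := mor_specP f; move=> uf [x h y|x h h' y [D [Dx [h1 h2] [h3 h4]]]].
  by rewrite !map_cat /= (mor_flip fm) !catA; apply: StepFlip.
rewrite !map_cat /= !catA; apply: StepSwap; exists (vmap f @^-1: D).
split; try by rewrite !inE -(mor_flip fm) !(mor_vtx fm).
move=> g; rewrite mem_cat => /orP[/uf e|/mapP[a ax ->]]; first by rewrite !inE e.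
by rewrite !inE -(mor_flip fm) !(mor_vtx fm) Dx.
Qed.

(** Here the separating set is pushed forward along the inclusion of the fiber. Being an ordering
    matters: the involution of the fiber agrees with that of [T] only on its internal edges. *)
Lemma step_fiber (T S : ggGrc) (f : mor T S) i u u' w :
  gordering (fiber f i) u -> gstep (fiber f i) u u' ->
  gstep T (map (fun h : 'I_(nh (fiber f i)) => enum_val h) u ++ w)
          (map (fun h : 'I_(nh (fiber f i)) => enum_val h) u' ++ w).
Proof.
move=> ou st; case: st ou => [x h y ou|x h h' y [D [Dx [h1 h2] [h3 h4]]] ou].
  rewrite !map_cat /= -!catA /= fiber_flip; first exact: StepFlip.
  by apply: (ordering_neq ou); rewrite mem_cat mem_head orbT.
rewrite !map_cat /= -!catA /=; apply: StepSwap.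
have nf g : g \in x ++ h :: h' :: y -> flip (fiber f i) g != g by apply: ordering_neq ou.
have vD (z : 'I_(nv (fiber f i))) : (enum_val z \in [set enum_val x | x in D]) = (z \in D).
  exact: mem_imset enum_val_inj.
have fv (g : 'I_(nh (fiber f i))) : vtx T (enum_val g) = enum_val (vtx (fiber f i) g).
  by rewrite fib_vtx.
exists [set enum_val x | x in D]; split.
- move=> _ /mapP[g gx ->]; rewrite -fiber_flip ?nf ?mem_cat ?gx // !fv !vD; exact: Dx.
- by rewrite -fiber_flip ?nf ?mem_cat ?inE ?eqxx ?orbT // !fv !vD.
- by rewrite -fiber_flip ?nf ?mem_cat ?inE ?eqxx ?orbT // !fv !vD.
Qed.

(** The vertices in one fiber of [f] serve as separating set. *)
Lemma separated_mor (T S : ggGrc) (f : mor T S) s h h' :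
  {in s, forall g, vmap f (vtx T g) = vmap f (vtx T (flip T g))} ->
  vmap f (vtx T h) = vmap f (vtx T (flip T h)) ->
  vmap f (vtx T h') = vmap f (vtx T (flip T h')) ->
  vmap f (vtx T h) != vmap f (vtx T h') -> gseparated T s h h'.
Proof.
move=> sf hf hf' hh; exists [set x | vmap f x == vmap f (vtx T h)]; split.
- by move=> g /sf; rewrite !inE => ->.
- by rewrite !inE -hf eqxx.
- by rewrite !inE -hf' eq_sym.
Qed.

(** Adjacent exchanges carry the letters of [a] one by one past [b]. The prefix grows meanwhile by
    letters of both blocks, hence the hypothesis for every [s] inside [a ++ b]. *)
Lemma eqv_swap_blocks n m (vt : {ffun 'I_m -> 'I_n}) (fl : {ffun 'I_m -> 'I_m}) a b v :
  (forall s h h', {subset s <= a ++ b} -> h \in a -> h' \in b -> separated vt fl s h h') ->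
  eqv vt fl (a ++ b ++ v) (b ++ a ++ v).
Proof.
move=> sep.
have swap1 h b' p w : h \in a -> {subset b' <= b} -> {subset p <= a ++ b} ->
    eqv vt fl (p ++ h :: b' ++ w) (p ++ b' ++ h :: w).
  move=> ha; elim: b' p => [|h' b' IH] p bb pb; first exact: rst_refl.
  have hb' : h' \in b by apply: bb; rewrite mem_head.
  apply: rst_trans (rst_step _ _ _ _ (StepSwap _ (sep _ _ _ pb ha hb'))) _.
  rewrite -cat_rcons -[p ++ _]/(p ++ h' :: (b' ++ h :: w)) -[p ++ h' :: _]cat_rcons.
  apply: IH; first by move=> g gb; apply: bb; rewrite inE gb orbT.
  by move=> g; rewrite mem_rcons inE => /orP[/eqP ->|/pb //]; rewrite mem_cat hb' orbT.
suff H p a' : {subset a' <= a} -> {subset p <= a ++ b} ->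
    eqv vt fl (p ++ a' ++ b ++ v) (p ++ b ++ a' ++ v) by apply: (H [::]).
elim: a' p => [|h a' IH] p aa pb; first exact: rst_refl.
have ha : h \in a by apply: aa; rewrite mem_head.
apply: (rst_trans _ _ _ (p ++ h :: b ++ a' ++ v)); last exact: swap1.
rewrite /= -!(cat_rcons h); apply: IH; first by move=> g ga; apply: aa; rewrite inE ga orbT.
by move=> g; rewrite mem_rcons inE => /orP[/eqP ->|/pb //]; rewrite mem_cat ha.
Qed.

Lemma ordering_ne (T : ggGrc) s : gordering T s -> size s = ne T.
Proof.
move/perm_size; rewrite size_cat size_map addnn -muln2 -cardE -cardsE edges_double ?ggGrc_ordered //.
by move/eqP; rewrite eqn_pmul2r // => /eqP.
Qed.

Lemma ordering_exists (T : ggGrc) : exists s, gordering T s.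
Proof. exact: ordering_ex (@flipK T). Qed.

Lemma iso_ne (T S : ggGrc) (w : iso T S) : ne T = ne S.
Proof.
have [s os] := ordering_exists S; rewrite -(ordering_ne os).
have := os; rewrite -(ordering_full _ (iso_codom w)) => /ordering_ne <-.
by rewrite size_map.
Qed.

Lemma elem_ne (F T S : ggGrc) (f : mor T S) i : elem F f i -> ne T = ne S + ne F.
Proof.
case=> fe <-; have [v ov] := ordering_exists S; have [u ou] := ordering_exists (fiber f i).
by rewrite -(ordering_ne (ordering_comp (fun h => elementary_inner fe) ou ov)) size_cat !size_map (ordering_ne ov)
  (ordering_ne ou) addnC.
Qed.

Lemma local_terminal_ne (U : ggGrc) : local_terminal U -> ne U = 0.
Proof. by case/andP=> _ /eqP. Qed.

Lemma fiber_terminal_ne (T U : ggGrc) (f : mor T U) i : local_terminal U -> ne (fiber f i) = ne T.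
Proof.
move=> tU; have [u ou] := ordering_exists (fiber f i).
have [v ov] := ordering_exists U.
have v0 : v = [::] by apply: size0nil; rewrite (ordering_ne ov) local_terminal_ne.
rewrite v0 in ov; have := ordering_comp (fun h _ => local_terminal_vertex _ i tU) ou ov.
by rewrite cats0 => /ordering_ne <-; rewrite size_map (ordering_ne ou).
Qed.

(** * The free operad *)

Section FreeOperad.
Local Open Scope ring_scope.
Variable k : fieldType.

Definition mk_linear (U V : lmodType k) (f : U -> V) (lf : linear f) : {linear U -> V} :=
  HB.pack f (GRing.isLinear.Build k U V *:%R f lf).

(** Legs and genera are left out on purpose. Over a local terminal graph the fiber differs from [T]
    at most in its global order, so the equality of spaces demanded by [op_eq] holds literally. *)
Definition free_sp (T : pregraph) : gvs k := osp k (vtx T) (flip T).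
Definition free_cls (T : pregraph) (d : int) (s : seq 'I_(nh T)) : free_sp T d :=
  ocls k (vtx T) (flip T) d s.

Lemma free_sp_relabel (G H : pregraph)
    (a : 'I_(nv G) -> 'I_(nv H)) (b : 'I_(nh G) -> 'I_(nh H)) :
  bijective a -> bijective b ->
  (forall i j : 'I_(nv G), (i < j)%N -> (a i < a j)%N) ->
  (forall i j : 'I_(nh G), (i < j)%N -> (b i < b j)%N) ->
  (forall h, vtx H (b h) = a (vtx G h)) ->
  (forall h, flip H (b h) = b (flip G h)) ->
  [/\ free_sp G = free_sp H, forall s, gordering G s = gordering H (map b s)
    & forall (e : free_sp G = free_sp H) d s, gcast e (free_cls d s) = free_cls d (map b s)].
Proof.
case: G a b => n m vt fl lg vg; case: H => n' m' vt' fl' lg' vg' /= a b ba bb.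
have nn : n = n' by have := bij_eq_card ba; rewrite !card_ord.
have mm : m = m' by have := bij_eq_card bb; rewrite !card_ord.
subst n' m' => /ord_mono_id ia /ord_mono_id ib Hv Hf.
have <- : vt = vt' by apply/ffunP=> h; have := Hv h; rewrite ia ib.
have <- : fl = fl' by apply/ffunP=> h; have := Hf h; rewrite !ib.
have bE s : map b s = s by rewrite (eq_map (g := id)) ?map_id // => x; rewrite ib.
split=> // [s|e d s]; first by rewrite bE.
by rewrite gcast_id /free_cls /= bE.
Qed.

Lemma free_sp_fiber (T u : ggGrc) (f : mor T u) i : local_terminal u ->
  [/\ free_sp (fiber f i) = free_sp T,
      forall s, gordering (fiber f i) s =
        gordering T (map (fun h : 'I_(nh (fiber f i)) => enum_val h) s)
    & forall (e : free_sp (fiber f i) = free_sp T) d s,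
        gcast e (free_cls d s) = free_cls d (map (fun h : 'I_(nh (fiber f i)) => enum_val h) s)].
Proof.
move=> tu; have one x : x = i by apply: local_terminal_vertex.
have vin x : x \in fvert f i by rewrite inE (one (vmap f x)).
have hin h : h \in fhalf f i by rewrite inE (one (vmap f _)).
apply: (@free_sp_relabel (fiber f i) T (fun x => enum_val x) (fun h => enum_val h)).
- exists (fun x => enum_rank_in (vin x) x) => x; last by rewrite enum_rankK_in.
  by apply: enum_val_inj; rewrite enum_rankK_in.
- exists (fun x => enum_rank_in (hin x) x) => x; last by rewrite enum_rankK_in.
  by apply: enum_val_inj; rewrite enum_rankK_in.
- by move=> x y; rewrite enum_val_lt.
- by move=> x y; rewrite enum_val_lt.
- by move=> h; rewrite fib_vtx.
move=> h; rewrite (fib_flip (mor_contr (mor_specP f))); case: ifP => // /codomP[a ->].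
have u0 : forall a, flip u a = a by apply/ne0P/local_terminal_ne.
by rewrite -(mor_flip (mor_specP f)) u0.
Qed.

Definition free_act (S T : ggGrc) (w : iso S T) d : {linear free_sp T d -> free_sp S d} :=
  mk_linear (oext_linear (fun s => free_cls d (map (hmap w) s))).

Lemma free_act_cls (S T : ggGrc) (w : iso S T) d s : d = 0 -> gordering T s ->
  free_act w d (free_cls d s) = free_cls d (map (hmap w) s).
Proof.
move=> d0 os; apply: (oext_cls (@flipK T)) => // t t' _ st.
apply: (ocls_step _ _); rewrite -[map _ t]cat0s -[map _ t']cat0s; exact: step_map.
Qed.

(** The inclusion of the fiber's half-edges, transported along the equality of graphs contained in
    [elem]. *)
Definition fincl (F T S : ggGrc) (f : mor T S) i (h : elem F f i) : 'I_(nh F) -> 'I_(nh T) :=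
  let: conj _ e := h in
  match e in _ = X return 'I_(nh X) -> 'I_(nh T) with erefl => fun a => enum_val a end.

Definition free_comp (F T S : ggGrc) (f : mor T S) i (h : elem F f i) (p q n : int) (_ : p + q = n)
    (a : free_sp S p) (b : free_sp F q) : free_sp T n :=
  oext (fun v => oext (fun u => free_cls n (map (fincl h) u ++ map (hmap f) v)) b) a.

Lemma finclE (T S : ggGrc) (f : mor T S) i (fe : elementary f i) (h : 'I_(nh (fiber f i))) :
  fincl (conj fe erefl) h = enum_val h.
Proof. by []. Qed.

Lemma fincl_ordering (F T S : ggGrc) (f : mor T S) i (h : elem F f i) u v :
  gordering F u -> gordering S v -> gordering T (map (fincl h) u ++ map (hmap f) v).
Proof.
case: h => fe e; case: F / e u => u ou ov; rewrite (eq_map (finclE fe)).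
by apply: ordering_comp => // g; apply: elementary_inner.
Qed.

Lemma fincl_step (F T S : ggGrc) (f : mor T S) i (h : elem F f i) u u' w :
  gordering F u -> gstep F u u' -> gstep T (map (fincl h) u ++ w) (map (fincl h) u' ++ w).
Proof.
by case: h => fe e; case: F / e u u' => u u' ou; rewrite !(eq_map (finclE fe)); apply: step_fiber.
Qed.

Lemma fincl_inner (F T S : ggGrc) (f : mor T S) i (h : elem F f i) (a : 'I_(nh F)) :
  flip F a != a -> fincl h a \notin codom (hmap f).
Proof. by case: h => fe e; case: F / e a => a; rewrite fiber_nonfixed finclE. Qed.

Lemma fincl_vtx (F T S : ggGrc) (f : mor T S) i (h : elem F f i) (a : 'I_(nh F)) :
  vmap f (vtx T (fincl h a)) = i.
Proof.
case: h => fe e; case: F / e a => a; rewrite finclE.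
by have := enum_valP a; rewrite inE => /eqP.
Qed.

Lemma free_comp_cls (F T S : ggGrc) (f : mor T S) i (h : elem F f i) (p q n : int) (e : p + q = n) v u :
  p = 0 -> q = 0 -> gordering S v -> gordering F u ->
  free_comp h e (free_cls p v) (free_cls q u) = free_cls n (map (fincl h) u ++ map (hmap f) v).
Proof.
move=> p0 q0 ov ou; rewrite /free_comp; set g := fun v => _.
have E t : oext (fun u => free_cls n (map (fincl h) u ++ map (hmap f) t)) (free_cls q u) =
    free_cls n (map (fincl h) u ++ map (hmap f) t).
  apply: (oext_cls (@flipK F)) => // r r' orr st.
  by apply: (ocls_step _ _); apply: fincl_step.
rewrite (oext_cls (@flipK S)) //; first exact: E.
move=> t t' ot st; rewrite /g !E.
apply: (ocls_step _ _); apply: step_map => // _ /mapP[a au ->].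
by rewrite (mor_contr (mor_specP f)) // fincl_inner // (ordering_neq ou).
Qed.

Lemma free_comp_linl (F T S : ggGrc) (f : mor T S) i (h : elem F f i) (p q n : int)
  (e : p + q = n) (b : free_sp F q) : linear (fun a => free_comp h e a b).
Proof. exact: oext_linear. Qed.

Lemma free_comp_linr (F T S : ggGrc) (f : mor T S) i (h : elem F f i) (p q n : int)
  (e : p + q = n) (a : free_sp S p) : linear (free_comp h e a).
Proof.
move=> c x y; rewrite /free_comp -oext_lin; congr oext; apply: funext => v.
exact: oext_linear.
Qed.

Lemma free_sp_lin_eq (T : pregraph) d (V : lmodType k) (f g : free_sp T d -> V) :
  linear f -> linear g ->
  (forall s, d = 0 -> gordering T s -> f (free_cls d s) = g (free_cls d s)) -> f =1 g.
Proof. exact: osp_lin_eq. Qed.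

Lemma gcast_linear (A B : gvs k) (e : A = B) d : linear (@gcast k A B e d).
Proof. by case: B / e => c x y. Qed.

Lemma free_act_id (T : ggGrc) d (x : free_sp T d) : free_act (iso_id T) d x = x.
Proof.
move: x; apply: free_sp_lin_eq => [|//|s d0 os]; first exact: linearP.
by rewrite free_act_cls // (eq_map (g := id)) ?map_id // => h; rewrite ffunE.
Qed.

Lemma free_act_comp (S T U : ggGrc) (g : iso T U) (f : iso S T) d (x : free_sp U d) :
  free_act (iso_comp g f) d x = free_act f d (free_act g d x).
Proof.
move: x; apply: free_sp_lin_eq => [|c x y|s d0 os]; first exact: linearP.
  by rewrite !linearP.
rewrite !free_act_cls //; last by rewrite (ordering_full _ (iso_codom g)).
by rewrite -map_comp; congr free_cls; apply: eq_map => h; rewrite mcomp_hmap.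
Qed.

(** Compares transported inclusions without unfolding the transports: both list the same set
    increasingly. *)
Lemma ord_mono_eq n m (a b : 'I_n -> 'I_m) :
  (forall i j : 'I_n, (i < j)%N -> (a i < a j)%N) ->
  (forall i j : 'I_n, (i < j)%N -> (b i < b j)%N) ->
  (forall x, (x \in codom a) = (x \in codom b)) -> a =1 b.
Proof.
move=> am bm ab; suff: map a (enum 'I_n) = map b (enum 'I_n).
  by move/eq_in_map => H i; apply: H; rewrite mem_enum.
have srt (c : 'I_n -> 'I_m) : (forall i j : 'I_n, (i < j)%N -> (c i < c j)%N) ->
    sorted ltn (map val (map c (enum 'I_n))).
  move=> cm; have := sorted_enum_ord (mem 'I_n); rewrite !sorted_map.
  by apply: sub_sorted => i j; apply: cm.
apply/(inj_map val_inj)/(@irr_sorted_eq _ ltn ltn_trans ltnn); try exact: srt.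
by apply: eq_mem_map => x; rewrite -!codomE ab.
Qed.

Lemma fincl_mono (F T S : ggGrc) (f : mor T S) i (h : elem F f i) (a b : 'I_(nh F)) :
  (a < b)%N -> (fincl h a < fincl h b)%N.
Proof. by case: h => fe e; case: F / e a b => a b; rewrite !finclE enum_val_lt. Qed.

Lemma fincl_codom (F T S : ggGrc) (f : mor T S) i (h : elem F f i) g :
  (g \in codom (fincl h)) = (vmap f (vtx T g) == i).
Proof.
apply/codomP/eqP => [[a ->]|gi]; first exact: fincl_vtx.
case: h => fe e; case: F / e; have gin : g \in fhalf f i by rewrite inE gi.
by exists (enum_rank_in gin g); rewrite finclE enum_rankK_in.
Qed.

Lemma finclE' (T S : ggGrc) (f : mor T S) i (h : elem (fiber f i) f i) a :
  fincl h a = enum_val a.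
Proof. by case: h => fe e; rewrite (Prop_irrelevance e erefl). Qed.

Lemma fincl_fiber_map F (T S P : ggGrc) (f : mor T S) (g : mor S P) j i
    (j' : 'I_(nv (fiber g i))) (hf : elem F f j) (hfi : elem F (fiber_map f g i) j') a :
  enum_val j' = j -> enum_val (fincl hfi a) = fincl hf a.
Proof.
move=> ej; apply: (@ord_mono_eq _ _ (fun a => enum_val (fincl hfi a))) a => [a b|a b|x].
- by move/(fincl_mono hfi); rewrite enum_val_lt.
- exact: fincl_mono.
have gi : vmap g j = i by rewrite -ej; have := enum_valP j'; rewrite inE => /eqP.
rewrite fincl_codom; apply/codomP/eqP => [[a ->]|xj].
  have := congr1 (fun z => enum_val z) (fincl_vtx hfi a).
  by rewrite fiber_vmapE fib_vtx ej.
have xin : x \in fhalf (mcomp g f) i by rewrite inE mcomp_vmap xj gi.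
pose y : 'I_(nh (fiber (mcomp g f) i)) := enum_rank_in xin x.
have yx : enum_val y = x by rewrite enum_rankK_in.
have : y \in codom (fincl hfi).
  rewrite fincl_codom; apply/eqP/enum_val_inj.
  by rewrite fiber_vmapE fib_vtx yx xj ej.
by case/codomP=> a ea; exists a; rewrite -ea yx.
Qed.

Lemma elementary_hmap_mono (T S : ggGrc) (f : mor T S) j (a b : 'I_(nh S)) :
  elementary f j -> vtx S a != j -> vtx S b != j -> (a < b)%N -> (hmap f a < hmap f b)%N.
Proof.
case/elementaryP=> mono tr _ aj bj ab; have fm := mor_specP f.
have := g_mono (ggGrc_spec S) (ltnW ab); rewrite leq_eqVlt => /orP[/eqP/val_inj e|lt].
  by have /trivial_fiberP[_ _ H] := tr _ bj; apply: H.
rewrite ltnNge; apply: contraTN lt => /(g_mono (ggGrc_spec T))/mono.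
by rewrite !(mor_vtx fm) -leqNgt.
Qed.

(** Nothing over [i] is contracted by [f'], nor over [l] by [g'']; both sides therefore list
    increasingly the half-edges of [T] over [l]. *)
Lemma fincl_par (G T P' P'' S : ggGrc) (f' : mor T P') (g' : mor P' S)
    (f'' : mor T P'') (g'' : mor P'' S) j i l m a
    (hf' : elementary f' j) (hg' : elem G g' i) (hf'' : elem G f'' l) (hg'' : elementary g'' m) :
  mcomp g' f' = mcomp g'' f'' -> vmap g'' l = i -> vmap g' j = m -> i != m ->
  hmap f' (fincl hg' a) = fincl hf'' a.
Proof.
move=> E gl gj im; have fm' := mor_specP f'.
have vj b : vmap g' (vtx P' b) = i -> vtx P' b != j.
  by move=> bi; apply: contraNneq im => bj; rewrite -bi bj gj.
apply: (@ord_mono_eq _ _ (fun a => hmap f' (fincl hg' a))) a => [a b ab|a b|x].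
- by apply: (elementary_hmap_mono hf'); rewrite ?fincl_mono // vj ?fincl_vtx.
- exact: fincl_mono.
rewrite fincl_codom; apply/codomP/eqP => [[a ->]|xl].
  have /elementaryP[_ /(_ i im)/trivial_fiberP[H _ _] _] := hg''.
  by apply: H => //; rewrite -mcomp_vmap -E mcomp_vmap (mor_vtx fm') fincl_vtx.
have xi : vmap g' (vmap f' (vtx T x)) = i by rewrite -mcomp_vmap E mcomp_vmap xl.
have : x \in codom (hmap f').
  have /elementaryP[_ tr _] := hf'.
  have /tr/trivial_fiberP[_ H _] : vmap f' (vtx T x) != j.
    by apply: contraNneq im => e; rewrite -xi e gj.
  exact: H.
case/codomP=> b eb; have : b \in codom (fincl hg').
  by rewrite fincl_codom -(mor_vtx fm') -eb xi.
by case/codomP=> a ea; exists a; rewrite -ea.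
Qed.

(** On words both sides are the same concatenation: the edges of [F], those of the fiber of [g],
    those of [P]. *)
Lemma free_comp_assoc F (T S P : ggGrc) (f : mor T S) (g : mor S P) j i
    (j' : 'I_(nv (fiber g i)))
    (hf : elem F f j) (hg : elem (fiber g i) g i)
    (hgf : elem (fiber (mcomp g f) i) (mcomp g f) i)
    (hfi : elem F (fiber_map f g i) j') :
    vmap g j = i -> enum_val j' = j ->
    forall (p q r m m' n : int) (e1 : p + m = n) (e2 : q + r = m)
      (e3 : m' + r = n) (e4 : p + q = m')
      (a : free_sp P p) (b : free_sp (fiber g i) q) (c : free_sp F r),
    free_comp hgf e1 a (free_comp hfi e2 b c) = free_comp hf e3 (free_comp hg e4 a b) c.
Proof.
move=> _ ej p q r m m' n e1 e2 e3 e4 a b c; move: a.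
apply: free_sp_lin_eq => [||v p0 ov]; first exact: free_comp_linl.
  by move=> x a a'; rewrite free_comp_linl free_comp_linl.
move: b; apply: free_sp_lin_eq => [x b b'|x b b'|u q0 ou]; rewrite ?free_comp_linl ?free_comp_linr ?free_comp_linl //.
move: c; apply: free_sp_lin_eq => [x c c'|x c c'|w r0 ow]; rewrite ?free_comp_linr ?free_comp_linr //.
rewrite !free_comp_cls // ?fincl_ordering -?e2 -?e4 ?p0 ?q0 ?r0 //.
congr free_cls; rewrite !map_cat -!map_comp catA; congr ((_ ++ _) ++ _).
- by apply: eq_map => x; rewrite /= finclE' (fincl_fiber_map hf hfi).
- by apply: eq_map => x; rewrite /= !finclE' fiber_hmapE.
by apply: eq_map => x; rewrite /= mcomp_hmap.
Qed.

(** The two sides list the blocks of [F] and [G] in opposite orders. The blocks lie over the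
    distinct vertices [m] and [i] of [S], so the common composite separates all their letters. *)
Lemma free_comp_par (F G T P' P'' S : ggGrc) (f' : mor T P') (g' : mor P' S)
    (f'' : mor T P'') (g'' : mor P'' S) j i l m
    (hf' : elem F f' j) (hg' : elem G g' i)
    (hf'' : elem G f'' l) (hg'' : elem F g'' m) :
    mcomp g' f' = mcomp g'' f'' -> vmap g'' l = i -> vmap g' j = m -> i != m ->
    forall (p q r s t n : int) (e1 : p + r = s) (e2 : s + q = n)
      (e3 : p + q = t) (e4 : t + r = n)
      (a : free_sp S p) (b : free_sp F q) (c : free_sp G r),
    (-1) ^+ absz (q * r) *: free_comp hf' e2 (free_comp hg' e1 a c) b =
    free_comp hf'' e4 (free_comp hg'' e3 a b) c.
Proof.
move=> E gl gj im p q r s t n e1 e2 e3 e4 a b c; move: a.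
apply: free_sp_lin_eq => [x a a'|x a a'|v p0 ov].
- by rewrite !free_comp_linl scalerDr !scalerA mulrC.
- by rewrite !free_comp_linl.
move: b; apply: free_sp_lin_eq => [x b b'|x b b'|u q0 ou].
- by rewrite free_comp_linr scalerDr !scalerA mulrC.
- by rewrite free_comp_linr free_comp_linl.
move: c; apply: free_sp_lin_eq => [x c c'|x c c'|w r0 ow].
- by rewrite free_comp_linr free_comp_linl scalerDr !scalerA mulrC.
- by rewrite free_comp_linr.
rewrite [absz _](_ : _ = 0%N) ?q0 ?mul0r // expr0 scale1r.
rewrite !free_comp_cls // ?fincl_ordering -?e1 -?e3 ?p0 ?q0 ?r0 //.
apply: (ocls_eqv _ _); rewrite !map_cat -!map_comp.
have [eF _] := hf'; have [eG _] := hg'; have [eF' _] := hf''; have [eG' _] := hg''.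
have mi : m != i by rewrite eq_sym.
rewrite (eq_map (fun a => fincl_par a eF hg' hf'' eG' E gl gj im)).
rewrite (eq_map (fun a => fincl_par a eF' hg'' hf' eG (esym E) gj gl mi)).
have -> : map (hmap f'' \o hmap g'') v = map (hmap f' \o hmap g') v.
  by apply: eq_map => x /=; rewrite -!mcomp_hmap E.
have pF x : flip F x != x -> vmap (mcomp g' f') (vtx T (flip T (fincl hf' x))) = m /\
   vmap (mcomp g' f') (vtx T (fincl hf' x)) = m.
  move=> /(fincl_inner hf')/(mor_contr (mor_specP f')) e.
  by rewrite !mcomp_vmap -e fincl_vtx.
have pG x : flip G x != x -> vmap (mcomp g' f') (vtx T (flip T (fincl hf'' x))) = i /\
   vmap (mcomp g' f') (vtx T (fincl hf'' x)) = i.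
  move=> /(fincl_inner hf'')/(mor_contr (mor_specP f'')) e.
  by rewrite E !mcomp_vmap -e fincl_vtx.
apply: eqv_swap_blocks => z h h' zs /mapP[x xu ->] /mapP[y yw ->].
have [px1 px2] := pF x (ordering_neq ou xu); have [py1 py2] := pG y (ordering_neq ow yw).
apply: (@separated_mor _ _ (mcomp g' f')); rewrite ?px1 ?px2 ?py1 ?py2 //.
move=> g /zs; rewrite mem_cat => /orP[]/mapP[y' yw' ->].
  by have [e5 e6] := pF y' (ordering_neq ou yw'); exact: etrans e6 (esym e5).
by have [e5 e6] := pG y' (ordering_neq ow yw'); exact: etrans e6 (esym e5).
Qed.

Lemma free_sp_eq (F T u : ggGrc) (f : mor T u) i : local_terminal u -> elem F f i -> free_sp F = free_sp T.
Proof. by move=> tu [_ <-]; have [] := free_sp_fiber f i tu. Qed.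

Lemma scale_cls_linear T d s : linear (fun c : k^o => c *: free_cls (T := T) d s).
Proof. by move=> c x y; rewrite scalerDl scalerA. Qed.

Definition free_unit (U : ggGrc) : {linear k^o -> free_sp U 0} := mk_linear (@scale_cls_linear U 0 [::]).

Lemma ordering_nil (T : ggGrc) : ne T = 0%N -> gordering T [::].
Proof.
by move=> T0; have [s os] := ordering_exists T; have := ordering_ne os; rewrite T0 => /size0nil e; rewrite -e.
Qed.

Lemma free_unit_act (u U : ggGrc) (t : iso u U) c : local_terminal U ->
  free_act t 0 (free_unit U c) = c *: free_cls 0 [::].
Proof.
by move=> tU; rewrite linearZ free_act_cls // ordering_nil // local_terminal_ne.
Qed.

Lemma trivial_local_terminal U : trivial U -> local_terminal U.
Proof. by case/andP. Qed.

Lemma free_comp_unitl (F T u U : ggGrc) (f : mor T u) i (hf : elem F f i)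
    (hU : trivial U) (t : iso u U) : local_terminal u ->
    forall (n : int) (e : 0 + n = n) (eq : free_sp F = free_sp T) (b : free_sp F n),
    free_comp hf e (free_act t 0 (free_unit U 1)) b = gcast eq b.
Proof.
move=> tu n e eq; rewrite free_unit_act ?trivial_local_terminal // scale1r.
apply: free_sp_lin_eq => [||s n0 os]; [exact: free_comp_linr | exact: gcast_linear |].
rewrite free_comp_cls // ?ordering_nil ?local_terminal_ne // cats0.
case: hf => fe eF; case: F / eF s os eq => s os eq; rewrite (eq_map (finclE fe)).
by have [_ _ ->] := free_sp_fiber f i tu.
Qed.

Lemma gcast_sym (A B : gvs k) (e : A = B) (e' : B = A) d x : gcast e' (@gcast k A B e d x) = x.
Proof. by case: B / e e' => e'; rewrite gcast_id. Qed.

(** Makes the abstract equality in [op_equiv] computable: [F'] is the fiber of [fiber_map f' s j]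
    over the local terminal graph [fiber s j], so the transport only renames letters. *)
Lemma gcast_fiber (F' T' S' S'' : ggGrc) (f' : mor T' S') (s : iso S' S'') i j x
    (h' : elem F' f' i) (eq : free_sp (fiber x j) = free_sp F') u d :
  x = mcomp s f' -> vmap s i = j -> gordering (fiber x j) u ->
  exists u', [/\ gcast eq (free_cls d u) = free_cls d u', gordering F' u'
    & map (fincl h') u' = map (fun a : 'I_(nh (fiber x j)) => enum_val a) u].
Proof.
move=> ex si; subst x => ou.
have iin : i \in fvert s j by rewrite inE si.
pose x0 : 'I_(nv (fiber s j)) := enum_rank_in iin i.
have x0i : enum_val x0 = i by rewrite enum_rankK_in.
have eF : fiber (fiber_map f' s j) x0 = F' by rewrite fiber_of_fiber_map x0i; case: h'.
subst F'.
have ts := fiber_iso_terminal s j.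
have [eq1 oE cE] := free_sp_fiber (fiber_map f' s j) x0 ts.
have iin' a : a \in fhalf (fiber_map f' s j) x0.
  by rewrite inE; apply/eqP; apply: local_terminal_vertex.
pose u' : seq 'I_(nh (fiber (fiber_map f' s j) x0)) := map (fun a => enum_rank_in (iin' a) a) u.
have u'E : map (fun h : 'I_(nh (fiber (fiber_map f' s j) x0)) => enum_val h) u' = u.
  by rewrite -map_comp (eq_map (g := id)) ?map_id // => a /=; rewrite enum_rankK_in.
exists u'; split.
- by rewrite -[in LHS]u'E -(cE eq1) gcast_sym.
- by rewrite oE u'E.
rewrite -[in RHS]u'E -[RHS]map_comp; apply: eq_map; apply: ord_mono_eq => [a b|a b|g].
- exact: fincl_mono.
- by rewrite /= !enum_val_lt.
rewrite fincl_codom; apply/eqP/codomP => [gi|[a ->]].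
  have gin : g \in fhalf (mcomp s f') j by rewrite inE mcomp_vmap gi si.
  exists (enum_rank_in (iin' (enum_rank_in gin g)) (enum_rank_in gin g)).
  by rewrite /= !enum_rankK_in.
have := enum_valP (enum_val a); rewrite inE mcomp_vmap => /eqP sg.
by apply: (can_inj (iso_vmapK s)); rewrite sg si.
Qed.

Lemma free_comp_equiv (F' T' T'' S' S'' : ggGrc) (f' : mor T' S') (f'' : mor T'' S'')
    (w : iso T' T'') (s : iso S' S'') i j
    (h' : elem F' f' i) (h'' : elem (fiber f'' j) f'' j)
    (wj : iso (fiber (mcomp f'' w) j) (fiber f'' j)) :
    mcomp f'' w = mcomp s f' -> iso_mor wj = fiber_map w f'' j ->
    forall (eq : free_sp (fiber (mcomp f'' w) j) = free_sp F') (p q n : int)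
      (e : p + q = n) (a : free_sp S'' p) (b : free_sp (fiber f'' j) q),
    free_act w n (free_comp h'' e a b) =
    free_comp h' e (free_act s p a) (gcast eq (free_act wj q b)).
Proof.
move=> E wjE eq p q n e a b.
have si : vmap s i = j.
  have /elementaryP[_ _ [h hj hc]] : elementary f'' j by case: h''.
  have hc' : hmap w h \notin codom (hmap f').
    apply: contraNN hc => /codomP[c ec].
    rewrite -(mcomp_codom f'' w) E ec mcomp_codom; exact: iso_codom.
  have fe : elementary f' i by case: h'.
  rewrite -(elementary_inner fe hc') -mcomp_vmap -E mcomp_vmap.
  by rewrite (mor_vtx (mor_specP w)).
move: a; apply: free_sp_lin_eq => [x a a'|x a a'|v p0 ov].
- by rewrite free_comp_linl linearP.
- by rewrite linearP free_comp_linl.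
move: b; apply: free_sp_lin_eq => [x b b'|x b b'|u q0 ou].
- by rewrite free_comp_linr linearP.
- by rewrite linearP gcast_linear free_comp_linr.
rewrite (free_act_cls s) // (free_act_cls wj) // free_comp_cls // free_act_cls ?fincl_ordering // -?e ?p0 ?q0 //.
have ou' : gordering (fiber (mcomp f'' w) j) (map (hmap wj) u).
  by rewrite (ordering_full _ (iso_codom wj)).
have [u' [-> ou'' u'E]] := gcast_fiber h' eq q E si ou'.
rewrite free_comp_cls // ?(ordering_full _ (iso_codom s)) //.
congr free_cls; rewrite u'E map_cat -!map_comp; congr (_ ++ _); apply: eq_map => x /=.
  by rewrite finclE' wjE fiber_hmapE.
by rewrite -!mcomp_hmap E.
Qed.

Definition free_operad : operad k :=
  @Operad k (fun T : ggGrc => free_sp T) free_act free_comp (fun U _ => free_unit U)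
    free_act_id free_act_comp free_comp_linl free_comp_linr free_comp_assoc free_comp_par free_sp_eq free_comp_unitl free_comp_equiv.

End FreeOperad.

(** * Iterated composites in an operad *)

Lemma one_edge_mcomp_iso (T1 T S : ggGrc) (w : iso T1 T) (p : mor T S) h :
  one_edge p h -> one_edge (mcomp p w) (hmap w h).
Proof.
move=> ph g; rewrite -(iso_hmapVK w g) mcomp_codom ph -(mor_flip (mor_specP w)).
by rewrite !(inj_eq (mor_inj (mor_specP w))).
Qed.

Lemma one_edge_comp_iso (T S S1 : ggGrc) (w : iso S S1) (p : mor T S) h :
  one_edge p h -> one_edge (mcomp w p) h.
Proof.
move=> ph g; rewrite -ph; congr (~~ _).
apply/idP/idP => [/mcomp_codomS //|/codomP[a ->]].
by rewrite mcomp_codom iso_codom.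
Qed.

Lemma one_edge_vtx (T S : ggGrc) (p : mor T S) h g : one_edge p h -> g \notin codom (hmap p) ->
  vmap p (vtx T g) = vmap p (vtx T h).
Proof.
move=> ph; have: h \notin codom (hmap p) by rewrite ph eqxx.
move/(mor_contr (mor_specP p)) => e; rewrite ph => /orP[/eqP -> //|/eqP ->].
by rewrite e.
Qed.

Lemma one_edge_elementary (T S : ggGrc) (p : mor T S) h : one_edge p h ->
  exists (T' : ggGrc) (w : iso T T') (f : mor T' S),
    mcomp f w = p /\ elementary f (vmap p (vtx T h)).
Proof.
move=> ph; have [|T' [w [f [fw mono tr]]]] := @make_elementary _ _ p (pred1 (vmap p (vtx T h))).
  by move=> g gh; apply: contraT => /(one_edge_vtx ph)/eqP e; rewrite /= e in gh.
exists T', w, f; split=> //; apply/elementaryP; split=> //.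
exists (hmap (iso_inv w) h); last by rewrite -(mcomp_codom f w) fw iso_hmapVK ph eqxx.
by rewrite -fw mcomp_vmap -{2}(iso_hmapVK w h) (mor_vtx (mor_specP w)).
Qed.

(** Peels the edge of [x] off an elementary map. The second contracted edge [y] guarantees that the
    remaining factor still contracts something, as an elementary map must. *)
Lemma split_first (T S : ggGrc) (p : mor T S) i x y : elementary p i ->
  x \notin codom (hmap p) -> y \notin codom (hmap p) -> y != x -> y != flip T x ->
  exists (T1 T' : ggGrc) (w : iso T T') (f : mor T' T1) (g : mor T1 S) j,
    [/\ mcomp (mcomp g f) w = p, one_edge (mcomp f w) x, elementary f j,
        elementary g i & vmap g j = i].
Proof.
move=> pe xc yc yx yx'.
have xx : flip T x != x by apply: contraNneq xc; apply: mor_legs_codom.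
have [T0 [f0 f0x]] := contract_edge xx.
have [p0 p0f] : exists p0, mcomp p0 f0 = p.
  apply: mor_factor => a; apply: contraT; rewrite f0x => /orP[]/eqP e.
    by rewrite -e codom_f in xc.
  by rewrite -flip_codom -e codom_f in xc.
have [|T1 [w0 [g [gw mono tr]]]] := @make_elementary _ _ p0 (pred1 i).
  move=> a ai; rewrite -(mcomp_codom p0 f0) p0f; apply: contraT => /(elementary_inner pe) e.
  by move: ai; rewrite /= -(mor_vtx (mor_specP f0)) -mcomp_vmap p0f e eqxx.
have qx := one_edge_comp_iso w0 f0x; have gq : mcomp g (mcomp w0 f0) = p by rewrite mcompA gw.
have [T' [w [f [fw fe]]]] := one_edge_elementary qx.
exists T1, T', w, f, g, (vmap (mcomp w0 f0) (vtx T x)); split=> //.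
- by rewrite -mcompA fw gq.
- by rewrite fw.
- apply/elementaryP; split=> //.
  have : y \in codom (hmap (mcomp w0 f0)) by apply: contraT; rewrite qx (negbTE yx) (negbTE yx').
  case/codomP=> a ea; exists a; last by rewrite -(mcomp_codom g (mcomp w0 f0)) gq -ea.
  by rewrite -(mor_vtx (mor_specP (mcomp w0 f0))) -mcomp_vmap gq -ea (elementary_inner pe yc).
by rewrite -mcomp_vmap gq (elementary_inner pe xc).
Qed.

Lemma fincl_flip (F T S : ggGrc) (f : mor T S) i (h : elem F f i) a :
  flip F a != a -> fincl h (flip F a) = flip T (fincl h a).
Proof. by case: h => fe e; case: F / e a => a; rewrite !finclE; apply: fiber_flip. Qed.

Lemma fincl_inj (F T S : ggGrc) (f : mor T S) i (h : elem F f i) : injective (fincl h).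
Proof.
by case: h => fe e; case: F / e => a b; rewrite !finclE => /enum_val_inj.
Qed.

Lemma square_vertex (T' T'' S' S'' : ggGrc) (f' : mor T' S') (f'' : mor T'' S'')
    (w : iso T' T'') (s : iso S' S'') i j :
  elementary f' i -> elementary f'' j -> mcomp f'' w = mcomp s f' -> vmap s i = j.
Proof.
move=> fe fe'' E; have /elementaryP[_ _ [h hj hc]] := fe''.
have hc' : hmap w h \notin codom (hmap f').
  apply: contraNN hc => /codomP[c ec].
  rewrite -(mcomp_codom f'' w) E ec mcomp_codom; exact: iso_codom.
rewrite -(elementary_inner fe hc') -mcomp_vmap -E mcomp_vmap.
by rewrite (mor_vtx (mor_specP w)).
Qed.

Lemma fiber_map_elem (F T S P : ggGrc) (f : mor T S) (g : mor S P) i j (j' : 'I_(nv (fiber g i))) :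
  elem F f j -> enum_val j' = j -> elem F (fiber_map f g i) j'.
Proof.
move=> [fe <-] e; split; first by apply: elementary_fiber_map; rewrite e.
by rewrite fiber_of_fiber_map e.
Qed.

Local Open Scope ring_scope.

Section IteratedComposition.
Variables (k : fieldType) (M : operad k) (c : forall T : ggGrc, M T 0).
Hypothesis c_act : forall (S T : ggGrc) (w : iso S T), op_act M w 0 (c T) = c S.
Hypothesis c_eq : forall (F T u : ggGrc) (f : mor T u) i, local_terminal u -> elem F f i ->
  forall eq : M F = M T, gcast eq (c F) = c T.

Let e00 : 0 + 0 = 0 :> int := addr0 0.

(* y is the iterated composite of the generators c along the contraction of
   the edges of s in this order.  It is a relation because the relabellings w
   and the contractions f involve choices; iterval_uniq shows they do not matter. *)
Fixpoint iterval (n : nat) (T : ggGrc) (s : seq 'I_(nh T)) (y : M T 0) : Prop :=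
  match n with
  | 0%N => s = [::] /\ exists (U : ggGrc) (t : iso T U) (hU : trivial U),
             y = op_act M t 0 (op_unit M hU 1)
  | n'.+1 => exists (T' S F : ggGrc) (w : iso T T') (f : mor T' S) i (hf : elem F f i) h s' y',
      [/\ one_edge (mcomp f w) h, s = h :: map (hmap (mcomp f w)) s',
          y = op_act M w 0 (op_comp hf e00 y' (c F)) & iterval n' s' y']
  end.

Lemma iterval_size n T s y : @iterval n T s y -> size s = n.
Proof.
elim: n T s y => [|n IH] T s y; first by case=> ->.
by case=> T' [S [F [w [f [i [hf [h [s' [y' [_ -> _ /IH]]]]]]]]]] /=; rewrite size_map => ->.
Qed.

(** Equivariance with a generator in the fiber: the induced isomorphism of fibers and the transport
    are absorbed by [c_act] and [c_eq], the latter because [F'] is a fiber over a local terminal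
    graph. *)
Lemma op_equiv_gen (F' F'' T' T'' S' S'' : ggGrc) (f' : mor T' S') (f'' : mor T'' S'')
    (w : iso T' T'') (s : iso S' S'') i j
    (h' : elem F' f' i) (h'' : elem F'' f'' j) (a : M S'' 0) :
  mcomp f'' w = mcomp s f' ->
  op_act M w 0 (op_comp h'' e00 a (c F'')) = op_comp h' e00 (op_act M s 0 a) (c F').
Proof.
move=> E; case: (h'') => fe'' eF''; case: F'' / eF'' h'' => h''.
have si : vmap s i = j by apply: square_vertex E => //; case: h'.
have [wj wjE] := fiber_map_iso w f'' j.
have [eq eqc] : exists eq : M (fiber (mcomp f'' w) j) = M F', gcast eq (c _) = c F'.
  rewrite E; have iin : i \in fvert s j by rewrite inE si.
  have hi : elem F' (fiber_map f' s j) (enum_rank_in iin i : 'I_(nv (fiber s j))).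
    by apply: fiber_map_elem h' _; rewrite enum_rankK_in.
  have ts := fiber_iso_terminal s j.
  exists (esym (op_eq M ts hi)); rewrite -(c_eq ts hi (op_eq M ts hi)).
  exact: gcast_sym.
by rewrite (op_equiv h' (conj fe'' erefl) E wjE eq) c_act eqc.
Qed.

Lemma iterval_cons n (F T S : ggGrc) (f : mor T S) i (hf : elem F f i) h s y :
  one_edge f h -> @iterval n S s y ->
  iterval n.+1 (h :: map (hmap f) s) (op_comp hf e00 y (c F)).
Proof.
move=> fh sy; exists T, S, F, (iso_id T), f, i, hf, h, s, y.
by rewrite mcomp1 op_act_id.
Qed.

Lemma iterval_iso n (T1 T : ggGrc) (w : iso T1 T) s y :
  @iterval n T s y -> iterval n (map (hmap w) s) (op_act M w 0 y).
Proof.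
case: n => [|n].
  case=> -> [U [t [hU ->]]]; split=> //; exists U, (iso_comp t w), hU.
  by rewrite op_act_comp.
case=> T' [S [F [w' [f [i [hf [h [s' [y' [fh -> -> sy]]]]]]]]]].
exists T', S, F, (iso_comp w' w), f, i, hf, (hmap w h), s', y'; split=> //.
- by rewrite mcompA; apply: one_edge_mcomp_iso.
- rewrite map_cons -map_comp; congr (_ :: _); apply: eq_map => a.
  by rewrite mcompA [RHS]mcomp_hmap.
- by rewrite op_act_comp.
Qed.

(** Two presentations contract the same first edge, so their targets are isomorphic under [T].
    Induction compares the remaining composites along this isomorphism, and equivariance absorbs it
    together with the relabellings. *)
Lemma iterval_uniq n T s y y' : @iterval n T s y -> iterval n s y' -> y = y'.
Proof.
elim: n T s y y' => [|n IH] T s y y'.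
  case=> _ [U [t [hU ->]]] [_ [U' [t' [hU' ->]]]].
  have eU := trivial_iso_eq (iso_comp t' (iso_sym t)) hU hU'; subst U'.
  rewrite (bool_irrelevance hU' hU).
  by have -> : t = t' by apply/iso_ext/trivial_terminal.
case=> T1 [S1 [F1 [w1 [f1 [i1 [hf1 [h1 [s1 [y1 [fh1 -> -> sy1]]]]]]]]]].
case=> T2 [S2 [F2 [w2 [f2 [i2 [hf2 [h2 [s2 [y2 [fh2 eseq -> sy2]]]]]]]]]].
have es : map (hmap (mcomp f1 w1)) s1 = map (hmap (mcomp f2 w2)) s2 := congr1 behead eseq.
have eh : h1 = h2 := congr1 (head h1) eseq.
subst h2; have [r rE] := one_edge_iso fh1 fh2.
have s1E : s1 = map (hmap r) s2.
  apply: (inj_map (mor_inj (mor_specP (mcomp f1 w1)))); rewrite es -map_comp.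
  by apply: eq_map => a; rewrite -rE mcomp_hmap.
have y1E : y1 = op_act M r 0 y2 by apply: IH sy1 _; rewrite s1E; apply: iterval_iso.
pose w := iso_comp w2 (iso_sym w1).
have E : mcomp f2 w = mcomp r f1.
  apply: (@mcomp_epi _ _ _ w1); rewrite -[RHS]mcompA rE -!mcompA; congr mcomp.
  by rewrite /w /= isoK mcomp1.
rewrite y1E -(op_equiv_gen hf1 hf2 _ E) -op_act_comp.
congr (op_act M _ _ _); apply: iso_ext; rewrite /= -mcompA.
by rewrite isoK mcomp1.
Qed.

Lemma iterval_ex (T : ggGrc) s : gordering T s -> exists y, @iterval (size s) T s y.
Proof.
move: {2}(size s) (erefl (size s)) => n; elim: n T s => [|n IH] T s.
  move/size0nil=> -> /ordering_ne/esym T0 /=.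
  have [U [t hU]] := trivial_iso (ne0_local_terminal T0).
  by exists (op_act M t 0 (op_unit M hU 1)); split=> //; exists U, t, hU.
case: s => //= h s [sn] os.
have hh : flip T h != h by apply: (ordering_neq os); rewrite mem_head.
have [S [p ph]] := contract_edge hh.
have [s' es os'] := ordering_tail ph os; rewrite es size_map in sn *.
have [y ys] := IH S s' sn os'; rewrite sn in ys *; have [T' [w [f [fw fe]]]] := one_edge_elementary ph.
exists (op_act M w 0 (op_comp (conj fe erefl) e00 y (c _))).
exists T', S, _, w, f, _, (conj fe erefl), h, s', y; rewrite fw; split=> //; by rewrite -fw.
Qed.

Lemma iterval_ordering n T s y : @iterval n T s y -> gordering T s.
Proof.
elim: n T s y => [|n IH] T s y.
  case=> -> [U [t [hU _]]]; apply: ordering_nil; rewrite (iso_ne t).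
  by apply: local_terminal_ne; case/andP: hU.
case=> T' [S [F [w [f [i [hf [h [s' [y' [fh -> _ /IH os]]]]]]]]]].
by rewrite (ordering_one_edge _ fh).
Qed.

Lemma iterval_single T h y : @iterval 1 T [:: h] y -> y = c T.
Proof.
case=> T' [S [F [w [f [i [hf [h' [s' [y' [_ _ -> [_ [U [t [hU ->]]]]]]]]]]]]]].
have tS : local_terminal S.
  by apply: ne0_local_terminal; rewrite (iso_ne t) local_terminal_ne //; case/andP: hU.
by rewrite (op_unitl hf hU t tS e00 (op_eq M tS hf)) (c_eq tS hf) c_act.
Qed.

Lemma map_split (A B : Type) (f : A -> B) s (x : seq B) h y : map f s = x ++ h :: y ->
  exists x' h' y', [/\ s = x' ++ h' :: y', x = map f x', h = f h' & y = map f y'].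
Proof.
elim: s x => [|a s IH] [|b x] //= [].
  by move=> <- <-; exists [::], a, s.
by move=> <- /IH[x' [h' [y' [-> -> -> ->]]]]; exists (a :: x'), h', y'.
Qed.

Lemma closed_same_fiber (T S : ggGrc) (p : mor T S) (D : {set 'I_(nv T)}) :
  (forall g, g \notin codom (hmap p) -> (vtx T g \in D) = (vtx T (flip T g) \in D)) ->
  forall x y, vmap p x = vmap p y -> (x \in D) = (y \in D).
Proof.
move=> Dp x y /mor_same_fiber/connectP[s]; elim: s x => [|z s IH] x /=; first by move=> _ ->.
by case/andP=> /existsP[h /and3P[/Dp e /eqP <- /eqP <-]] /IH{}IH /IH <-.
Qed.

(** The separating set is pushed forward. It is a union of fibers of [p], because the contracted
    edge belongs to the prefix and does not leave it. *)
Lemma separated_one_edge (T S : ggGrc) (p : mor T S) h s a b : one_edge p h ->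
  gseparated T (h :: map (hmap p) s) (hmap p a) (hmap p b) -> gseparated S s a b.
Proof.
move=> ph [D [Ds [a1 a2] [b1 b2]]]; have pm := mor_specP p.
have Dh : (vtx T h \in D) = (vtx T (flip T h) \in D) by apply: Ds; rewrite mem_head.
have DE x : (vmap p x \in [set vmap p x | x in D]) = (x \in D).
  apply/imsetP/idP => [[y yD e]|xD]; last by exists x.
  rewrite (closed_same_fiber _ e) // => g; rewrite ph => /orP[]/eqP -> //.
  by rewrite flipK Dh.
exists [set vmap p x | x in D]; split; rewrite -?(mor_vtx pm) ?(mor_flip pm) ?DE //.
move=> g gs; rewrite -!(mor_vtx pm) (mor_flip pm) !DE; apply: Ds.
by rewrite inE map_f ?orbT.
Qed.

(* Relabel T so that contracting h and h' is monotone with trivial fibers away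
   from two vertices, split this map in both orders, and apply op_par. *)
Lemma iterval_swap n (T : ggGrc) h h' s y : gseparated T [::] h h' ->
  iterval n.+2 (h :: h' :: s) y -> @iterval n.+2 T (h' :: h :: s) y.
Proof.
move=> [D [_ [Dh1 Dh2] [Dh'1 Dh'2]]] ity; have := ity.
case=> T1 [S1 [F1 [w1 [f1 [i1 [hf1 [h0 [s1 [y1 [p1h e0 _ ity1]]]]]]]]]].
have eh : h = h0 := congr1 (head h) e0; subst h0.
have es : h' :: s = map (hmap (mcomp f1 w1)) s1 := congr1 behead e0.
case: ity1 => T2 [S2 [F2 [w2 [f2 [i2 [hf2 [h2 [s2 [y2 [p2h e2 _ ity2]]]]]]]]]].
subst s1; rewrite map_cons in es.
have eh' : h' = hmap (mcomp f1 w1) h2 := congr1 (head h') es.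
have {}es : s = map (hmap (mcomp f1 w1)) (map (hmap (mcomp f2 w2)) s2) := congr1 behead es.
pose q1 := mcomp f1 w1; pose q2 := mcomp f2 w2; rewrite -/q1 -/q2 in p1h p2h eh' es.
have q1m := mor_specP q1; have q2m := mor_specP q2.
pose p := mcomp q2 q1; have pE : mcomp q2 q1 = p by [].
have {}es : s = map (hmap p) s2.
  by rewrite es -map_comp; apply: eq_map => a; rewrite mcomp_hmap.
clear e0; clearbody q1 q2.
have pc g : (g \notin codom (hmap p)) =
    [|| g == h, g == flip T h, g == h' | g == flip T h'].
  rewrite -pE; have [/codomP[a ->]|gc] := boolP (g \in codom (hmap q1)).
    have nh : (hmap q1 a == h) || (hmap q1 a == flip T h) = false.
      by rewrite -p1h codom_f.
    rewrite mcomp_codom p2h orbA nh /= eh' -(mor_flip q1m).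
    by rewrite !(inj_eq (mor_inj q1m)).
  rewrite orbA -p1h gc /=; apply: contraNN gc; exact: mcomp_codomS.
have hp : h \notin codom (hmap p) by rewrite pc eqxx.
have hp' : h' \notin codom (hmap p) by rewrite pc eqxx !orbT.
pose m := vmap p (vtx T h); pose i := vmap p (vtx T h').
(* [D] is closed under the edges contracted by [p], hence a union of fibers on vertices; it contains
   the ends of [h] and not those of [h']. *)
have im : i != m.
  have nD := Dh'1; apply: contraNneq nD => e; rewrite (closed_same_fiber _ (e : vmap p (vtx T h') = vmap p (vtx T h))) // => g.
  by rewrite pc => /or4P[]/eqP -> //; rewrite ?flipK ?Dh1 ?Dh2 // (negbTE Dh'1) (negbTE Dh'2).
have pv g : g \notin codom (hmap p) -> vmap p (vtx T g) = if (g == h) || (g == flip T h) then m else i.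
  have em := mor_contr (mor_specP p) hp; have ei := mor_contr (mor_specP p) hp'.
  rewrite pc orbA; case: ifP => [|_] /=; first by case/orP=> /eqP ->; rewrite -?em.
  by case/orP=> /eqP ->; rewrite -?ei.
have [|T' [w [f [fw mono tr]]]] := @make_elementary _ _ p (pred2 i m).
  by move=> g; apply: contraR => /pv /= ->; case: ifP; rewrite eqxx ?orbT.
have wm := mor_specP w; have fm := mor_specP f.
pose a := hmap (iso_inv w) h; pose b := hmap (iso_inv w) h'.
have wa : hmap w a = h by rewrite /a iso_hmapVK.
have wb : hmap w b = h' by rewrite /b iso_hmapVK.
have fc g : (g \notin codom (hmap f)) = [|| g == a, g == flip T' a, g == b | g == flip T' b].
  by rewrite -(mcomp_codom f w) fw pc -wa -wb -!(mor_flip wm) !(inj_eq (mor_inj wm)).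
have fv g : vmap f (vtx T' g) = vmap p (vtx T (hmap w g)).
  by rewrite -fw mcomp_vmap (mor_vtx wm).
have fa : vmap f (vtx T' a) = m by rewrite fv wa.
have fb : vmap f (vtx T' b) = i by rewrite fv wb.
have ac : a \notin codom (hmap f) by rewrite fc eqxx.
have bc : b \notin codom (hmap f) by rewrite fc eqxx !orbT.
have fa' : vmap f (vtx T' (flip T' a)) = m by rewrite -(mor_contr fm).
have fb' : vmap f (vtx T' (flip T' b)) = i by rewrite -(mor_contr fm).
have aa : flip T' a != a by apply: contraNneq ac; apply: mor_legs_codom.
have bb : flip T' b != b by apply: contraNneq bc; apply: mor_legs_codom.
have mi : m != i by rewrite eq_sym.
have [Ra [ra rae]] := contract_edge aa; have [Rb [rb rbe]] := contract_edge bb.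
have [||||P' [w' [g' [j [gE' fe' ge' [gj' eF' eG']]]]]] :=
  @split_parallel T' Ra S2 f ra i m im mono.
- by move=> v vi vm; apply: tr; rewrite /= negb_or vi vm.
- move=> g; rewrite rae fc orbA andb_orr; have [gab|_] := boolP ((g == a) || (g == flip T' a)).
    by rewrite andbT orbC; case/orP: gab => /eqP ->; rewrite ?fa ?fa' eqxx ?orbT.
  rewrite andbF /=; apply/esym/negbTE; rewrite negb_and orbC -implybE; apply/implyP.
  by case/orP=> /eqP ->; rewrite ?fb ?fb'.
- by exists b.
- by exists a.
have [||||P'' [w'' [g'' [l [gE'' fe'' ge'' [gl'' eG'' eF'']]]]]] :=
  @split_parallel T' Rb S2 f rb m i mi mono.
- by move=> v vm vi; apply: tr; rewrite /= negb_or vi vm.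
- move=> g; rewrite rbe fc orbA andb_orr; have [gab|_] := boolP ((g == b) || (g == flip T' b)).
    by rewrite andbT; case/orP: gab => /eqP ->; rewrite ?fb ?fb' eqxx ?orbT.
  rewrite andbF orbF; apply/esym/negbTE; rewrite negb_and orbC -implybE; apply/implyP.
  by case/orP=> /eqP ->; rewrite ?fa ?fa'.
- by exists a.
- by exists b.
pose f' := mcomp w' ra; pose f'' := mcomp w'' rb; rewrite -/f' -/f'' in gE' gE'' fe' fe'' eF' eG''.
have f'e : one_edge f' a by apply: one_edge_comp_iso.
have f''e : one_edge f'' b by apply: one_edge_comp_iso.
have hf' : elem (fiber f m) f' j by [].
have hg' : elem (fiber f i) g' i by [].
have hf'' : elem (fiber f i) f'' l by [].
have hg'' : elem (fiber f m) g'' m by [].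
have ab : ~~ ((b == a) || (b == flip T' a)).
  by apply: contra im => /orP[]/eqP e; rewrite -fb e ?fa ?fa'.
have ba : ~~ ((a == b) || (a == flip T' b)).
  by apply: contra mi => /orP[]/eqP e; rewrite -fa e ?fb ?fb'.
have : b \in codom (hmap f') by rewrite -[_ \in _]negbK f'e.
case/codomP=> b1 eb1.
have : a \in codom (hmap f'') by rewrite -[_ \in _]negbK f''e.
case/codomP=> a1 ea1.
have g'e : one_edge g' b1.
  move=> g; rewrite -(mcomp_codom g' f') gE' fc orbA -f'e codom_f /= eb1.
  by rewrite -(mor_flip (mor_specP f')) !(inj_eq (mor_inj (mor_specP f'))).
have g''e : one_edge g'' a1.
  move=> g; rewrite -(mcomp_codom g'' f'') gE'' fc orbA orbC -f''e codom_f /= ea1.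
  by rewrite -(mor_flip (mor_specP f'')) !(inj_eq (mor_inj (mor_specP f''))).
(* Both orders of contraction end at [S2] with the same composite [y2]. [op_par] identifies the two
   extensions, and uniqueness identifies the first with [y]. *)
have it1 := iterval_iso w (iterval_cons hf' f'e (iterval_cons hg' g'e ity2)).
have it2 := iterval_iso w (iterval_cons hf'' f''e (iterval_cons hg'' g''e ity2)).
have := op_par hf' hg' hf'' hg'' (etrans gE' (esym gE'')) gl'' gj' im e00 e00 e00 e00 y2 (c _) (c _).
rewrite mul0r expr0 scale1r => opE; rewrite -opE in it2.
have pE1 : map (hmap w) (map (hmap f') (map (hmap g') s2)) = s.
  by rewrite es -!map_comp; apply: eq_map => x; rewrite -fw mcomp_hmap -gE' mcomp_hmap.
have pE2 : map (hmap w) (map (hmap f'') (map (hmap g'') s2)) = s.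
  by rewrite es -!map_comp; apply: eq_map => x; rewrite -fw mcomp_hmap -gE'' mcomp_hmap.
rewrite !map_cons pE1 -eb1 wa wb in it1; rewrite !map_cons pE2 -ea1 wa wb in it2.
by rewrite (iterval_uniq ity it1).
Qed.

(** A step behind the first letter descends to the contracted graph. At the front, a flip leaves the
    contraction unchanged and an exchange is [iterval_swap]. *)
Lemma iterval_step n (T : ggGrc) s t y : gstep T s t -> @iterval n T s y -> iterval n t y.
Proof.
elim: n T s t y => [|n IH] T s t y st.
  by case=> e; case: st e => [[|? x] h z|[|? x] h h' z _].
move=> ity; have := ity.
case=> T1 [S [F [w [f [i [hf [h0 [s' [y' [fh es ey ity']]]]]]]]]].
have [ht st'] : head h0 s = h0 /\ behead s = map (hmap (mcomp f w)) s' by rewrite es.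
move: es => _; case: st ht st' ity => [[|h1 x] h z|[|h1 x] h h' z sep] /= eh es ity; subst.
- exists T1, S, F, w, f, i, hf, (flip T h0), s', y'; split=> //; exact: one_edge_flip.
- have [x' [h' [z' [ez -> -> ->]]]] := map_split (esym es).
  exists T1, S, F, w, f, i, hf, h0, (x' ++ flip S h' :: z'), y'; split=> //.
    by rewrite map_cat map_cons (mor_flip (mor_specP (mcomp f w))).
  by apply: IH ity'; rewrite ez; apply: StepFlip.
- case: n ity' IH ity => [|n] ity' IH ity; first by case: ity' => e; rewrite e in es.
  exact: iterval_swap sep ity.
have [x' [a [[|b z'] [ez ex ea //]]]] := map_split (esym es).
rewrite map_cons => ez'.
have eb : h' = hmap (mcomp f w) b := congr1 (head h') ez'.
have ez2 : z = map (hmap (mcomp f w)) z' := congr1 behead ez'.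
subst; exists T1, S, F, w, f, i, hf, h0, (x' ++ b :: a :: z'), y'; split=> //.
  by rewrite map_cat !map_cons.
by apply: IH ity'; apply: StepSwap; apply: separated_one_edge fh sep.
Qed.

Lemma one_edge_single (F T S : ggGrc) (p : mor T S) i (hp : elem F p i) h :
  gordering F [:: h] -> one_edge p (fincl hp h).
Proof.
move=> oh; have hh : flip F h != h by apply: (ordering_neq oh); rewrite inE.
have fe : elementary p i by case: hp.
have nf a : (flip F a != a) = (a == h) || (a == flip F h).
  by have := perm_mem oh a; rewrite mem_enum !inE /= => ->.
move=> g; rewrite -fincl_flip //; apply/idP/orP => [gc|].
  have : g \in codom (fincl hp) by rewrite fincl_codom (elementary_inner fe gc).
  case/codomP=> a ea; suff : flip F a != a.
    by rewrite nf ea => /orP[]/eqP ->; rewrite eqxx; [left | right].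
  apply: contraNneq gc => fa; rewrite ea.
  case: (hp) => fe' e; case: F / e hp a fa ea {h oh hh nf} => hp a fa ea.
  rewrite finclE' -[_ \in _]negbK -fiber_nonfixed fa eqxx //.
by case=> /eqP ->; apply: fincl_inner; rewrite nf eqxx ?orbT.
Qed.

Lemma one_edge_fiber (T T' S P : ggGrc) (w : iso T T') (f : mor T' S) (g : mor S P) i
    (wi : iso (fiber (mcomp (mcomp g f) w) i) (fiber (mcomp g f) i)) h :
  iso_mor wi = fiber_map w (mcomp g f) i ->
  flip (fiber (mcomp (mcomp g f) w) i) h != h -> one_edge (mcomp f w) (enum_val h) ->
  one_edge (mcomp (fiber_map f g i) wi) h.
Proof.
move=> wiE hh fh a; rewrite -(iso_hmapVK wi a); move: (hmap _ a) => b.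
have cE : (b \in codom (hmap (fiber_map f g i))) = (enum_val b \in codom (hmap f)).
  exact: codom_fiber_map.
rewrite mcomp_codom cE -(mcomp_codom f w).
have wb : hmap w (enum_val b) = enum_val (hmap wi b) by rewrite wiE fiber_hmapE.
by rewrite wb fh -fiber_flip // !(inj_eq enum_val_inj).
Qed.

(** Concatenation of words is composition in [M]. The fiber is used up edge by edge: split off its
    first edge, apply associativity, and treat the rest by induction. The count starts at 1 since an
    elementary fiber has an edge. *)
Lemma iterval_comp n m (F T S : ggGrc) (p : mor T S) i (hp : elem F p i) u v a b :
  @iterval n.+1 F u b -> @iterval m S v a ->
  iterval (n.+1 + m)%N (map (fincl hp) u ++ map (hmap p) v) (op_comp hp e00 a b).
Proof.
elim: n F T S p i hp u v a b => [|n IH] F T S p i hp u v a b itu itv.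
  have ou := iterval_ordering itu.
  case: u itu ou (iterval_size itu) => [|h [|]] // itu ou _.
  rewrite (iterval_single itu); apply: iterval_cons => //.
  exact: one_edge_single.
have ou := iterval_ordering itu.
case: u itu ou (iterval_size itu) => [|h [|h2 u]] // itu ou _.
set u' := h2 :: u in itu ou *.
have nf g : g \in h :: u' -> flip F g != g by apply: ordering_neq ou.
have hh : flip F h != h by apply: nf; rewrite mem_head.
have hh2 : flip F h2 != h2 by apply: nf; rewrite !inE eqxx orbT.
have h2h : h2 != h by have := ordering_uniq ou; rewrite /= inE negb_or eq_sym => /andP[/andP[]].
have h2fh : h2 != flip F h.
  have := perm_uniq ou; rewrite enum_uniq cat_uniq => /and3P[_ /hasPn H _].
  have /H : flip F h \in map (flip F) (h :: u') by rewrite map_f ?mem_head.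
  by apply: contraNneq => <-; rewrite /= !inE eqxx orbT.
have [T1 [T' [w [f [g [j [E fx fe ge gj]]]]]]] : exists (T1 T' : ggGrc) (w : iso T T') (f : mor T' T1)
    (g : mor T1 S) j, [/\ mcomp (mcomp g f) w = p, one_edge (mcomp f w) (fincl hp h),
        elementary f j, elementary g i & vmap g j = i].
  apply: (@split_first _ _ p i (fincl hp h) (fincl hp h2)); try exact: fincl_inner.
  - by case: hp.
  - by rewrite (inj_eq (fincl_inj (h := hp))).
  - by rewrite -fincl_flip // (inj_eq (fincl_inj (h := hp))).
subst p; case: (hp) => pe eF; case: F / eF hp h h2 u @u' b itu ou nf hh hh2 h2h h2fh fx => hp
  h h2 u u' b itu ou nf hh hh2 h2h h2fh fx.
have gfe : elementary (mcomp g f) i by apply: elementary_comp fe ge gj.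
pose hg : elem (fiber g i) g i := conj ge erefl.
pose hgf : elem (fiber (mcomp g f) i) (mcomp g f) i := conj gfe erefl.
pose hf : elem (fiber f j) f j := conj fe erefl.
have jin : j \in fvert g i by rewrite inE gj.
pose j' : 'I_(nv (fiber g i)) := enum_rank_in jin j.
have ej : enum_val j' = j by rewrite enum_rankK_in.
have hfi : elem (fiber f j) (fiber_map f g i) j' by apply: fiber_map_elem hf ej.
have [wi wiE] := fiber_map_iso w (mcomp g f) i.
rewrite finclE' in fx.
have ch := one_edge_fiber wiE hh fx.
have [u1 eu ou1] := ordering_tail ch ou.
have [b1 it1] := iterval_ex ou1.
have su1 : size u1 = n.+1.
  have : (size u').+1 = n.+2 := iterval_size itu.
  by rewrite eu size_map => -[].
rewrite su1 in it1.
(* [f] induces a contraction of the same edge inside the fiber; uniqueness allows [b] to be computed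
   along it, the form that associativity requires. *)
have bE : b = op_act M wi 0 (op_comp hfi e00 b1 (c (fiber f j))).
  apply: iterval_uniq itu _; exists (fiber (mcomp g f) i), (fiber g i), (fiber f j), wi,
    (fiber_map f g i), j', hfi, h, u1, b1; split=> //.
  by rewrite eu.
have it2 := IH _ _ _ _ _ hg _ _ _ _ it1 itv.
exists T', T1, (fiber f j), w, f, j, hf, (enum_val h),
  (map (fincl hg) u1 ++ map (hmap g) v), (op_comp hg e00 a b1); split=> //.
  rewrite map_cons finclE' cat_cons eu map_cat -!map_comp; congr (_ :: _ ++ _); apply: eq_map => x.
    rewrite [LHS]finclE' mcomp_hmap wiE fiber_hmapE fiber_hmapE.
    by rewrite [RHS]mcomp_hmap finclE'.
  by rewrite [RHS]mcomp_hmap !mcomp_hmap.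
rewrite -(op_assoc hf hg hgf hfi gj ej e00 e00 e00 e00).
(* Equivariance moves [w] from the composite to the fiber, with the identity on [S]. *)
have sq : mcomp (mcomp g f) w = mcomp (iso_id S) (mcomp (mcomp g f) w) by rewrite mcomp1l.
by rewrite (op_equiv hp hgf sq wiE erefl) op_act_id -bE (Prop_irrelevance (conj pe erefl) hp).
Qed.

End IteratedComposition.

(** * Freeness and weights *)

Section Generators.
Variable k : fieldType.

(** The line k in degree 0 if [b] holds and zero otherwise. The index set has at most one element,
    so one formula serves both cases and the sum [ecoef] is the coordinate. *)
Definition esp (b : bool) : gvs k :=
  fun d => ({ffun 'I_((d == 0) && b) -> k^o} : lmodType k).

Definition egen b d : esp b d := [ffun=> 1 : k^o].

Definition ecoef b d (x : esp b d) : k := \sum_j x j.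

Lemma ecoef_linear b d (c : k) (x y : esp b d) : ecoef (c *: x + y) = c * ecoef x + ecoef y.
Proof. by rewrite /ecoef mulr_sumr -big_split; apply: eq_bigr => j _; rewrite !ffunE. Qed.

Lemma ecoef_span b d (x : esp b d) : x = ecoef x *: egen b d.
Proof.
rewrite /ecoef /egen; move: x; rewrite /esp; case: ((d == 0) && b) => x; apply/ffunP=> j.
  by rewrite !ffunE big_ord1 (ord1 j) [RHS]mulr1.
by case: j.
Qed.

Lemma ecoef_zero b d (x : esp b d) : (d == 0) && b = false -> ecoef x = 0.
Proof. by move=> e; rewrite /ecoef big1 // => -[j jl]; exfalso; move: jl; rewrite e. Qed.

Lemma ecoef_gen d : d = 0 -> ecoef (egen true d) = 1.
Proof. by move=> ->; rewrite /ecoef big_ord1 ffunE. Qed.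

Lemma ecoef_scale b b' d (x : esp b d) : b = b' -> ecoef (ecoef x *: egen b' d) = ecoef x.
Proof. by move=> e; subst b'; rewrite -ecoef_span. Qed.

Lemma egen_scale b b' d : b = b' -> ecoef (egen b d) *: egen b' d = egen b' d.
Proof. by move=> e; subst b'; rewrite -ecoef_span. Qed.

Lemma gcast_egen b b' d (e : esp b = esp b') : b = b' -> gcast e (egen b d) = egen b' d.
Proof. by move=> bb; subst b'; rewrite gcast_id. Qed.

Lemma gcast_ecoef b b' d (e : esp b = esp b') (x : esp b d) : b = b' ->
  ecoef (gcast e x) = ecoef x.
Proof. by move=> bb; subst b'; rewrite gcast_id. Qed.

Lemma gcastZ (A B : gvs k) (e : A = B) d c (x : A d) : gcast e (c *: x) = c *: gcast e x.
Proof. by case: B / e. Qed.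

Lemma ecoef_scale_linear b d (V : lmodType k) (v : V) : linear (fun x : esp b d => ecoef x *: v).
Proof. by move=> c x y; rewrite ecoef_linear scalerDl scalerA. Qed.

(** Depends on the number of edges alone, so the equalities required of a collection hold literally
    and the action can be trivial. *)
Definition gsp (T : ggGrc) : gvs k := esp (ne T == 1)%N.

Definition gact (S T : ggGrc) (w : iso S T) d : {linear gsp T d -> gsp S d} :=
  mk_linear (ecoef_scale_linear (egen (ne S == 1)%N d)).

Lemma gactE (S T : ggGrc) (w : iso S T) d x : gact w d x = ecoef x *: egen (ne S == 1)%N d.
Proof. by []. Qed.

Lemma gact_id (T : ggGrc) d (x : gsp T d) : gact (iso_id T) d x = x.
Proof. by rewrite gactE -ecoef_span. Qed.

Lemma gact_comp (S T U : ggGrc) (g : iso T U) (f : iso S T) d (x : gsp U d) :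
  gact (iso_comp g f) d x = gact f d (gact g d x).
Proof. by rewrite !gactE ecoef_scale // (iso_ne g). Qed.

Lemma gsp_zero (T : ggGrc) : ne T = 0%N -> forall d (x : gsp T d), x = 0.
Proof. by move=> T0 d x; rewrite (ecoef_span x) ecoef_zero ?scale0r // T0 andbF. Qed.

Lemma gsp_fiber (T u : ggGrc) (f : mor T u) i : local_terminal u -> gsp (fiber f i) = gsp T.
Proof. by move=> tu; rewrite /gsp fiber_terminal_ne. Qed.

Lemma gsp_fiber_act (T S u : ggGrc) (w : iso T S) (f : mor S u) i
    (wi : iso (fiber (mcomp f w) i) (fiber f i)) :
    local_terminal u -> iso_mor wi = fiber_map w f i ->
    forall (eqT : gsp (fiber (mcomp f w) i) = gsp T)
      (eqS : gsp (fiber f i) = gsp S) d (x : gsp (fiber f i) d),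
    gcast eqT (gact wi d x) = gact w d (gcast eqS x).
Proof.
move=> tu _ eqT eqS d x; rewrite !gactE gcastZ gcast_egen ?gcast_ecoef // fiber_terminal_ne //.
Qed.

Definition edge_collection : collection k :=
  @Collection k gsp gact gact_id gact_comp gsp_zero gsp_fiber gsp_fiber_act.

Section Coefficients.
Variables (M : operad k) (f : coll_hom edge_collection M).

Definition gen_elt (T : ggGrc) : M T 0 := f T 0 (egen (ne T == 1)%N 0).

Lemma gen_elt_act (S T : ggGrc) (w : iso S T) : op_act M w 0 (gen_elt T) = gen_elt S.
Proof.
rewrite /gen_elt -ch_act; congr (f _ _ _); apply: etrans (gactE _ _) _.
by rewrite egen_scale // (iso_ne w).
Qed.

Lemma gen_elt_eq (F T u : ggGrc) (p : mor T u) i : local_terminal u -> elem F p i ->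
  forall eq : M F = M T, gcast eq (gen_elt F) = gen_elt T.
Proof.
move=> tu hp eq; have e : (ne F == 1%N) = (ne T == 1%N).
  by case: hp => _ <-; rewrite fiber_terminal_ne.
have eqE : gsp F = gsp T by rewrite /gsp e.
by rewrite /gen_elt -(ch_eq f tu hp (eqE : edge_collection F = edge_collection T)) gcast_egen.
Qed.

End Coefficients.

Lemma operad_hom_iterval (M N : operad k) (g : operad_hom M N)
    (cM : forall T : ggGrc, M T 0) (cN : forall T : ggGrc, N T 0) :
  (forall T, g T 0 (cM T) = cN T) ->
  forall n T s y, @iterval k M cM n T s y -> @iterval k N cN n T s (g T 0 y).
Proof.
move=> gc; elim=> [|n IH] T s y.
  by case=> -> [U [t [hU ->]]]; split=> //; exists U, t, hU; rewrite oh_act oh_unit.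
case=> T' [S [F [w [f [i [hf [h [s' [y' [fh -> -> /IH ity]]]]]]]]]].
exists T', S, F, w, f, i, hf, h, s', (g S 0 y'); split=> //.
by rewrite oh_act oh_comp gc.
Qed.

Notation fop := (free_operad k).

(** For a one-edge graph the two half-edges give the same class, whose indicator is this constant;
    no half-edge has to be chosen. *)
Definition free_one (T : ggGrc) d : free_sp k T d := [ffun=> 1 : k^o].

Lemma free_one_single (T : ggGrc) h d : gordering T [:: h] -> free_one T d = free_cls k d [:: h].
Proof.
move=> oh; apply/ffunP=> x; rewrite !ffunE; have /and3P[_ ox /eqP xr] := valP x.
have : size (val x) = 1%N by rewrite (ordering_ne ox) -(ordering_ne oh).
case: (val x : seq _) ox xr => [|g [|]] //= og <- _.
have hh : flip T h != h by apply: (ordering_neq oh); rewrite inE.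
suff e : eqv (vtx T) (flip T) [:: h] [:: g] by rewrite (eqv_rep_eq e) eqxx.
have : g \in [:: h; flip T h].
  by rewrite (perm_mem oh) mem_enum inE (ordering_neq og) // inE.
rewrite !inE => /orP[]/eqP ->; first exact: rst_refl.
by apply: rst_step; apply: (@StepFlip _ _ _ _ [::]).
Qed.

Lemma ordering_single (T : ggGrc) : ne T = 1%N -> exists h, gordering T [:: h].
Proof.
move=> T1; have [s os] := ordering_exists T; have := ordering_ne os; rewrite T1.
by case: s os => [|h [|]] // oh _; exists h.
Qed.

Definition free_iota (T : ggGrc) d : {linear edge_collection T d -> fop T d} :=
  mk_linear (ecoef_scale_linear (free_one T d) : linear (fun x : gsp T d => _)).

Lemma fiotaE (T : ggGrc) d x : free_iota T d x = ecoef (x : gsp T d) *: free_one T d.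
Proof. by []. Qed.

Lemma gsp_ind (T : ggGrc) d (x : gsp T d) : ecoef x = 0 \/ d = 0 /\ ne T = 1%N.
Proof.
case e : ((d == 0) && (ne T == 1%N)); last by left; apply: ecoef_zero.
by right; case/andP: e => /eqP -> /eqP.
Qed.

Lemma free_iota_act (S T : ggGrc) (w : iso S T) d (x : edge_collection T d) :
  free_iota S d (co_act edge_collection w d x) = op_act fop w d (free_iota T d x).
Proof.
rewrite !fiotaE [co_act _ _ _ _]gactE ecoef_scale ?(iso_ne w) // linearZ_LR.
have [->|[d0 T1]] := gsp_ind x; first by rewrite !scale0r.
have [h oh] := ordering_single T1; congr (_ *: _).
have ow : gordering S [:: hmap w h].
  by rewrite -[[:: _]]/(map (hmap w) [:: h]) (ordering_full _ (iso_codom w)).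
by rewrite (free_one_single _ oh) (free_one_single _ ow) [RHS]free_act_cls.
Qed.

Lemma free_iota_eq (F T u : ggGrc) (f : mor T u) i : local_terminal u -> elem F f i ->
  forall (eqE : edge_collection F = edge_collection T) (eqM : fop F = fop T) d x,
  free_iota T d (gcast eqE x) = gcast eqM (free_iota F d x).
Proof.
move=> tu [fe eF]; subst F => eqE eqM d x.
rewrite !fiotaE gcastZ [ecoef _]gcast_ecoef ?fiber_terminal_ne //.
have [->|[d0 F1]] := gsp_ind x; first by rewrite !scale0r.
have [h oh] := ordering_single F1; congr (_ *: _).
have [_ oE cE] := free_sp_fiber k f i tu.
have oh' := oh; rewrite oE in oh'.
by rewrite (free_one_single _ oh) [RHS]cE; apply: free_one_single.
Qed.

Definition edge_iota : coll_hom edge_collection fop := CollHom free_iota_act free_iota_eq.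

(** A basis vector of F is the iterated composite of generators along its own word. Hence the
    generators determine every morphism out of F. *)
Lemma free_iterval n (T : ggGrc) s z : @iterval k fop (gen_elt edge_iota) n T s z -> z = free_cls k 0 s.
Proof.
elim: n T s z => [|n IH] T s z.
  case=> -> [U [t [hU ->]]]; apply: etrans (free_unit_act _ _ (trivial_local_terminal hU)) _.
  by rewrite scale1r.
move=> itz; have oz := iterval_ordering itz; move: itz.
case=> T' [S [F [w [f [i [hf [h [s' [y' [fh es -> ity]]]]]]]]]].
have os' := iterval_ordering ity; rewrite (IH _ _ _ ity) es; rewrite es in oz.
have F1 : ne F = 1%N.
  apply/eqP; rewrite -(eqn_add2l (ne S)) -(elem_ne hf) -(iso_ne w) -(ordering_ne oz).
  by rewrite -(ordering_ne os') /= size_map addn1.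
have [g og] := ordering_single F1.
have -> : gen_elt edge_iota F = free_cls k 0 [:: g].
  by rewrite /gen_elt [LHS]fiotaE F1 ecoef_gen // scale1r; apply: free_one_single.
have gg : flip F g != g by apply: (ordering_neq og); rewrite inE.
transitivity (free_act k w 0 (free_cls k 0 (map (fincl hf) [:: g] ++ map (hmap f) s'))).
  by congr (free_act _ _ _ _); apply: free_comp_cls.
rewrite free_act_cls ?fincl_ordering // map_cat -!map_comp.
have -> : map (hmap w \o hmap f) s' = map (hmap (mcomp f w)) s'.
  by apply: eq_map => a; rewrite mcomp_hmap.
(* The fiber's only edge is the contracted one, so its chosen half maps to [h] or to the flip of
   [h], and both give the same class. *)
have : hmap w (fincl hf g) \notin codom (hmap (mcomp f w)) by rewrite mcomp_codom fincl_inner.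
rewrite fh => /orP[]/eqP /= -> //.
apply: (ocls_step _ _); rewrite -{2}[h](@flipK T).
exact: (@StepFlip _ _ _ _ [::]).
Qed.

End Generators.

(** * The universal property *)

Section Freeness.
Variables (k : fieldType) (M : operad k) (f : coll_hom (edge_collection k) M).
Notation fop := (free_operad k).

Let c := gen_elt f.

(** [iterval] as a function; uniqueness makes the choice harmless, and the default 0 is taken only
    on sequences that are not orderings. *)
Definition oval (T : ggGrc) (s : seq 'I_(nh T)) : M T 0 :=
  match pselect (exists y, iterval c (size s) s y) with
  | left H => projT1 (cid H) | right _ => 0 end.

Lemma ovalE n (T : ggGrc) s y : iterval c n s y -> @oval T s = y.
Proof.
move=> sy; have sn := iterval_size sy; subst n; rewrite /oval.
case: pselect => [H|[]]; last by exists y.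
apply: (iterval_uniq (c := c)) sy; [exact: gen_elt_act | exact: gen_elt_eq |].
exact: (projT2 (cid H)).
Qed.

Lemma oval_iterval (T : ggGrc) s : gordering T s -> iterval c (size s) s (oval s).
Proof. by move=> os; have [y sy] := iterval_ex c os; rewrite (ovalE sy). Qed.

Lemma oval_step (T : ggGrc) s t : gordering T s -> gstep T s t -> oval s = oval t.
Proof.
move=> os st; apply/esym/ovalE; apply: iterval_step st _.
- exact: gen_elt_act.
- exact: gen_elt_eq.
exact: oval_iterval.
Qed.

Definition ovald (T : ggGrc) (d : int) (s : seq 'I_(nh T)) : M T d :=
  match d return M T d with Posz 0 => oval s | _ => 0 end.

Definition free_map (T : ggGrc) d : {linear fop T d -> M T d} :=
  mk_linear (oext_linear (ovald d) : linear (oext (ovald (T := T) d) : free_sp k T d -> _)).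

Lemma free_map_cls (T : ggGrc) s : gordering T s -> free_map T 0 (free_cls k 0 s) = oval s.
Proof. by move=> os; apply: (oext_cls (@flipK T)) => // t t'; exact: oval_step. Qed.

Lemma free_map_act (S T : ggGrc) (w : iso S T) d (x : fop T d) :
  free_map S d (op_act fop w d x) = op_act M w d (free_map T d x).
Proof.
move: x; apply: (@free_sp_lin_eq k T d) => [a x y|a x y|s d0 os]; try by rewrite !linearP.
subst d; rewrite [op_act fop _ _ _]free_act_cls // !free_map_cls ?(ordering_full _ (iso_codom w)) //.
apply: ovalE; apply: iterval_iso; exact: oval_iterval.
Qed.

Lemma free_map_comp (F T S : ggGrc) (p : mor T S) i (h : elem F p i) (d e n : int) (den : d + e = n)
    (a : fop S d) (b : fop F e) :
  free_map T n (op_comp h den a b) = op_comp h den (free_map S d a) (free_map F e b).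
Proof.
move: a; apply: (@free_sp_lin_eq k S d) => [r x y|r x y|v d0 ov]; rewrite ?linearP ?op_comp_linl ?linearP //.
move: b; apply: (@free_sp_lin_eq k F e) => [r x y|r x y|u e0 ou]; rewrite ?linearP ?op_comp_linr ?linearP //.
subst d e; have n0 : n = 0 by rewrite -den.
move: den; rewrite {}n0 => den; rewrite [op_comp _ _ _ _]free_comp_cls // !free_map_cls ?fincl_ordering //.
(* [iterval_comp] wants a nonempty word in the fiber; an empty one would mean a fiber without edges,
   which [elementary] excludes. *)
case: (eqVneq u [::]) => [u0|u0].
  have := elem_ne h; case: h => fe eF; case: F / eF u ou u0 => u ou u0 _.
  have /elementaryP[_ _ [g gi gc]] := fe.
  have := ordering_ne ou; rewrite u0 => /esym/ne0P H.
  have gin : g \in fhalf p i by rewrite inE gi.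
  have := fiber_nonfixed (enum_rank_in gin g : 'I_(nh (fiber p i))).
  by rewrite H eqxx enum_rankK_in // gc.
have [m um] : exists m, size u = m.+1 by case: u u0 {ou} => // x u _; exists (size u).
have itu := oval_iterval ou; rewrite um in itu.
rewrite (Prop_irrelevance den (addr0 0)).
by apply: ovalE; apply: iterval_comp itu (oval_iterval ov); [exact: gen_elt_act | exact: gen_elt_eq].
Qed.

Lemma free_map_unit (U : ggGrc) (hU : trivial U) r :
  free_map U 0 (op_unit fop hU r) = op_unit M hU r.
Proof.
have e1 : op_unit fop hU r = r *: free_cls k 0 [::] by [].
have e2 : op_unit M hU r = r *: op_unit M hU 1.
  by rewrite -linearZ_LR; congr (op_unit _ _ _); rewrite [RHS]mulr1.
rewrite e1 e2 linearZ_LR; congr (_ *: _).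
have oU : gordering U [::] by rewrite ordering_nil // local_terminal_ne // trivial_local_terminal.
rewrite free_map_cls //; apply: (@ovalE 0); split=> //; exists U, (iso_id U), hU.
by rewrite op_act_id.
Qed.

Definition free_hom : operad_hom fop M := OperadHom free_map_act free_map_comp free_map_unit.

Lemma free_hom_iota (T : ggGrc) d (x : edge_collection k T d) :
  free_hom T d (edge_iota k T d x) = f T d x.
Proof.
have -> : edge_iota k T d x = ecoef (x : gsp k T d) *: free_one k T d by [].
have [e|[d0 T1]] := gsp_ind x.
  have x0 : x = 0 by rewrite [LHS](ecoef_span (x : gsp k T d)) e scale0r.
  by rewrite e scale0r x0 !linear0.
subst d; have [h oh] := ordering_single T1.
rewrite [in RHS](ecoef_span (x : gsp k T 0)) !linearZ_LR; congr (_ *: _).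
rewrite (free_one_single _ _ oh) [LHS]free_map_cls //.
apply: etrans (_ : gen_elt f T = _) => //.
apply: (iterval_single (c := c)); [exact: gen_elt_act | exact: gen_elt_eq |].
exact: (oval_iterval oh).
Qed.

(** A morphism carries iterated composites to iterated composites, and by [free_iterval] each class
    is one. *)
Lemma free_hom_uniq (g : operad_hom fop M) :
  (forall T d (x : edge_collection k T d), g T d (edge_iota k T d x) = f T d x) ->
  forall T d (x : fop T d), g T d x = free_hom T d x.
Proof.
move=> gf T d; apply: (@free_sp_lin_eq k T d) => [a x y|a x y|s d0 os]; try by rewrite linearP.
subst d; rewrite [RHS]free_map_cls //; apply/esym.
have [z sz] := iterval_ex (gen_elt (edge_iota k)) os.
have ez := free_iterval sz; rewrite ez in sz.
by apply: ovalE; apply: (operad_hom_iterval (cN := c)) sz => S; exact: gf.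
Qed.

End Freeness.

Lemma edge_iota_free k : is_free (edge_iota k).
Proof.
move=> M _ f; exists (free_hom f); split; first exact: free_hom_iota.
exact: free_hom_uniq.
Qed.

(** * The weight grading *)

Section Weights.
Variable k : fieldType.
Notation fop := (free_operad k).

Lemma fop_one_connected : one_connected fop.
Proof.
move=> U hU; have U0 := local_terminal_ne (trivial_local_terminal hU).
have oU := ordering_nil U0.
split; last by move=> d d0; apply: osp_ind => [|a x y -> ->|s de] //;
  [rewrite scaler0 addr0 | rewrite de eqxx in d0].
pose g (x : free_sp k U 0) : k^o := oext (fun _ => 1 : k^o) x.
have gl : linear g := oext_linear _.
have g1 : g (free_cls k 0 [::]) = 1 by apply: (oext_cls (@flipK U)).
have gZ r x : g (r *: x) = r *: g x by have := gl r x 0; rewrite !addr0 (linear_at0 gl) addr0.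
have uE r : op_unit fop hU r = r *: free_cls k 0 [::] by [].
exists g => [r|]; first by rewrite uE gZ g1 [LHS]mulr1.
apply: (@free_sp_lin_eq k U 0) => [a x y|//|s _ os]; first by rewrite gl linearP.
have -> : s = [::] by apply: size0nil; rewrite (ordering_ne os).
by rewrite g1 uE scale1r.
Qed.

Lemma free_one_scale_inj (T : ggGrc) d : d = 0 -> ne T = 1%N -> injective (fun r : k => r *: free_one k T d).
Proof.
move=> d0 T1 r r' rr'; have [h oh] := ordering_single T1.
have gl := oext_linear (fun _ => 1 : k^o) : linear (fun x : free_sp k T d => oext _ x).
have g1 t : oext (fun _ => 1 : k^o) (t *: free_one k T d : free_sp k T d) = t.
  rewrite -[_ *: _]addr0 gl (linear_at0 gl) addr0 (free_one_single _ d oh).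
  by rewrite (oext_cls (@flipK T)) // [LHS]mulr1.
by rewrite -(g1 r) rr' g1.
Qed.

(** Every generator has one edge, so F(T) lies entirely in the weight given by the number of edges
    of [T]. *)
Definition edge_weight (n : nat) : Defs.family fop := fun T d x => ne T = n \/ x = 0.

Lemma fop_weight_grading : weight_grading (edge_iota k) edge_weight.
Proof.
split.
- move=> n; split=> [T d|T d a x y|S T w d x]; first by right.
    by case=> [Tn _|->]; [left | case=> [Tn|->]; [left | right; rewrite scaler0 addr0]].
  by move=> [Tn|->]; [left; rewrite (iso_ne w) | right; rewrite linear0].
- move=> T d x; exists (ne T).+1, (fun i => if i == ord_max then x else 0); split.
    by move=> i; case: eqP => [->|_]; [left | right].
  by rewrite -big_mkcond big_pred1_eq.
- move=> T d n w Ww; have w0 (i : 'I_n) : ne T != i -> w i = 0.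
    by move=> Ti; case: (Ww i) => // e; rewrite e eqxx in Ti.
  move=> sw i; have [Ti|/w0 //] := eqVneq (ne T) i.
  rewrite -sw (bigD1 i) //= big1 ?addr0 // => j ji; apply: w0.
  by rewrite Ti eq_sym; apply: contraNneq ji => /val_inj ->.
- move=> G T S p i h d e n den s t a b [Ss|->].
    by case=> [Gt|->]; [left; rewrite (elem_ne h) Ss Gt | right; apply: linear_at0; apply: op_comp_linr].
  by move=> _; right; apply: (linear_at0 (f := fun a => op_comp h den a b)); apply: op_comp_linl.
- by [].
- move=> T d x; split=> [[T1|->]|[y ->]]; last first.
  + have [e|[_ T1]] := gsp_ind y; last by left.
    by right; have -> : edge_iota k T d y = ecoef (y : gsp k T d) *: free_one k T d by []; rewrite e scale0r.
  + by exists 0; rewrite linear0.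
  have [h oh] := ordering_single T1.
  suff [r xr] : exists r : k, x = r *: free_one k T d.
    have [d0|d0] := eqVneq d 0.
      exists (r *: egen k (ne T == 1%N) d); rewrite linearZ_LR xr; congr (_ *: _).
      have -> : edge_iota k T d (egen k (ne T == 1%N) d) = ecoef (egen k (ne T == 1%N) d) *: free_one k T d by [].
      by rewrite T1 ecoef_gen // scale1r.
    exists 0; rewrite linear0; move: x {xr}; apply: osp_ind => [|a x y -> ->|s de] //.
      by rewrite scaler0 addr0.
    by rewrite de eqxx in d0.
  move: x; apply: osp_ind => [|a x y [r ->] [r' ->]|s d0 os].
  + by exists 0; rewrite scale0r.
  + by exists (a * r + r'); rewrite scalerDl scalerA.
  exists 1; rewrite scale1r; have := ordering_ne os; rewrite T1.
  by case: s os => [|g [|]] // og _; apply/esym/free_one_single.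
move=> T d x y xy; rewrite (ecoef_span (x : gsp k T d)) (ecoef_span (y : gsp k T d)); congr (_ *: _).
have [dT|dT] := boolP ((d == 0) && (ne T == 1%N)); last by rewrite !ecoef_zero //; apply: negbTE.
by case/andP: dT => /eqP d0 /eqP T1; apply: (free_one_scale_inj d0 T1) xy.
Qed.

End Weights.

(** * Quadraticity *)

(** A converse of [ordering_comp]: cancelling the edges coming from [S] leaves exactly the
    contracted ones. *)
Lemma ordering_fiber (T S : ggGrc) (f : mor T S) i u r : elementary f i ->
  gordering T (map (fun h : 'I_(nh (fiber f i)) => enum_val h) u ++ map (hmap f) r) ->
  gordering S r -> gordering (fiber f i) u.
Proof.
move=> fe oT oS; set eu := map _ u in oT.
have fm := mor_specP f.
have H : perm_eq (eu ++ map (flip T) eu) (enum [pred h | h \notin codom (hmap f)]).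
  rewrite -(perm_cat2r (map (hmap f) (enum [pred h | flip S h != h]))).
  rewrite (permPr (nonfixed_split f)) -(permPr oT) map_cat perm_sym perm_catACA perm_cat2l.
  have -> : map (flip T) (map (hmap f) r) = map (hmap f) (map (flip S) r).
    by rewrite -!map_comp; apply/eq_map => h /=; rewrite (mor_flip fm).
  by rewrite -map_cat perm_map.
have e : map (flip T) eu = map (fun h : 'I_(nh (fiber f i)) => enum_val h) (map (flip (fiber f i)) u).
  rewrite -!map_comp; apply/eq_in_map => h hu /=; rewrite fiber_flip // fiber_nonfixed.
  by have := perm_mem H (enum_val h); rewrite mem_cat map_f //= mem_enum inE => <-.
apply: (perm_map_inj enum_val_inj); rewrite map_cat -e.
by rewrite (permPr (fiber_nonfixed_perm (fun h => elementary_inner fe))).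
Qed.

Lemma ordering_swap m (fl : {ffun 'I_m -> 'I_m}) h g s :
  ordering fl (h :: g :: s) = ordering fl (g :: h :: s).
Proof.
have /permPl e : perm_eq ((h :: g :: s) ++ map fl (h :: g :: s)) ((g :: h :: s) ++ map fl (g :: h :: s)).
  by apply/seq.permP=> p; rewrite /= !count_cat /=; lia.
by rewrite /ordering e.
Qed.

Section Quotient.
Variable k : fieldType.
Notation fop := (free_operad k).
Notation one := (terminal_operad k).

Lemma terminal_one_connected : one_connected one.
Proof.
move=> U hU; split; first by exists id.
by move=> d d0 x; rewrite -[LHS]keltK kval_out // kelt0.
Qed.

Lemma term_gen_linear (T : ggGrc) d : linear (fun x : gsp k T d => kelt d (ecoef x)).
Proof. by move=> c x y; rewrite ecoef_linear -kelt_linear. Qed.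

Definition term_gen (T : ggGrc) d : {linear edge_collection k T d -> one T d} :=
  mk_linear (@term_gen_linear T d).

Lemma term_gen_act (S T : ggGrc) (w : iso S T) d (x : edge_collection k T d) :
  term_gen S d (co_act (edge_collection k) w d x) = op_act one w d (term_gen T d x).
Proof. by congr (kelt d _); rewrite [co_act _ _ _ _]gactE ecoef_scale ?(iso_ne w). Qed.

Lemma term_gen_eq (F T u : ggGrc) (f : mor T u) i : local_terminal u -> elem F f i ->
  forall (eqE : edge_collection k F = edge_collection k T) (eqM : one F = one T) d x,
  term_gen T d (gcast eqE x) = gcast eqM (term_gen F d x).
Proof.
move=> tu [fe eF]; subst F => eqE eqM d x; rewrite gcast_id; congr (kelt d _).
by rewrite [LHS]gcast_ecoef // fiber_terminal_ne.
Qed.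

Definition term_coll : coll_hom (edge_collection k) one := CollHom term_gen_act term_gen_eq.

Definition free_pi : operad_hom fop one := free_hom term_coll.

(** The value is a product of units and generators, all equal to 1. *)
Lemma free_pi_cls (T : ggGrc) d s : d = 0 -> gordering T s -> kval (free_pi T d (free_cls k d s)) = 1.
Proof.
move=> d0 os; subst d; rewrite [free_pi _ _ _]free_map_cls //.
have := oval_iterval term_coll os; move: (oval _ _) => y.
move: (size s) => n; elim: n T s os y => [|n IH] T s os y.
  by case=> _ [U [t [hU ->]]].
move=> ity; have := ity; case=> T' [S [F [w [f [i [hf [h [s' [y' [fh es -> ity']]]]]]]]]].
have os' := iterval_ordering ity'.
have F1 : ne F = 1%N.
  apply/eqP; rewrite -(eqn_add2l (ne S)) -(elem_ne hf) -(iso_ne w) -(ordering_ne os).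
  by rewrite es -(ordering_ne os') /= size_map addn1.
rewrite [kval _]kval_mul ?addr0 // (IH _ _ os' _ ity') mul1r.
have : ecoef (egen k (ne F == 1%N) 0) = 1 by rewrite F1 ecoef_gen.
exact.
Qed.

Lemma free_pi_surj (T : ggGrc) d y : exists x, free_pi T d x = y.
Proof.
have [d0|d0] := eqVneq d 0; last first.
  by exists 0; rewrite linear0; apply: kval_inj; rewrite kval_out // kval_out.
have [s os] := ordering_exists T; exists (kval y *: free_cls k d s).
by rewrite linearZ_LR; apply: kval_inj; rewrite kvalZ free_pi_cls // mulr1.
Qed.

(** The whole kernel in weight 2, rather than the span of differences of words, so closure under the
    action is immediate. *)
Definition free_rel : Defs.family fop := fun T d x => edge_weight 2 x /\ free_pi T d x = 0.

Lemma free_rel_subpresheaf : subpresheaf free_rel.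
Proof.
have [W0 Wl Wa] := wg_sub (fop_weight_grading k) 2.
split=> [T d|T d c x y [x1 x2] [y1 y2]|S T w d x [x1 x2]].
- by split; [exact: W0 | rewrite linear0].
- by split; [exact: Wl | rewrite linearP x2 y2 scaler0 addr0].
by split; [exact: Wa | rewrite oh_act x2 linear0].
Qed.

Lemma free_pi_ker_ideal : ideal (fun T d x => free_pi T d x = 0).
Proof.
split; first split=> [T d|T d c x y x0 y0|S T w d x x0].
- by rewrite linear0.
- by rewrite linearP x0 y0 scaler0 addr0.
- by rewrite oh_act x0 linear0.
move=> F T S f i h p q n e a b ab; rewrite oh_comp; case: ab => ->.
  exact: (linear_at0 (op_comp_linl h e _)).
exact: (linear_at0 (op_comp_linr h e _)).
Qed.

(** * Congruence of orderings modulo an ideal containing the relations *)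

Section Congruence.
Variable I : Defs.family fop.
Hypotheses (I_ideal : ideal I) (I_rel : forall T d x, free_rel (T := T) (d := d) x -> I x).

Let I0 (T : ggGrc) d : I (0 : fop T d). Proof. by case: I_ideal => -[]. Qed.

Let Il (T : ggGrc) d c (x y : fop T d) : I x -> I y -> I (c *: x + y).
Proof. by case: I_ideal => -[_ H _] _; apply: H. Qed.

Let Ia (S T : ggGrc) (w : iso S T) d (x : fop T d) : I x -> I (op_act fop w d x).
Proof. by case: I_ideal => -[_ _ H] _; apply: H. Qed.

Let Ic (F T S : ggGrc) (f : mor T S) i (h : elem F f i) (p q n : int) (e : p + q = n)
    (a : fop S p) (b : fop F q) : I a \/ I b -> I (op_comp h e a b).
Proof. by case: I_ideal => _; apply. Qed.

Definition cong (T : ggGrc) (s t : seq 'I_(nh T)) : Prop :=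
  I (free_cls k 0 s - free_cls k 0 t : fop T 0).

Lemma cong_refl T s : @cong T s s.
Proof. by rewrite /cong subrr. Qed.

Lemma cong_trans T s t r : @cong T s t -> cong t r -> cong s r.
Proof.
rewrite /cong => st tr; have := Il 1 st tr; rewrite scale1r.
by rewrite addrA subrK.
Qed.

Lemma cong_eqv (T : ggGrc) s t : gstep T s t -> cong s t.
Proof. by move=> st; rewrite /cong /free_cls (ocls_step _ _ st) subrr. Qed.

Lemma linear_atB (U V : lmodType k) (f : U -> V) : linear f -> forall x y, f (x - y) = f x - f y.
Proof. by move=> lf x y; rewrite addrC -scaleN1r lf scaleN1r addrC. Qed.

(** Prepending an edge is composing with a generator and relabelling, a linear operation that
    preserves the ideal. *)
Lemma cong_cons (T S : ggGrc) (p : mor T S) h s t : one_edge p h ->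
  gordering S s -> gordering S t -> cong s t ->
  cong (h :: map (hmap p) s) (h :: map (hmap p) t).
Proof.
move=> ph os ot st; have [T' [w [f [fw fe]]]] := one_edge_elementary ph.
pose hf : elem (fiber f (vmap p (vtx T h))) f (vmap p (vtx T h)) := conj fe erefl.
pose g (a : fop S 0) : fop T 0 := op_act fop w 0 (op_comp hf (addr0 0) a (gen_elt (edge_iota k) _)).
have H r : gordering S r -> free_cls k 0 (h :: map (hmap p) r) = g (free_cls k 0 r).
  move=> orr; apply/esym/(@free_iterval k (size r).+1 T); rewrite -fw.
  have [z rz] := iterval_ex (gen_elt (edge_iota k)) orr; have zE := free_iterval rz; subst z.
  exists T', S, _, w, f, _, hf, h, r, (free_cls k 0 r); split=> //; by rewrite fw.
rewrite /cong !H // /g -linearB; apply: Ia.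
by rewrite -(linear_atB (op_comp_linl hf _ _)); apply: Ic; left.
Qed.

Lemma cong_swap (T S1 S2 : ggGrc) (p1 : mor T S1) (p2 : mor S1 S2) h g r :
  one_edge p1 h -> one_edge p2 g -> gordering S2 r ->
  cong (h :: hmap p1 g :: map (hmap (mcomp p2 p1)) r)
       (hmap p1 g :: h :: map (hmap (mcomp p2 p1)) r).
Proof.
move=> p1h p2g orr; set p := mcomp p2 p1; set g' := hmap p1 g.
have o1 : gordering T (h :: g' :: map (hmap p) r).
  have -> : g' :: map (hmap p) r = map (hmap p1) (g :: map (hmap p2) r).
    by rewrite map_cons -map_comp; congr (_ :: _); apply: eq_map => a; rewrite mcomp_hmap.
  by rewrite (ordering_one_edge _ p1h) (ordering_one_edge _ p2g).
have o2 : gordering T (g' :: h :: map (hmap p) r) by rewrite ordering_swap.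
have m1 := mor_specP p1; have pm := mor_specP p.
have hc : h \notin codom (hmap p).
  by apply: contraTN (_ : h \notin codom (hmap p1)) => [/mcomp_codomS ->|]; rewrite ?p1h ?eqxx.
have gc : g' \notin codom (hmap p) by rewrite mcomp_codom p2g eqxx.
have [hg|hg] := eqVneq (vmap p (vtx T h)) (vmap p (vtx T g')); last first.
  apply: cong_eqv; apply: (@StepSwap _ _ _ _ [::]); apply: (separated_mor (f := p)) => //.
  - exact: (mor_contr pm).
  - exact: (mor_contr pm).
set i := vmap p (vtx T g') in hg.
have pc a : a \notin codom (hmap p) -> vmap p (vtx T a) = i.
  have [/codomP[b ->]|ac _] := boolP (a \in codom (hmap p1)).
    by rewrite mcomp_codom => /(one_edge_vtx p2g) e; rewrite /i /p !mcomp_vmap !(mor_vtx m1) e.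
  by rewrite -hg /p !mcomp_vmap (one_edge_vtx p1h ac).
have [|T' [w [f [fw mono tr]]]] := @make_elementary _ _ p (pred1 i).
  by move=> a; apply: contraR => /pc /= ->.
have wm := mor_specP w.
have fe : elementary f i.
  apply/elementaryP; split=> //; exists (hmap (iso_inv w) h).
    by rewrite -hg -fw mcomp_vmap -{2}(iso_hmapVK w h) (mor_vtx wm).
  by rewrite -(mcomp_codom f w) fw iso_hmapVK.
have inF a : a \notin codom (hmap p) -> hmap (iso_inv w) a \in fhalf f i.
  by move=> ac; rewrite inE -(mor_vtx wm) iso_hmapVK -mcomp_vmap fw pc.
pose a : 'I_(nh (fiber f i)) := enum_rank_in (inF h hc) (hmap (iso_inv w) h).
pose b : 'I_(nh (fiber f i)) := enum_rank_in (inF g' gc) (hmap (iso_inv w) g').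
have aE : hmap w (enum_val a) = h by rewrite enum_rankK_in ?inF // iso_hmapVK.
have bE : hmap w (enum_val b) = g' by rewrite enum_rankK_in ?inF // iso_hmapVK.
have wE u : map (hmap w) (map (fun x : 'I_(nh (fiber f i)) => enum_val x) u ++ map (hmap f) r) =
    map (fun x : 'I_(nh (fiber f i)) => hmap w (enum_val x)) u ++ map (hmap p) r.
  rewrite map_cat -!map_comp; congr (_ ++ _).
  by apply: eq_map => x; rewrite -fw mcomp_hmap.
have oab : gordering (fiber f i) [:: a; b].
  apply: (ordering_fiber fe _ orr); rewrite -(ordering_full _ (iso_codom w)) wE.
  by rewrite /= aE bE.
have oba : gordering (fiber f i) [:: b; a] by rewrite ordering_swap.
pose hf : elem (fiber f i) f i := conj fe erefl.
have H u : gordering (fiber f i) u -> free_cls k 0 (map (fun x : 'I_(nh (fiber f i)) => hmap w (enum_val x)) u ++ map (hmap p) r) =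
    op_act fop w 0 (op_comp hf (addr0 0) (free_cls k 0 r : fop S2 0) (free_cls k 0 u : fop _ 0)).
  move=> ou; rewrite -wE; apply/esym.
  transitivity (free_act k w 0 (free_cls k 0 (map (fincl hf) u ++ map (hmap f) r))).
    by congr (free_act _ _ _ _); apply: free_comp_cls.
  by rewrite free_act_cls // fincl_ordering.
have mE x y : map (fun z : 'I_(nh (fiber f i)) => hmap w (enum_val z)) [:: x; y] ++ map (hmap p) r =
    hmap w (enum_val x) :: hmap w (enum_val y) :: map (hmap p) r by [].
have Hab := H _ oab; have Hba := H _ oba; rewrite mE aE bE in Hab; rewrite mE aE bE in Hba.
rewrite /cong Hab Hba -linearB; apply: Ia.
(* By linearity the difference is concentrated in the fiber, as the two orders of its two edges: it
   has weight 2, and both words have value 1. *)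
rewrite -(linear_atB (op_comp_linr hf _ _)); apply: Ic; right; apply: I_rel; split.
  by left; rewrite -(ordering_ne oab).
have pE u : gordering (fiber f i) u -> free_pi (fiber f i) 0 (free_cls k 0 u) = kelt 0 1.
  by move=> ou; apply: kval_inj; rewrite free_pi_cls // kval0K.
by rewrite linearB !pE // subrr.
Qed.

(** Induction on length. Words with the same first edge are compared after contracting it. If the
    first edges h and g differ, any word r in the remaining edges links them: h s to h g r, by
    [cong_swap] to g h r, and then to g t, the outer links sharing their first edge. *)
Lemma cong_ordering (T : ggGrc) s t : gordering T s -> gordering T t -> cong s t.
Proof.
move: {2}(size s) (erefl (size s)) => n; elim: n T s t => [|n IH] T s t sn os ot.
  have t0 : size t = 0%N by rewrite (ordering_ne ot) -(ordering_ne os).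
  by rewrite (size0nil sn) (size0nil t0); apply: cong_refl.
have tn : size t = n.+1 by rewrite (ordering_ne ot) -(ordering_ne os).
case: s sn os => // h s [sn] os; case: t tn ot => // g t [tn] ot.
have hh : flip T h != h by apply: (ordering_neq os); rewrite mem_head.
have gg : flip T g != g by apply: (ordering_neq ot); rewrite mem_head.
have same x u v : flip T x != x -> gordering T (x :: u) -> gordering T (x :: v) -> size u = n ->
    cong (x :: u) (x :: v).
  move=> xx ou ov un; have [S [p px]] := contract_edge xx.
  have [u' eu ou'] := ordering_tail px ou; have [v' ev ov'] := ordering_tail px ov.
  subst u v; apply: cong_cons => //; apply: IH => //.
  by rewrite -un size_map.
have [S1 [p1 p1h]] := contract_edge hh.
(* If [g] does not survive the contraction of [h], it is a half of the same edge, and a flip makes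
   the first letters equal. *)
have [gc|gc] := boolP (g \in codom (hmap p1)); last first.
  move: gc; rewrite p1h => /orP[]/eqP gh; subst g; first exact: same.
  have st : gstep T (flip T h :: t) (h :: t).
    by rewrite -{2}[h](@flipK T); apply: (@StepFlip _ _ _ _ [::]).
  apply: (@cong_trans _ _ (h :: t)).
    by apply: same => //; rewrite -(step_ordering (@flipK T) st).
  by apply: cong_eqv; apply: step_sym => //; exact: flipK.
case/codomP: gc => g1 eg; subst g.
have gg1 : flip S1 g1 != g1.
  by rewrite -(inj_eq (mor_inj (mor_specP p1))) (mor_flip (mor_specP p1)).
have [S2 [p2 p2g]] := contract_edge gg1; have [r orr] := ordering_exists S2.
have o1 : gordering T (h :: hmap p1 g1 :: map (hmap (mcomp p2 p1)) r).
  have -> : hmap p1 g1 :: map (hmap (mcomp p2 p1)) r = map (hmap p1) (g1 :: map (hmap p2) r).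
    by rewrite map_cons -map_comp; congr (_ :: _); apply: eq_map => a; rewrite mcomp_hmap.
  by rewrite (ordering_one_edge _ p1h) (ordering_one_edge _ p2g).
apply: cong_trans (same _ _ _ hh os o1 sn) _.
apply: cong_trans (cong_swap p1h p2g orr) _.
apply: same => //; first by rewrite ordering_swap.
have := ordering_ne o1; rewrite -(ordering_ne ot) /= => -[->].
exact: tn.
Qed.


End Congruence.

Lemma free_pi_quotient : is_quotient (ideal_gen free_rel) free_pi.
Proof.
move=> T d; split=> [y|x]; first exact: free_pi_surj.
split=> [x0 I I_ideal I_rel|]; last first.
  move=> H; apply: (H (fun T d x => free_pi T d x = 0)) => [|T' d' y []//].
  exact: free_pi_ker_ideal.
have [s0 os0] := ordering_exists T.
(* Modulo the ideal every class equals that of one reference word [s0], so F(T) collapses to a line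
   on which [free_pi] is the coordinate; an element of the kernel then lies in the ideal. *)
suff H (z : fop T d) : I T d (z - kval (free_pi T d z) *: free_cls k d s0).
  have := H x; rewrite x0 (_ : kval (0 : kgr k d) = 0) ?scale0r ?subr0 //.
  by rewrite -[0](kelt0 k d) -[kelt d 0]/(kelt d 0); have := kvalZ 0 (0 : kgr k d); rewrite scale0r mul0r kelt0.
have [[I0 Il _] _] := I_ideal.
move: z; apply: osp_ind => [|c x1 x2 I1 I2|s d0 os].
- by rewrite linear0; have := kvalZ 0 (0 : kgr k d); rewrite scale0r mul0r => ->; rewrite scale0r subr0.
- rewrite linearP kval_linear.
  rewrite (_ : _ - _ = c *: (x1 - kval (free_pi T d x1) *: free_cls k d s0) +
    (x2 - kval (free_pi T d x2) *: free_cls k d s0)); first exact: Il.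
  by rewrite scalerDl scalerBr scalerA opprD addrACA.
rewrite free_pi_cls // scale1r; subst d; exact: (cong_ordering I_ideal I_rel).
Qed.

End Quotient.

Theorem theorem5p10 (k : fieldType) (hk : [pchar k]%R =i pred0) :
  binary_quadratic (terminal_operad k).
Proof.
split; first exact: terminal_one_connected.
exists (edge_collection k); split; last first.
  move=> T d x; apply: contraNeq => T1.
  by rewrite (ecoef_span (x : gsp k T d)) ecoef_zero ?scale0r // (negbTE T1) andbF.
exists (free_operad k), (edge_iota k), (@edge_weight k), (@free_rel k), (terminal_operad k), (free_pi k).
split.
- split; [exact: fop_one_connected | exact: edge_iota_free].
- exact: fop_weight_grading.
- by split; [exact: free_rel_subpresheaf | move=> T d x []].
- exact: free_pi_quotient.
exists (@OperadHom k (terminal_operad k) (terminal_operad k)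
  (fun T d => idfun : {linear kgr k d -> kgr k d}) (fun _ _ _ _ _ => erefl)
  (fun _ _ _ _ _ _ _ _ _ _ _ _ => erefl) (fun _ _ _ => erefl)).
by move=> T d; exists id.
Qed.
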